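(* We have $\mathrm{Aut}_4(J)=\mathrm{Inn}(J)\mathrm{Aut}_3(J)$, $\mathrm{Aut}(J)=\langle\theta\rangle\mathrm{Aut}_4(J)$, and $|\mathrm{Aut}(J)|=2p^{8m}$.
   Context: $p$ is an odd prime, $m\geq 1$ an integer, and $\alpha>1$ an integer with $v_p(\alpha-1)=m$ ($v_p$ is the $p$-adic valuation); if $p=3$ and $m=1$, it is also assumed that $(\alpha-1)/3\equiv 1\bmod 3$. Conventions: $[x,y]=x^{-1}y^{-1}xy$, $x^y=y^{-1}xy$. $J$ is the group (a finite $p$-group of order $p^{7m}$ and nilpotency class 5) $$J=\langle A,B\,|\,A^{[A,B]}=A^\alpha,\ B^{[B,A]}=B^\alpha,\ A^{p^{3m}}=B^{p^{3m}}=1\rangle,$$ and $\theta$ is the automorphism of $J$ interchanging $A$ and $B$. For a group $T$, $1=Z_0(T)\subseteq Z_1(T)=Z(T)\subseteq Z_2(T)\subseteq\cdots$ is the upper central series, $\mathrm{Aut}_i(T)$ is the kernel of the canonical map $\mathrm{Aut}(T)\to\mathrm{Aut}(T/Z_i(T))$, and $\mathrm{Inn}(T)$ is the group of inner automorphisms. *)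

(* Defs.v *)
From mathcomp Require Import all_boot all_fingroup all_solvable.

Set Implicit Arguments.
Unset Strict Implicit.
Unset Printing Implicit Defensive.

Local Open Scope group_scope.

(* Automorphisms of T are the elements of Aut T, i.e. permutations of the
   ambient type that fix every point outside T.  The canonical map
   Aut T -> Aut (T / 'Z_i(T)) is the permutation morphism of the action of
   Aut T induced on cosets of 'Z_i(T); its domain is all of Aut T and its image
   lies in Aut (T / 'Z_i(T)), by the lemmas below. *)
Definition can_aut (gT : finGroupType) (T : {group gT}) (i : nat) :=
  actperm_morphism ([Aut T] / 'Z_i(T))%act.

Definition Auti (gT : finGroupType) (T : {group gT}) (i : nat)
  : {set {perm gT}} := 'ker (can_aut T i).

Definition Inn (gT : finGroupType) (T : {group gT}) : {set {perm gT}} :=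
  conj_aut T @* T.

Lemma dom_can_aut (gT : finGroupType) (T : {group gT}) (i : nat) :
  'dom (can_aut T i) = Aut T.
Proof.
have sZT : 'Z_i(T) \subset T by apply: gFsub.
have chZ : 'Z_i(T) \char T by apply: gFchar.
rewrite /dom (qact_domE [Aut T] sZT); apply/setP => f.
apply/idP/idP => [/setIP[]//|Af]; rewrite in_setI Af /= inE.
apply/subsetP => x Zx; rewrite inE -[_ x f]/(f x) -(autmE Af).
have /charP[_ /(_ _ (injm_autm Af) (im_autm Af)) imZ] := chZ.
by rewrite -imZ mem_morphim // (subsetP sZT).
Qed.

Lemma can_aut_coset (gT : finGroupType) (T : {group gT}) (i : nat)
    (f : {perm gT}) (x : gT) :
  f \in Aut T -> x \in T ->
  can_aut T i f (coset 'Z_i(T) x) = coset 'Z_i(T) (f x).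
Proof.
move=> Af Tx; rewrite /= actpermE qactE //; last first.
  by rewrite -[qact_dom _ _]/('dom (can_aut T i)) dom_can_aut.
by apply: (subsetP (normal_norm (ucn_normal i T))).
Qed.

Lemma im_can_aut (gT : finGroupType) (T : {group gT}) (i : nat) :
  can_aut T i @* Aut T \subset Aut (T / 'Z_i(T)).
Proof.
apply/subsetP => _ /morphimP[f _ Af ->].
apply: (@qact_is_groupAction _ _ _ _ [Aut T]%gact 'Z_i(T)%G f).
by rewrite -[qact_dom _ _]/('dom (can_aut T i)) dom_can_aut.
Qed.

Lemma AutiP (gT : finGroupType) (T : {group gT}) (i : nat) (f : {perm gT}) :
  reflect (f \in Aut T /\
           {in T, forall x, coset 'Z_i(T) (f x) = coset 'Z_i(T) x})
          (f \in Auti T i).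
Proof.
have nTZ : T \subset 'N('Z_i(T)) := normal_norm (ucn_normal i T).
apply: (iffP idP) => [kf | [Af fZ]].
  have Af : f \in Aut T by rewrite -(dom_can_aut T i) (dom_ker kf).
  by split=> // x Tx; rewrite -can_aut_coset // (mker kf) perm1.
have Df : f \in 'dom (can_aut T i) by rewrite dom_can_aut.
apply/kerP => //; apply/permP => u; rewrite perm1.
case: (cosetP u) => x Nx ->; rewrite /= actpermE qactE //=.
case Tx: (x \in T); first exact: fZ.
by rewrite -[_ x f]/(f x) (out_Aut Af) ?Tx.
Qed.

(* Main.v *)
(* Put x = alpha - 1, q = p^m and C = [A, B].  Computing [A, B^alpha] in two ways
   shows that A^(q^2) is central and A^(q^2) B^(q^2) = 1.  Hence every group
   generated by a pair satisfying the relations is exhausted by the chain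
     <A^(q^2)> < .. <C^q> < .. <A^q>, <B^q> < .. <C> < .. <A> < .. <B>
   and has order at most q^7; a permutation model shows that J attains this
   bound, and then the first four of these steps are Z_1, Z_2, Z_3, Z_4.
   By maximality, a generating pair (A', B') of J satisfying the relations always
   comes from an automorphism: the subgroup of J * J generated by (A, A') and
   (B, B') is no larger than J, hence it is a graph.  So Aut_3 corresponds to the
   pairs (z, w) in Z_3 * Z_3 for which (A z, B w) satisfies the relations; these
   form the kernel of a homomorphism onto Z_1 * Z_1, whence |Aut_3| = q^6.
   Conjugation by A^-l B^k multiplies A by C^k and B by C^l modulo Z_3, so
   Aut_4 = Inn Aut_3.  Finally write A -> A^i B^j, B -> A^k B^l modulo Z_4 for an
   arbitrary automorphism.  The relations modulo Z_2 force, up to theta,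
   j = k = 0 and i l = 1 mod q, and the relations modulo Z_1 then force
   i = l = 1 mod q. *)

Require Import Defs.
From mathcomp Require Import all_boot all_fingroup all_solvable.
From mathcomp Require Import all_algebra.
From mathcomp Require Import ring zify.

Set Implicit Arguments.
Unset Strict Implicit.
Unset Printing Implicit Defensive.

(** * Valuations *)

Section NumberTheory.

(** Collecting x-th powers leaves binomials C(x,3), whose denominator makes p = 3 delicate. C(x,3)
    is 0 modulo p, except for p = 3 and m = 1, where it is x/3 modulo 3. Two quantities must be
    prime to p: 1 - 2 C(x,3), which makes A^(q^2) central, and 2 - C(x,3), which makes the
    homomorphism to Z_1 * Z_1 surjective. In the exceptional case both vanish modulo 3 exactly when
    x/3 = 2 modulo 3. The relations bound the order of a group only from above, so a concrete group
    is needed for the lower bound. It is modelled on the action of J on the right cosets of <C>,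
    written <C> B^j A^i; there are q^5 of them, because B^(q^2) A^(q^2) = 1 identifies (j, i) with
    (j + q^2, i + q^2). Exponents are natural numbers, so q - 1 and p - 1 often stand for -1. *)

Definition geom (a n : nat) := \sum_(k < n) a ^ k.

Lemma geom0 a : geom a 0 = 0. Proof. by rewrite /geom big_ord0. Qed.
Lemma geomS a n : geom a n.+1 = geom a n + a ^ n.
Proof. by rewrite /geom big_ord_recr. Qed.
Lemma geomSr a n : geom a n.+1 = (a * geom a n).+1.
Proof. by rewrite /geom big_ord_recl big_distrr /= expn0 add1n; congr _.+1;
  apply: eq_bigr => k _; rewrite -expnS. Qed.

Lemma geom_pred x n : x * geom x.+1 n = x.+1 ^ n - 1.
Proof.
elim: n => [|n IH]; first by rewrite geom0 muln0.
rewrite geomS mulnDr IH expnS mulSn; have := expn_gt0 x.+1 n; lia.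
Qed.

Lemma exp_expand x n :
  exists z, x.+1 ^ n = 1 + n * x + 'C(n, 2) * x ^ 2 + x ^ 3 * z.
Proof.
elim: n => [|n [z E]]; first by exists 0; rewrite expn0 bin0n !mul0n muln0.
exists ('C(n, 2) + z * x.+1); rewrite expnS E binS bin1; ring.
Qed.

Lemma geom_expand x n :
  exists z, geom x.+1 n = n + 'C(n, 2) * x + 'C(n, 3) * x ^ 2 + x ^ 3 * z.
Proof.
elim: n => [|n [z E]]; first by exists 0; rewrite geom0 !bin0n !mul0n muln0.
have [w Ew] := exp_expand x n.
by exists (z + w); rewrite geomS E Ew !binS bin1; ring.
Qed.

Variables (p m x : nat).
Hypotheses (p_pr : prime p) (p_odd : odd p) (m_gt0 : 0 < m).
Hypotheses (x_gt0 : 0 < x) (x_val : logn p x = m).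
Let q := p ^ m.

Lemma dvd_q_x : q %| x.
Proof. by rewrite pfactor_dvdn // x_val. Qed.

Lemma p_gt2 : 2 < p.
Proof. by move: p_pr p_odd; case: p => [|[|[|]]]. Qed.

Lemma dvd_p_q : p %| q.
Proof. by rewrite /q -(prednK m_gt0) expnS dvdn_mulr. Qed.

Lemma coprime_p_2 : coprime p 2.
Proof. by rewrite coprimen2. Qed.

Lemma pexp_mulK k a b : ~~ (p %| b) -> (p ^ k %| a * b) = (p ^ k %| a).
Proof. by move=> pb; rewrite Gauss_dvdl // coprimeXl // prime_coprime. Qed.

Lemma dvd_q_bin2 n k : p ^ k %| n -> p ^ k %| 'C(n, 2).
Proof.
move=> kn; have p2: ~~ (p %| 2) by rewrite -prime_coprime // coprime_p_2.
by rewrite -(pexp_mulK _ _ p2) mulnC -mul_bin_diag dvdn_mulr.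
Qed.

Lemma dvd_q_bin3 n k : p ^ k %| n -> p ^ k %| 3 * 'C(n, 3).
Proof.
by move=> kn; rewrite -mul_bin_diag dvdn_mulr.
Qed.

Lemma dvd_bin3 k n : p ^ k.+1 %| n -> p ^ k %| 'C(n, 3).
Proof.
move=> kn; have H := dvd_q_bin3 kn; have [p3|np3] := eqVneq p 3.
  by move: H; rewrite expnS {1}p3 dvdn_pmul2l.
have p3: ~~ (p %| 3) by rewrite dvdn_prime2.
rewrite -(pexp_mulK _ _ p3) mulnC; apply: dvdn_trans H.
by rewrite dvdn_exp2l.
Qed.

Lemma dvd_x_q k n : (p ^ (k + m) %| n * x) = (p ^ k %| n).
Proof.
have [y py Ex] := pfactor_coprime p_pr x_gt0; rewrite x_val in Ex.
rewrite Ex mulnA expnD dvdn_pmul2r ?expn_gt0 ?prime_gt0 //.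
rewrite pexp_mulK //; by rewrite -prime_coprime.
Qed.

Lemma exp_mod3 n : x.+1 ^ n = 1 + n * x + 'C(n, 2) * x ^ 2 %[mod p ^ (3 * m)].
Proof.
have [z ->] := exp_expand x n; apply/eqP; rewrite eqn_mod_dvd ?leq_addr // addKn.
by rewrite dvdn_mulr // mulnC expnM dvdn_exp2r // dvd_q_x.
Qed.

Lemma geom_mod3 n :
  geom x.+1 n = n + 'C(n, 2) * x + 'C(n, 3) * x ^ 2 %[mod p ^ (3 * m)].
Proof.
have [z ->] := geom_expand x n; apply/eqP; rewrite eqn_mod_dvd ?leq_addr // addKn.
by rewrite dvdn_mulr // mulnC expnM dvdn_exp2r // dvd_q_x.
Qed.

(** Twice alpha^n - 1 equals n x (2 + (n - 1) x) modulo x^3, and the bracket is prime to p because p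
    divides x. So alpha has multiplicative order q^2 modulo q^3. *)
Lemma exp_order n : (p ^ (3 * m) %| x.+1 ^ n - 1) = (p ^ (2 * m) %| n).
Proof.
have [z E] := exp_expand x n.
have p2: ~~ (p %| 2) by rewrite -prime_coprime // coprime_p_2.
have px : p %| x by rewrite (dvdn_trans dvd_p_q) // dvd_q_x.
rewrite -(pexp_mulK _ _ p2).
have -> : (x.+1 ^ n - 1) * 2 = n * (2 + n.-1 * x) * x + x ^ 3 * (z * 2).
  have := mul_bin_diag n 1; rewrite bin1 => E2.
  rewrite E -addnA -addnA addKn.
  transitivity (n * x * 2 + (2 * 'C(n, 2)) * x ^ 2 + x ^ 3 * z * 2); first ring.
  by rewrite -E2; ring.
have x3 : p ^ (3 * m) %| x ^ 3 * (z * 2).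
  by rewrite dvdn_mulr // mulnC expnM dvdn_exp2r // dvd_q_x.
rewrite dvdn_addl // (_ : 3 * m = 2 * m + m) ?dvd_x_q; last by lia.
rewrite pexp_mulK // dvdn_addl //; by rewrite dvdn_mull.
Qed.

Lemma dvd_binx k n : p ^ k %| n -> p ^ (k + m) %| 'C(n, 2) * x.
Proof. by move=> kn; rewrite expnD dvdn_mul ?dvd_q_bin2 ?dvd_q_x. Qed.

(** For p = 3 the factor 3 that C(n,3) may lack is supplied by one of the two factors x. *)
Lemma dvd_bin3x k n : p ^ k %| n -> p ^ (k + m) %| 'C(n, 3) * x ^ 2.
Proof.
move=> kn; have p2 := p_gt2; have [p3|np3] := eqVneq p 3.
  have [z Ez] := dvdnP (dvdn_trans dvd_p_q dvd_q_x).
  rewrite (_ : _ * _ = 3 * 'C(n, 3) * (z * x)).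
    by rewrite expnD dvdn_mul ?dvd_q_bin3 // dvdn_mull ?dvd_q_x.
  by rewrite expnS expn1 {1}Ez p3; ring.
have p3: ~~ (p %| 3).
  by rewrite -prime_coprime // coprime_sym prime_coprime // dvdn_prime2 // eq_sym.
rewrite -(pexp_mulK _ _ p3) mulnC mulnA expnD dvdn_mul ?dvd_q_bin3 //.
by rewrite (expnS x 1) dvdn_mulr ?dvd_q_x.
Qed.

Lemma dvd_mod_add k a b : p ^ k %| b -> a + b = a %[mod p ^ k].
Proof. by move=> kb; rewrite -modnDmr (eqP kb) addn0. Qed.

Lemma geom_mod k n : k <= 2 * m -> p ^ k %| n -> geom x.+1 n = n %[mod p ^ (k + m)].
Proof.
move=> k2 kn; have k3 : p ^ (k + m) %| p ^ (3 * m) by rewrite dvdn_exp2l //; lia.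
by rewrite -(modn_dvdm _ k3) geom_mod3 modn_dvdm // -addnA dvd_mod_add // dvdn_add
  ?dvd_binx ?dvd_bin3x.
Qed.

Lemma exp_mod k n : k <= m -> p ^ k %| n -> x.+1 ^ n = 1 + n * x %[mod p ^ (k + 2 * m)].
Proof.
move=> k1 kn; have k3 : p ^ (k + 2 * m) %| p ^ (3 * m) by rewrite dvdn_exp2l //; lia.
rewrite -(modn_dvdm _ k3) exp_mod3 modn_dvdm // dvd_mod_add //.
by rewrite expnD dvdn_mul ?dvd_q_bin2 // mulnC expnM dvdn_exp2r // dvd_q_x.
Qed.

Hypothesis x3 : p = 3 -> m = 1 -> x %/ 3 = 1 %[mod 3].

Lemma dvd_q_3bin3 : q %| 3 * 'C(x, 3).
Proof. exact/dvd_q_bin3/dvd_q_x. Qed.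

(** As q divides 3 C(x,3), the prime p divides C(x,3) unless q = 3. In that last case x/3 = 1 modulo
    3 yields the residue 1, while the residue 2 would make both numbers of the next two lemmas
    divisible by 3. *)
Lemma bin3_cases : p %| 'C(x, 3) \/ p = 3 /\ 'C(x, 3) = 1 %[mod 3].
Proof.
have [p3|np3] := eqVneq p 3; last first.
  left; have p3: ~~ (p %| 3).
    by rewrite -prime_coprime // coprime_sym prime_coprime // dvdn_prime2 // eq_sym.
  rewrite -[p]expn1 -(pexp_mulK _ _ p3) mulnC expn1.
  exact: dvdn_trans dvd_p_q dvd_q_3bin3.
have [m1|m1] := eqVneq m 1%N.
  right; split=> //; have /dvdnP[y Ey] : 3 %| x.
    by have := dvd_q_x; rewrite /q m1 expn1 p3.
  have := x3 p3 m1; rewrite Ey mulnK // => y1.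
  have Ey' : y = (y %/ 3) * 3 + 1 by rewrite {1}(divn_eq y 3) y1.
  (* Now x = 9w + 3, so 6 C(x,3) = (9w + 3)(9w + 2)(9w + 1) is 6 modulo 9. *)
  set w := y %/ 3 in Ey'; set c := 'C(_, 3).
  have En : y * 3 = (9 * w).+3 by rewrite Ey'; lia.
  have := bin_ffact (y * 3) 3; rewrite -/c En !ffactnS ffactn0 /= => E.
  have : c * 6 = 9 * (81 * w ^ 3 + 54 * w ^ 2 + 11 * w) + 6.
    by move: E; rewrite (_ : 3`! = 6) // => ->; ring.
  by lia.
left; have m2 : 1 < m by lia.
have := dvd_q_3bin3; rewrite /q -(subnK m2) p3 addn2 !expnS mulnA.
move=> /(dvdn_trans (dvdn_mulr _ (dvdnn _))).
by rewrite dvdn_pmul2l.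
Qed.

(* [p.-1] stands for -1 modulo p. *)
Lemma bin3_unit2 : ~~ (p %| 2 * 'C(x, 3) + p.-1).
Proof.
have p2 := p_gt2; apply/negP.
case: bin3_cases => [pc|[p3 c1]].
  rewrite dvdn_addr; last by rewrite dvdn_mull.
  by move/dvdn_leq; lia.
rewrite p3; lia.
Qed.

Lemma bin3_unit1 : ~~ (p %| 2 + p.-1 * 'C(x, 3)).
Proof.
have p2 := p_gt2; apply/negP.
case: bin3_cases => [pc|[p3 c1]].
  rewrite dvdn_addl; last by rewrite dvdn_mull.
  by move/dvdn_leq; lia.
rewrite p3; lia.
Qed.

(* Up to higher powers of p, 2 p^(2m) u = x^2 (1 - 2 C(x,3)); for p = 3 and m = 1
   one has C(x,3) = x/3 mod 3, and x/3 = 2 mod 3 would raise the valuation. *)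
Lemma key_valuation : exists u,
  x.+1 ^ x.+1 = geom x.+1 x.+1 + p ^ (2 * m) * u /\ coprime p u.
Proof.
have [z Ez] := exp_expand x x.+1; have [w Ew] := geom_expand x x.+1.
have [y py Ex] := pfactor_coprime p_pr x_gt0; rewrite x_val -/q in Ex.
have le_g : geom x.+1 x.+1 <= x.+1 ^ x.+1.
  by rewrite (leq_trans (leq_pmull _ x_gt0)) // geom_pred leq_subr.
have := subnK le_g; set u := _ - _ => Eg.
have p2: ~~ (p %| 2) by rewrite -prime_coprime // coprime_p_2.
have px : p %| x by rewrite (dvdn_trans dvd_p_q) // dvd_q_x.
have Eu : 2 * u + (2 * 'C(x, 3) * x ^ 2 + 2 * x ^ 3 * w) =
          x ^ 2 + x ^ 3 * (1 + 2 * z).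
  have E2 : 2 * u + 2 * geom x.+1 x.+1 = 2 * x.+1 ^ x.+1 by lia.
  have Eb2 : x.+1 * x = 2 * 'C(x.+1, 2) by rewrite -mul_bin_diag bin1.
  have := mul_bin_diag x 1; rewrite bin1 => Eb1.
  (* The remaining terms of twice the expansion of [geom] are added to both sides, which keeps the
     identity in nat. *)
  apply: (@addIn (2 * x.+1 + (2 * 'C(x.+1, 2)) * x + (2 * 'C(x, 2)) * x ^ 2)).
  transitivity (2 * u + 2 * geom x.+1 x.+1).
    by rewrite Ew (binS x 2); ring.
  rewrite E2 Ez -Eb1.
  transitivity (2 + 2 * x.+1 * x + 2 * 'C(x.+1, 2) * x ^ 2 + 2 * x ^ 3 * z).
    by ring.
  by rewrite -Eb2 -(prednK x_gt0) /=; ring.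
have Eq2 : x ^ 2 = q ^ 2 * y ^ 2 by rewrite Ex; ring.
have q2 : q ^ 2 = p ^ (2 * m) by rewrite -expnM mulnC.
have qu : q ^ 2 %| u.
  rewrite q2 -(pexp_mulK _ _ p2) -q2 mulnC.
  have qx2 : q ^ 2 %| x ^ 2 by rewrite Eq2 dvdn_mulr.
  have qx3 : q ^ 2 %| x ^ 3 by rewrite (expnS x 2) dvdn_mull.
  have : q ^ 2 %| x ^ 2 + x ^ 3 * (1 + 2 * z) by rewrite dvdn_add // dvdn_mulr.
  rewrite -Eu dvdn_addl //.
  by apply: dvdn_add; [rewrite dvdn_mull | rewrite -mulnA mulnCA dvdn_mulr].
have [u' Eu'] := dvdnP qu; exists u'; split.
  by rewrite -q2 mulnC -Eu' addnC Eg.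
rewrite prime_coprime //; apply: contra bin3_unit2 => pu'.
have p0 := prime_gt0 p_pr.
have q0 : 0 < q ^ 2 by rewrite expn_gt0 expn_gt0 p0.
have E3 : 2 * u' + y ^ 2 * (2 * 'C(x, 3) + 2 * x * w) = y ^ 2 * (1 + x * (1 + 2 * z)).
  apply/eqP; rewrite -(eqn_pmul2l q0); apply/eqP.
  transitivity (2 * u + (2 * 'C(x, 3) * x ^ 2 + 2 * x ^ 3 * w)).
    by rewrite Eu' !(expnS x 2) Eq2; ring.
  by rewrite Eu !(expnS x 2) Eq2; ring.
(* Adding y^2 (p - 1) to [E3] turns its right side into a multiple of p, since p divides x. *)
have E4 : y ^ 2 * (2 * 'C(x, 3) + p.-1) + (2 * u' + y ^ 2 * (2 * x * w)) =
          y ^ 2 * (p + x * (1 + 2 * z)).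
  transitivity (y ^ 2 * p.-1 + y ^ 2 * (1 + x * (1 + 2 * z))); first by rewrite -E3; ring.
  by rewrite -{2}(prednK p0); ring.
have py2 : coprime p (y ^ 2) by rewrite coprimeXr.
rewrite -(Gauss_dvdr _ py2) -(dvdn_addl _ (_ : p %| 2 * u' + y ^ 2 * (2 * x * w))).
  by rewrite E4 dvdn_mull // dvdn_add // dvdn_mulr.
by apply: dvdn_add; [exact: dvdn_mull | rewrite dvdn_mull // dvdn_mulr // dvdn_mull].
Qed.

End NumberTheory.

(** * A permutation model of order p^(7m) *)

Section Chart.
Local Open Scope ring_scope.
Import GRing.Theory.
Variables (R : comNzRingType) (T : R).
Hypothesis T3 : 27%:R * T ^+ 3 = 0.
Hypothesis fermat : forall y : R, 9%:R * T ^+ 3 * (y ^+ 3 - y) = 0.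

(* T stands for x/12, so d = x/4 and d^2 = 3e, which keeps the formulas below
   free of denominators.  The model acts on R * R modulo (j, i) ~ (j + s, i + s)
   for d s = 0, whose classes are the fibres of ch_pi.  There ch_a, ch_b, ch_c
   become A, B, [A, B], and ch_psi conjugates the translation ch_t to ch_b. *)
Definition chd : R := 3%:R * T.
Definition che : R := T * chd.
Local Notation d := chd.
Local Notation e := che.
Definition ch_alpha : R := 1 + 4%:R * d.
Definition ch_beta : R := 1 - 4%:R * d + 16%:R * d ^+ 2.

Definition ch_a (v : R * R) : R * R := (v.1, v.2 + 1).
Definition ch_t (v : R * R) : R * R := (v.1 + 1, v.2).
Definition ch_c (v : R * R) : R * R := (ch_beta * v.1, ch_alpha * v.2).
(** The point (j, i) stands for the coset <C> B^j A^i, on which A, B, C act by right multiplication.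
    Since A^i B = B C^i A^r with r = alpha + ... + alpha^i, the coset <C> B^j A^i B is <C> B^((j+1)
    beta^i) A^r; the two coordinates are the expansions of (j + 1) beta^i and r in powers of d. *)
Definition ch_b (v : R * R) : R * R := let: (j, i) := v in
  ((j + 1) * (1 - 4%:R * d * i + 8%:R * d ^+ 2 * (i ^+ 2 + i)),
   i + 2%:R * d * (i ^+ 2 + i) + 8%:R * e * (i ^+ 3 - i)).
(** Polynomial interpolation in n of the n-th iterate of [ch_b] at (0, i), that is, of the coset <C>
    A^i B^n. In the coordinates (n, i) right multiplication by B is a translation, which makes the
    order of B and its relation easy to read off. *)
Definition ch_psi (v : R * R) : R * R := let: (n, i) := v in
  (n - 2%:R * d * i * n * (n + 1) - 8%:R * e * (i ^+ 2 + i) * n * (n ^+ 2 - 1)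
     + 4%:R * e * i ^+ 2 * n * (n + 1) * (2%:R * n + 1)
     + 4%:R * d ^+ 2 * i * n * (n + 1),
   i + 2%:R * d * n * (i ^+ 2 + i) + 8%:R * e * n * (i ^+ 3 - i)
     + 2%:R * d ^+ 2 * n * (n - 1) * i * (i + 1) * (2%:R * i + 1)
     - 8%:R * d * e * n * (n - 1) * i * (i + 1)).
Definition ch_pi (v : R * R) : R * R := (d * v.1, v.2 - v.1).

Lemma chd3 : d ^+ 3 = 0.
Proof. by rewrite -[RHS]T3 /d; ring. Qed.
Lemma chd2e : d ^+ 2 * e = 0.
Proof. by rewrite -[RHS](mulr0 T) -T3 /e /d; ring. Qed.
Lemma chde2 : d * e ^+ 2 = 0.
Proof. by rewrite -[RHS](mulr0 (T ^+ 2)) -T3 /e /d; ring. Qed.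
Lemma che3 : e ^+ 3 = 0.
Proof. by rewrite -[RHS](mulr0 (T ^+ 3)) -T3 /e /d; ring. Qed.
Lemma ch3de : 3%:R * d * e = 0.
Proof. by rewrite -[RHS]T3 /e /d; ring. Qed.
Lemma ch3e2 : 3%:R * e ^+ 2 = 0.
Proof. by rewrite -[RHS](mulr0 T) -T3 /e /d; ring. Qed.
Lemma chd2 : d ^+ 2 - 3%:R * e = 0.
Proof. by rewrite /e /d; ring. Qed.
Lemma ch_fermat_de y : d * e * (y ^+ 3 - y) = 0.
Proof. by rewrite -(fermat y) /e /d; ring. Qed.
Lemma ch_fermat_e2 y : e ^+ 2 * (y ^+ 3 - y) = 0.
Proof. by rewrite -[RHS](mulr0 T) -(fermat y) /e /d; ring. Qed.

Lemma ch_alphaK : ch_alpha * ch_beta = 1.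
Proof. by rewrite /ch_alpha /ch_beta; ring: chd3. Qed.

(* The cofactors passed to ideal0 below are membership certificates found by
   polynomial division. *)
Let ideal (k1 k2 k3 k4 k5 k6 i n : R) : R :=
  3%:R * d * e * k1 + 3%:R * e ^+ 2 * k2 + d * e * (i ^+ 3 - i) * k3
  + d * e * (n ^+ 3 - n) * k4 + e ^+ 2 * (i ^+ 3 - i) * k5
  + (d ^+ 2 - 3%:R * e) * k6.
Let ideal0 k1 k2 k3 k4 k5 k6 i n : ideal k1 k2 k3 k4 k5 k6 i n = 0.
Proof.
by rewrite /ideal ch3de ch3e2 chd2 !ch_fermat_de ch_fermat_e2 !mul0r !addr0.
Qed.

Lemma ch_psi_step v : ch_psi (ch_t v) = ch_b (ch_psi v).
Proof.
case: v => n i; rewrite /ch_t /ch_psi /ch_b /=; congr (_, _); apply/eqP;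
  rewrite -subr_eq0; apply/eqP.
- rewrite -[RHS](ideal0
    (- 11%:R * i * n - 11%:R * i * n ^+ 2 + 11%:R * i ^+ 2 * n
     - 11%:R * i ^+ 2 * n ^+ 3 + 27%:R * i ^+ 3 * n + 27%:R * i ^+ 3 * n ^+ 2) 0
    (- n - n ^+ 2) (i ^+ 2) 0
    (8%:R * i * n + 8%:R * i * n ^+ 2 - 8%:R * i ^+ 2 - 8%:R * i ^+ 2 * n) i n).
  by rewrite /ideal; ring: chd3 chd2e chde2 che3.
rewrite -[RHS](ideal0
    (5%:R * i * n + 11%:R * i ^+ 2 * n - 21%:R * i ^+ 3 * n - 27%:R * i ^+ 4 * n)
    (- 21%:R * i * n + 85%:R * i ^+ 3 * n - 64%:R * i ^+ 5 * n)
    (- n + i * n) 0 n 0 i n).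
by rewrite /ideal; ring: chd3 chd2e chde2 che3.
Qed.

Lemma ch_b_comm v : ch_b (ch_a v) = ch_c (ch_a (ch_b v)).
Proof.
case: v => j i; rewrite /ch_c /ch_a /ch_b /ch_alpha /ch_beta /=;
  congr (_, _); apply/eqP; rewrite -subr_eq0; apply/eqP.
- by ring: chd3 chd2e chde2 che3.
rewrite -[RHS](ideal0 (11%:R * i - 11%:R * i ^+ 3) 0 1 0 0
                 (- 8%:R * i - 8%:R * i ^+ 2) i 0).
by rewrite /ideal; ring: chd3 chd2e chde2 che3.
Qed.

Lemma ch_pi_shift v w :
  ch_pi v = ch_pi w -> exists2 s, d * s = 0 & w = (v.1 + s, v.2 + s).
Proof.
case: v w => [j i] [j' i'] [/= dj ij]; exists (j' - j).
  by rewrite mulrBr dj subrr.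
by congr (_, _); [ring | rewrite addrC -addrA [- j + i]addrC ij; ring].
Qed.

Lemma ch_pi_shiftE v s : d * s = 0 -> ch_pi (v.1 + s, v.2 + s) = ch_pi v.
Proof. by move=> ds; rewrite /ch_pi /= mulrDr ds addr0; congr (_, _); ring. Qed.

Lemma ch_pi_a v w : (ch_pi (ch_a v) == ch_pi (ch_a w)) = (ch_pi v == ch_pi w).
Proof.
by rewrite /ch_pi /ch_a /= !xpair_eqE ![_ + 1 - _]addrAC (inj_eq (addIr 1)).
Qed.

Lemma ch_pi_t v w : (ch_pi (ch_t v) == ch_pi (ch_t w)) = (ch_pi v == ch_pi w).
Proof.
rewrite /ch_pi /ch_t /= !xpair_eqE !mulrDr (inj_eq (addIr _)).
by rewrite !opprD !addrA !(inj_eq (addIr _)).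
Qed.

Let de0 s : d * s = 0 -> e * s = 0.
Proof. by move=> ds; rewrite /e -mulrA ds mulr0. Qed.

Lemma ch_c_shift v s : d * s = 0 ->
  ch_c (v.1 + s, v.2 + s) = ((ch_c v).1 + s, (ch_c v).2 + s).
Proof. by move=> ds; rewrite /ch_c /ch_alpha /ch_beta /=; congr (_, _); ring: ds. Qed.

Lemma ch_b_shift v s : d * s = 0 ->
  ch_b (v.1 + s, v.2 + s) = ((ch_b v).1 + s, (ch_b v).2 + s).
Proof.
case: v => j i ds; have es := de0 ds.
by rewrite /ch_b /=; congr (_, _); ring: ds es.
Qed.

Lemma ch_psi_shift v s : d * s = 0 ->
  ch_psi (v.1 + s, v.2 + s) = ((ch_psi v).1 + s, (ch_psi v).2 + s).
Proof.
case: v => j i ds; have es := de0 ds.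
by rewrite /ch_psi /=; congr (_, _); ring: ds es.
Qed.

(** [ch_psi] is the identity modulo d, and d is nilpotent: the difference of two points with the
    same image is killed in turn by d^2, by d and by 1. *)
Lemma ch_psi_inj : injective ch_psi.
Proof.
move=> [n i] [n' i'] [E1 E2].
pose u := n' - n; pose w := i' - i.
have En : n' = n + u by rewrite /u; ring.
have Ei : i' = i + w by rewrite /w; ring.
move: E1 E2; rewrite {}En {}Ei => E1 E2.
have d2u : d ^+ 2 * u = 0.
  transitivity (d ^+ 2 * ((ch_psi (n + u, i + w)).1 - (ch_psi (n, i)).1)).
    by rewrite /ch_psi /=; ring: chd3 chd2e.
  by rewrite /ch_psi /= E1 subrr mulr0.
have d2w : d ^+ 2 * w = 0.
  transitivity (d ^+ 2 * ((ch_psi (n + u, i + w)).2 - (ch_psi (n, i)).2)).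
    by rewrite /ch_psi /=; ring: chd3 chd2e.
  by rewrite /ch_psi /= E2 subrr mulr0.
have deu : d * e * u = 0 by rewrite -[RHS](mulr0 T) -d2u /e; ring.
have dew : d * e * w = 0 by rewrite -[RHS](mulr0 T) -d2w /e; ring.
have du : d * u = 0.
  transitivity (d * ((ch_psi (n + u, i + w)).1 - (ch_psi (n, i)).1)).
    by rewrite /ch_psi /=; ring: d2u d2w deu dew chd3 chd2e.
  by rewrite /ch_psi /= E1 subrr mulr0.
have dw : d * w = 0.
  transitivity (d * ((ch_psi (n + u, i + w)).2 - (ch_psi (n, i)).2)).
    by rewrite /ch_psi /=; ring: d2u d2w deu dew chd3 chd2e.
  by rewrite /ch_psi /= E2 subrr mulr0.
have [eu ew] := (de0 du, de0 dw).
have psiw : ch_psi (n + u, i + w) =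
            ((ch_psi (n + u, i)).1, (ch_psi (n + u, i)).2 + w).
  by rewrite /ch_psi /=; congr (_, _); ring: dw ew.
have psiu : ch_psi (n + u, i) = ((ch_psi (n, i)).1 + u, (ch_psi (n, i)).2).
  by rewrite /ch_psi /=; congr (_, _); ring: du eu.
have u0 : u = 0.
  transitivity ((ch_psi (n + u, i + w)).1 - (ch_psi (n, i)).1).
    by rewrite psiw psiu /=; ring.
  by rewrite /ch_psi /= E1 subrr.
have w0 : w = 0.
  transitivity ((ch_psi (n + u, i + w)).2 - (ch_psi (n, i)).2).
    by rewrite psiw psiu /=; ring.
  by rewrite /ch_psi /= E2 subrr.
by rewrite u0 w0 !addr0.
Qed.

Lemma ch_pi_psi v w :
  (ch_pi (ch_psi v) == ch_pi (ch_psi w)) = (ch_pi v == ch_pi w).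
Proof.
apply/eqP/eqP => /ch_pi_shift[s ds].
  by rewrite -ch_psi_shift // => /ch_psi_inj ->; rewrite ch_pi_shiftE.
by move=> ->; rewrite ch_psi_shift // ch_pi_shiftE.
Qed.

Lemma ch_pi_c v w : (ch_pi (ch_c v) == ch_pi (ch_c w)) = (ch_pi v == ch_pi w).
Proof.
have cI : injective ch_c.
  move=> [j i] [j' i'] [/(congr1 ( *%R ch_alpha)) + /(congr1 ( *%R ch_beta))].
  by rewrite !mulrA [_ * ch_alpha]mulrC ch_alphaK !mul1r => -> ->.
apply/eqP/eqP => /ch_pi_shift[s ds].
  by rewrite -ch_c_shift // => /cI ->; rewrite ch_pi_shiftE.
by move=> ->; rewrite ch_c_shift // ch_pi_shiftE.
Qed.

Lemma ch_pi_b v w : ch_pi v = ch_pi w -> ch_pi (ch_b v) = ch_pi (ch_b w).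
Proof. by case/ch_pi_shift=> s ds ->; rewrite ch_b_shift // ch_pi_shiftE. Qed.

Lemma ch_psi_c v : ch_pi (ch_psi (ch_c v)) = ch_pi (ch_c (ch_psi v)).
Proof.
(* The two maps commute only up to the identification of points: both coordinates differ by the same
   s, and d s = 0 because 3 d e = 0 and d^2 e = 0. *)
case: v => n i; set s := - 24%:R * e * i * n + d * e * i * n.
have ds : d * s = 0.
  by rewrite -[RHS](mulr0 (- 8%:R * i * n)) -ch3de /s; ring: chd2e.
rewrite -[RHS](ch_pi_shiftE _ ds); congr ch_pi.
rewrite /ch_c /ch_psi /ch_alpha /ch_beta /s /=; congr (_, _); apply/eqP;
  rewrite -subr_eq0; apply/eqP.
- rewrite -[RHS](ideal0
    (10%:R * i * n + 11%:R * i * n ^+ 3 + 32%:R * i ^+ 2 * n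
     + 16%:R * i ^+ 2 * n ^+ 2) 0 0 (- i) 0 (- 8%:R * i * n) i n).
  by rewrite /ideal; ring: chd3 chd2e chde2 che3.
rewrite -[RHS](ideal0 (10%:R * i * n + 11%:R * i ^+ 3 * n) 0 (- n) 0 0
                 (- 8%:R * i * n) i n).
by rewrite /ideal; ring: chd3 chd2e chde2 che3.
Qed.

End Chart.

(** * Permutations induced on the fibres of a map *)

Section PermLift.
Variables (X Y : finType) (f : X -> Y).

Definition quo : finType := {y : Y | y \in codom f} : finType.
Definition cls (v : X) : quo := exist _ (f v) (codom_f f v).
Definition repr_cls (w : quo) : X := iinv (valP w).

Lemma repr_clsK w : cls (repr_cls w) = w.
Proof. by apply: val_inj; rewrite /= f_iinv. Qed.

Lemma cls_eq v w : (cls v == cls w) = (f v == f w).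
Proof. by []. Qed.

Variables (g : X -> X) (gP : forall v w, (f (g v) == f (g w)) = (f v == f w)).

Lemma lift_cls_inj : injective (fun w => cls (g (repr_cls w))).
Proof.
move=> v w /eqP; rewrite cls_eq gP -cls_eq !repr_clsK => /eqP //.
Qed.

Definition lift_perm : {perm quo} := perm lift_cls_inj.

Lemma lift_permE v : lift_perm (cls v) = cls (g v).
Proof.
by rewrite permE; apply/eqP; rewrite cls_eq gP -cls_eq repr_clsK.
Qed.

End PermLift.

(** * The permutation model over a finite ring *)

Section Model.
Local Open Scope ring_scope.
Import GRing.Theory.
Variables (R : finComNzRingType) (T : R).
Hypothesis T3 : 27%:R * T ^+ 3 = 0.
Hypothesis fermat : forall y : R, 9%:R * T ^+ 3 * (y ^+ 3 - y) = 0.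
Local Notation pi := (ch_pi T).
Local Notation cl := (cls pi).

Definition mod_a : {perm quo pi} := lift_perm (ch_pi_a T).
Definition mod_t : {perm quo pi} := lift_perm (ch_pi_t T).
Definition mod_c : {perm quo pi} := lift_perm (ch_pi_c T3).
Definition mod_psi : {perm quo pi} := lift_perm (ch_pi_psi T3).
(** Taking a conjugate of the translation, rather than lifting [ch_b], makes the powers of B
    computable; [mod_bE] recovers the explicit formula. *)
Definition mod_b : {perm quo pi} := locked (mod_t ^ mod_psi)%g.
Lemma mod_b_psi w : mod_b (mod_psi w) = mod_psi (mod_t w).
Proof. by rewrite /mod_b -lock permJ. Qed.

Lemma mod_bE v : mod_b (cl v) = cl (ch_b T v).
Proof.
set w := (mod_psi^-1)%g (cl v).
have Dv : cl v = mod_psi w by rewrite /w permKV.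
have Dw : w = cl (repr_cls w) by rewrite repr_clsK.
have E : cl v = cl (ch_psi T (repr_cls w)) by rewrite Dv {1}Dw lift_permE.
rewrite Dv mod_b_psi Dw !lift_permE (ch_psi_step T3 fermat).
apply/eqP; rewrite cls_eq; apply/eqP/ch_pi_b.
by apply/esym/eqP; rewrite -cls_eq E.
Qed.

Lemma mod_permP (s t : {perm quo pi}) : (forall v, s (cl v) = t (cl v)) -> s = t.
Proof. by move=> st; apply/permP=> w; rewrite -[w]repr_clsK st. Qed.

Lemma mod_aX k v : (mod_a ^+ k)%g (cl v) = cl (v.1, v.2 + k%:R).
Proof.
elim: k v => [|k IH] [j i]; first by rewrite expg0 perm1 addr0.
by rewrite expgSr permM IH lift_permE /ch_a /= mulrS [1 + _]addrC addrA.
Qed.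

Lemma mod_tX k v : (mod_t ^+ k)%g (cl v) = cl (v.1 + k%:R, v.2).
Proof.
elim: k v => [|k IH] [j i]; first by rewrite expg0 perm1 addr0.
by rewrite expgSr permM IH lift_permE /ch_t /= mulrS [1 + _]addrC addrA.
Qed.

Lemma mod_cX k v :
  (mod_c ^+ k)%g (cl v) = cl (ch_beta T ^+ k * v.1, ch_alpha T ^+ k * v.2).
Proof.
elim: k v => [|k IH] [j i]; first by rewrite expg0 perm1 !mul1r.
by rewrite expgSr permM IH lift_permE /ch_c /= !exprS !mulrA.
Qed.

Lemma mod_bX k w : (mod_b ^+ k)%g (mod_psi w) = mod_psi ((mod_t ^+ k)%g w).
Proof.
elim: k => [|k IH]; first by rewrite !expg0 !perm1.
by rewrite !expgSr !permM IH mod_b_psi.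
Qed.

Lemma mod_bX0 k : (mod_b ^+ k)%g (cl 0) = cl (k%:R, 0).
Proof.
have psi0 n : mod_psi (cl (n, 0)) = cl (n, 0).
  by rewrite lift_permE /ch_psi; congr (cl (_, _)); ring.
by rewrite -[cl 0]psi0 mod_bX mod_tX /= add0r psi0.
Qed.

Lemma mod_comm : [~ mod_a, mod_b]%g = mod_c.
Proof.
apply: (mulgI (mod_b * mod_a)%g); rewrite -commgC; apply: mod_permP => v.
by rewrite !permM lift_permE !mod_bE !lift_permE (ch_b_comm T3 fermat).
Qed.

Lemma mod_relA (al : nat) : al%:R = ch_alpha T ->
  (mod_a ^ [~ mod_a, mod_b] = mod_a ^+ al)%g.
Proof.
move=> Eal; rewrite mod_comm; apply: (mulgI mod_c); rewrite -conjgC.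
apply: mod_permP => v; rewrite !permM !lift_permE mod_aX /ch_a /ch_c /=.
by rewrite mulrDr mulr1 Eal.
Qed.

Lemma mod_c_psi : commute mod_c mod_psi.
Proof.
apply: mod_permP => v; rewrite !permM !lift_permE.
by apply/eqP; rewrite cls_eq (ch_psi_c T3 fermat).
Qed.

Lemma mod_relB (al : nat) : al%:R = ch_alpha T ->
  (mod_b ^ [~ mod_b, mod_a] = mod_b ^+ al)%g.
Proof.
move=> Eal; rewrite -invg_comm mod_comm; apply: (mulIg mod_c).
rewrite conjgE invgK -!mulgA mulVg mulg1.
apply/permP=> w; set u := (mod_psi^-1)%g w.
have Dw : w = mod_psi u by rewrite /u permKV.
have cpsi z : mod_c (mod_psi z) = mod_psi (mod_c z).
  by have /permP/(_ z) := mod_c_psi; rewrite !permM.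
rewrite Dw !permM mod_bX !cpsi mod_b_psi; congr (mod_psi _).
rewrite -[u]repr_clsK mod_tX !lift_permE.
by rewrite /ch_t /ch_c /= mulrDr Eal [_ * ch_alpha T]mulrC ch_alphaK.
Qed.

Lemma mod_ordA k : k%:R = 0 :> R -> (mod_a ^+ k = 1)%g.
Proof. by move=> k0; apply: mod_permP => -[j i]; rewrite mod_aX k0 addr0 perm1. Qed.

Lemma mod_ordB k : k%:R = 0 :> R -> (mod_b ^+ k = 1)%g.
Proof.
move=> k0; apply/permP=> w; set u := (mod_psi^-1)%g w.
have -> : w = mod_psi u by rewrite /u permKV.
by rewrite mod_bX perm1 -[u]repr_clsK mod_tX k0 addr0 -surjective_pairing.
Qed.

(** [mod_c] fixes the class of (0, 0), so the word sends that class to the class of (j, i), which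
    remembers exactly d j and i - j. *)
Lemma mod_word_inj (k j i k' j' i' : nat) :
  (mod_c ^+ k * mod_b ^+ j * mod_a ^+ i
     = mod_c ^+ k' * mod_b ^+ j' * mod_a ^+ i')%g ->
  chd T * j%:R = chd T * j'%:R /\ i%:R - j%:R = i'%:R - j'%:R :> R.
Proof.
move=> E; have [//] : pi (j%:R, i%:R) = pi (j'%:R, i'%:R).
apply/eqP; rewrite -cls_eq; apply/eqP.
have := congr1 (fun s : {perm _} => s (cl 0)) E.
by rewrite /= !permM !mod_cX /= !mulr0 !mod_bX0 !mod_aX /= !add0r.
Qed.

Lemma mod_cX_inj k k' :
  (mod_c ^+ k = mod_c ^+ k')%g -> ch_alpha T ^+ k = ch_alpha T ^+ k'.
Proof.
move=> E; have := congr1 (fun s : {perm _} => s (cl (0, 1))) E.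
rewrite /= !mod_cX => /eqP; rewrite cls_eq => /eqP[_].
by rewrite /= !mulr0 !mulr1 !subr0.
Qed.

End Model.

(** * The parameter x/12 modulo p^(3m) *)

Section ModelExists.
Local Open Scope ring_scope.
Import GRing.Theory.

Lemma natr_Zp_eq0 P n : (1 < P)%N -> (n%:R == 0 :> 'Z_P) = (P %| n)%N.
Proof. by move=> P1; rewrite -val_eqE /= val_Zp_nat. Qed.

Lemma natr_Zp_eq P a b : (1 < P)%N -> (a%:R == b%:R :> 'Z_P) = (a == b %[mod P])%N.
Proof. by move=> P1; rewrite -val_eqE /= !val_Zp_nat. Qed.

Variables (p m x : nat).
Hypotheses (p_pr : prime p) (p_odd : odd p) (m_gt0 : (0 < m)%N).
Hypotheses (x_gt0 : (0 < x)%N) (x_val : logn p x = m).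
Let P := (p ^ (3 * m))%N.

Let P_gt1 : (1 < P)%N.
Proof. by rewrite -(exp1n (3 * m)) ltn_exp2r ?prime_gt1 // muln_gt0. Qed.

Let natr_unit n : ~~ (p %| n)%N -> (n%:R : 'Z_P) \is a GRing.unit.
Proof. by move=> pn; rewrite unitZpE // coprimeXl // prime_coprime. Qed.

Lemma model_param : exists T : 'Z_P,
  [/\ 27%:R * T ^+ 3 = 0, forall y, 9%:R * T ^+ 3 * (y ^+ 3 - y) = 0
    & 4%:R * (3%:R * T) = x%:R].
Proof.
have U4 : (4%:R : 'Z_P) \is a GRing.unit.
  apply: natr_unit; rewrite (_ : 4 = 2 ^ 2)%N // -prime_coprime //.
  by rewrite coprimeXr // coprime_p_2.
(* For p = 3 the element 3 is not a unit, so x/3 is formed in nat, where p divides x. *)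
have [y Ey] : exists y : 'Z_P, 3%:R * y = x%:R.
  have [p3|np3] := eqVneq p 3.
    have [y ->] := dvdnP (dvdn_trans (dvd_p_q p m_gt0) (dvd_q_x p_pr x_gt0 x_val)).
    by exists y%:R; rewrite p3 mulnC natrM.
  have U3 : (3%:R : 'Z_P) \is a GRing.unit.
    by apply: natr_unit; rewrite dvdn_prime2.
  by exists (3%:R^-1 * x%:R); rewrite mulVKr.
pose T := 4%:R^-1 * y; have E : 4%:R * (3%:R * T) = x%:R.
  by rewrite mulrCA /T mulVKr.
have x3 : x%:R ^+ 3 = 0 :> 'Z_P.
  apply/eqP; rewrite -natrX natr_Zp_eq0 // /P mulnC expnM dvdn_exp2r //.
  exact: dvd_q_x.
have T3 : 27%:R * T ^+ 3 = 0.
  by apply: (mulrI (unitrX 3 U4)); rewrite mulr0 -x3 -E; ring.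
exists T; split=> // z.
have lez : (z <= z ^ 3)%N.
  by case: (nat_of_ord z) => // k; rewrite -{1}(expn1 k.+1) leq_pexp2l.
have /dvdnP[w Ew] : (3 %| z ^ 3 - z)%N by rewrite -eqn_mod_dvd // fermat_little.
have -> : z ^+ 3 - z = 3%:R * w%:R.
  rewrite -natrM mulnC -Ew natrB // natrX natr_Zp //.
by transitivity (27%:R * T ^+ 3 * w%:R); [ring | rewrite T3 mul0r].
Qed.

End ModelExists.

Section ModelOrder.
Local Open Scope group_scope.
Variables (p m x : nat).
Hypotheses (p_pr : prime p) (p_odd : odd p) (m_gt0 : 0 < m).
Hypotheses (x_gt0 : 0 < x) (x_val : logn p x = m).

(** The q^7 words C^k B^j A^i with k, j < q^2 and i < q^3 are distinct: the image of the base point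
    determines x j and i - j modulo q^3, hence j and i, and then alpha^k modulo q^3 determines k by
    [exp_order]. *)
Lemma model_exists : exists (gT : finGroupType) (A B : gT),
  [/\ A ^ [~ A, B] = A ^+ x.+1, B ^ [~ B, A] = B ^+ x.+1,
      A ^+ (p ^ (3 * m))%N = 1, B ^+ (p ^ (3 * m))%N = 1
    & p ^ (7 * m) <= #|<<[set A; B]>>|].
Proof.
have [T [T3 fermat E]] := model_param p_pr p_odd m_gt0 x_gt0 x_val.
set P := (p ^ (3 * m))%N in T T3 fermat E *.
have P_gt1 : 1 < P by rewrite -(exp1n (3 * m)) ltn_exp2r ?prime_gt1 // muln_gt0.
pose a := mod_a T; pose b := mod_b T3; pose c := mod_c T3.
have al : (x.+1%:R)%R = ch_alpha T by rewrite /ch_alpha /chd E -addn1 addnC GRing.natrD.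
have P0 : (P%:R = 0 :> 'Z_P)%R by apply/eqP; rewrite natr_Zp_eq0.
exists {perm quo (ch_pi T)}, a, b; split.
- exact: (mod_relA T3 fermat al).
- exact: (mod_relB T3 fermat al).
- exact: mod_ordA.
- exact: mod_ordB.
set G := <<_>>.
pose S := ('I_(p ^ (2 * m)) * 'I_(p ^ (2 * m)) * 'I_P)%type.
pose f (s : S) : {perm quo (ch_pi T)} := c ^+ s.1.1 * b ^+ s.1.2 * a ^+ s.2.
have fG s : f s \in G.
  have Ga : a \in G by rewrite mem_gen // !inE eqxx.
  have Gb : b \in G by rewrite mem_gen // !inE eqxx orbT.
  have Gc : c \in G by rewrite /c -(mod_comm T3 fermat) groupR.
  by rewrite !groupM ?groupX.
have canc_j (j j' : nat) : j <= j' -> x * j == x * j' %[mod P] ->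
    j' == j %[mod p ^ (2 * m)].
  move=> le_j; rewrite eq_sym eqn_mod_dvd ?leq_mul // -mulnBr mulnC /P.
  rewrite (_ : 3 * m = 2 * m + m)%N ?(dvd_x_q p_pr x_gt0 x_val); last by lia.
  by rewrite eqn_mod_dvd.
have canc_k (k k' : nat) : k <= k' -> x.+1 ^ k == x.+1 ^ k' %[mod P] ->
    k' == k %[mod p ^ (2 * m)].
  move=> le_k; rewrite eq_sym !eqn_mod_dvd ?leq_pexp2l //.
  rewrite -{1}(subnK le_k) expnD -[X in _ - X]mul1n -mulnBl mulnC.
  rewrite Gauss_dvdr ?exp_order // coprimeXl // coprimeXr // coprime_sym.
  apply: (@coprime_dvdr _ x); last by rewrite coprimeSn.
  exact: dvdn_trans (dvd_p_q p m_gt0) (dvd_q_x p_pr x_gt0 x_val).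
have f_inj : injective f.
  move=> [[k j] i] [[k' j'] i']; rewrite /f /= => Ef.
  have [Ej Ei] := mod_word_inj Ef.
  have {}Ej : j = j'.
    have /eqP : ((x * j)%N%:R = (x * j')%N%:R :> 'Z_P)%R.
      have E' : (4%:R * chd T = x%:R)%R := E.
      by rewrite !GRing.natrM -E' -GRing.mulrA Ej GRing.mulrA.
    rewrite natr_Zp_eq // => Em; apply: val_inj.
    rewrite -[LHS](modn_small (ltn_ord j)) -[RHS](modn_small (ltn_ord j')).
    apply/eqP; have [le_j|/ltnW le_j] := leqP j j'; last rewrite eq_sym in Em;
      [rewrite eq_sym | ]; exact: canc_j.
  have {}Ei : i = i'.
    move: Ei; rewrite Ej => /GRing.addIr/eqP; rewrite natr_Zp_eq //.
    by rewrite !modn_small // => /eqP/val_inj.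
  move: Ef; rewrite Ei Ej => /mulIg/mulIg/mod_cX_inj; rewrite -al -!GRing.natrX.
  move/eqP; rewrite natr_Zp_eq // => Ek; congr (_, _, _); apply: val_inj.
  rewrite -[LHS](modn_small (ltn_ord k)) -[RHS](modn_small (ltn_ord k')).
  apply/eqP; have [le_k|/ltnW le_k] := leqP k k'; last rewrite eq_sym in Ek;
    [rewrite eq_sym | ]; exact: canc_k.
have -> : (p ^ (7 * m) = #|{: S}|)%N.
  by rewrite !card_prod !card_ord -!expnD; congr (_ ^ _)%N; lia.
rewrite -(card_codom f_inj) subset_leq_card //.
by apply/subsetP=> _ /codomP[s ->].
Qed.

End ModelOrder.

(** * Consequences of the relations *)

Local Open Scope group_scope.

(** * Cyclic extensions and one step of the upper central series *)

Section GroupPrelim.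
Variable gT : finGroupType.
Implicit Types (H J : {group gT}) (y : gT).

Lemma expg_eq_mod y n a b : y ^+ n = 1 -> a = b %[mod n] -> y ^+ a = y ^+ b.
Proof. by move=> yn ab; rewrite -(expg_mod a yn) ab expg_mod. Qed.

Lemma card_join_cycle H y n : y \in 'N(H) -> y ^+ n \in H -> 0 < n ->
  #|H <*> <[y]>| <= #|H| * n.
Proof.
move=> Ny Hyn n0; rewrite norm_joinEr ?cycle_subG //.
have I0 : 0 < #|H :&: <[y]>| by exact: cardG_gt0.
rewrite -(leq_pmul2r I0) -mul_cardG -mulnA leq_pmul2l ?cardG_gt0 //.
have le1 : #[y ^+ n] <= #|H :&: <[y]>|.
  by rewrite subset_leq_card // subsetI !cycle_subG Hyn mem_cycle.
apply: leq_trans (leq_mul (leqnn n) le1).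
by rewrite dvdn_leq ?muln_gt0 ?n0 ?order_gt0 // order_dvdn expgM expg_order.
Qed.

(** In the quotient by H the order of y divides n and k, so y^gcd(n,k) lies in H and the join has at
    most gcd(n,k) |H| elements. *)
Lemma join_cycle_exact H y n k : y \in 'N(H) -> y ^+ n \in H -> 0 < n ->
  #|H| * n <= #|H <*> <[y]>| -> y ^+ k \in H -> n %| k.
Proof.
move=> Ny Hn n0 le_n Hk.
have Hd : y ^+ gcdn n k \in H.
  apply: coset_idr; rewrite ?groupX // morphX //; apply/eqP.
  have E i : y ^+ i \in H -> coset H y ^+ i = 1.
    by move=> Hi; have := coset_id Hi; rewrite morphX.
  by rewrite -order_dvdn dvdn_gcd !order_dvdn !E ?eqxx.
have d0 : 0 < gcdn n k by rewrite gcdn_gt0 n0.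
have := leq_trans le_n (card_join_cycle Ny Hd d0).
rewrite leq_pmul2l ?cardG_gt0 // => le_nd.
have /eqP <- : gcdn n k == n by rewrite eqn_leq le_nd dvdn_leq ?dvdn_gcdl.
exact: dvdn_gcdr.
Qed.

Lemma mem_join_cycle H y g : y \in 'N(H) -> g \in H <*> <[y]> ->
  exists2 h, h \in H & exists k, g = h * y ^+ k.
Proof.
move=> Ny; rewrite norm_joinEr ?cycle_subG // => /mulsgP[h z Hh /cycleP[k ->] ->].
by exists h => //; exists k.
Qed.

Definition up H J := (coset H @*^-1 'Z(J / H))%G.

Lemma mem_up H J y : H <| J ->
  reflect (y \in J /\ {in J, forall g, [~ y, g] \in H}) (y \in up H J).
Proof.
move=> nHJ; have sJN := normal_norm nHJ.
apply: (iffP idP) => [|[Jy Hy]].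
  move=> /morphpreP[Ny /setIP[/morphimP[z Nz Jz E] Cy]].
  have Jy : y \in J.
    by rewrite -(quotientGK nHJ) mem_morphpre // E mem_morphim.
  split=> // g Jg; have Ng := subsetP sJN g Jg.
  apply: coset_idr; rewrite ?groupR // morphR //; apply/eqP/commgP.
  by apply: (centP Cy); rewrite mem_morphim.
have Ny := subsetP sJN y Jy; rewrite mem_morphpre // inE mem_morphim //=.
apply/centP=> _ /morphimP[g Ng Jg ->]; apply/commgP.
by rewrite -morphR //; apply/eqP/coset_id/Hy.
Qed.

Lemma up_gen H J y (S : {set gT}) : H <| J -> J = <<S>> :> {set gT} ->
  y \in J -> {in S, forall g, [~ y, g] \in H} -> y \in up H J.
Proof.
move=> nHJ defJ Jy HS; have sJN := normal_norm nHJ.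
have Ny := subsetP sJN y Jy.
apply/mem_up=> //; split=> // g Jg.
have JC : J \subset coset H @*^-1 'C[coset H y].
  rewrite defJ gen_subG; apply/subsetP=> z Sz.
  have Nz : z \in 'N(H) by rewrite (subsetP sJN) // defJ mem_gen.
  rewrite mem_morphpre //; apply/cent1P; apply: commute_sym; apply/commgP.
  by rewrite -morphR //; apply/eqP/coset_id/HS.
have Ng := subsetP sJN g Jg.
have /morphpreP[_ /cent1P/commute_sym/commgP/eqP E] := subsetP JC g Jg.
by apply: coset_idr; rewrite ?groupR // morphR.
Qed.

Lemma up_normal H J : H <| J -> up H J <| J.
Proof.
move=> nHJ; rewrite /normal /=; apply/andP; split.
  by apply/subsetP=> y /mem_up[].
rewrite -{1}(quotientGK nHJ).
apply: subset_trans (morphpre_norm _ _) ; last exact/morphpreS/normal_norm/center_normal.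
Qed.

Lemma sub_up H J : H <| J -> H \subset up H J.
Proof.
move=> nHJ; apply/subsetP=> h Hh; apply/mem_up=> //.
have [sHJ nJH] := andP nHJ; split=> [|g Jg]; first exact: (subsetP sHJ).
by rewrite commgEl groupM ?groupV // memJ_norm // (subsetP nJH).
Qed.

End GroupPrelim.

Definition relpair (gT : finGroupType) (x : nat) (A B : gT) : Prop :=
  A ^ [~ A, B] = A ^+ x.+1 /\ B ^ [~ B, A] = B ^+ x.+1.

Lemma relpair_sym (gT : finGroupType) x (A B : gT) :
  relpair x A B -> relpair x B A.
Proof. by case. Qed.

Section Words.
Variables (gT : finGroupType) (x : nat) (A B : gT).
Hypothesis rel : relpair x A B.
Local Notation C := [~ A, B].

Lemma conjXC k n : (A ^+ k) ^ (C ^+ n) = A ^+ (k * x.+1 ^ n)%N.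
Proof.
elim: n => [|n IH]; first by rewrite conjg1 expn0 muln1.
by rewrite expgSr conjgM IH conjXg rel.1 -expgM expnS mulnC mulnA mulnAC mulnC.
Qed.

Lemma commXC k n : [~ A ^+ k, C ^+ n] = A ^+ (k * (x.+1 ^ n - 1))%N.
Proof.
have n0 : 0 < x.+1 ^ n by rewrite expn_gt0.
by rewrite commgEl conjXC -{1}(subnK n0) mulnDr muln1 addnC expgD mulKg.
Qed.

(** A^B = A C = C A^alpha. Collecting the factors C of (C A^alpha)^n on the left multiplies
    exponents of A by powers of alpha, which sum to alpha + ... + alpha^n. *)
Lemma conjXB n : (A ^+ n) ^ B = C ^+ n * A ^+ (x.+1 * geom x.+1 n)%N.
Proof.
elim: n => [|n IH]; first by rewrite geom0 muln0 !expg0 conj1g mulg1.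
rewrite expgSr conjMg IH conjg_mulR -mulgA (mulgA (A ^+ _)) -expgSr.
rewrite (conjgC _ C) conjXg rel.1 -expgM mulgA -expgSr geomSr.
by congr (_ * _ ^+ _); ring.
Qed.

End Words.

(** * The relation between powers of A and powers of B *)

Section KeyRelation.
Variables (gT : finGroupType) (x : nat) (A B : gT).
Hypothesis rel : relpair x A B.
Local Notation C := [~ A, B].
Let rel' := relpair_sym rel.
Let al := x.+1.

(* Computing [A, B^alpha] both from B^alpha = C B C^-1 and from
   (B^alpha)^A puts a power of A into <[B]>. *)
Lemma key_commute (U : nat) : (al ^ al)%N = (geom al al + U)%N ->
  commute (A ^+ U) B /\ (A ^+ U) ^ (C ^- al) = B ^- (al * U).
Proof.
move=> EU; set g := geom al al in EU.
have EBA : [~ B, A] = C^-1 by rewrite invg_comm.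
have conjBC n k : (B ^+ k) ^ (C ^- n) = B ^+ (k * al ^ n)%N.
  by rewrite -(conjXC rel') EBA expgVn.
have EB : B ^+ al = B ^ C^-1 by rewrite -rel'.1 EBA.
have E1 : A ^ (B ^+ al) = C ^+ al * A ^+ g.
  have conjA k : (A ^+ (al * k)) ^ C^-1 = A ^+ k.
    by rewrite expgM -rel.1 -conjXg conjgK.
  rewrite EB [B ^ _]conjgE invgK (conjgM A C) rel.1 (conjgM _ B) (conjXB rel) conjMg conjA.
  by rewrite conjXg conjgE invgK mulgV mulg1.
have E2 : (B ^+ al) ^ A = C ^- al * B ^+ (al * g)%N.
  by rewrite (conjXB rel') EBA expgVn.
have E3 : (A ^+ U) ^ (C ^- al) = B ^- (al * U).
  have E4 : B ^+ al * A ^+ U = (B ^+ (al * g)) ^ (C ^+ al).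
    apply: (mulgI A); rewrite !mulgA (conjgC A) E1 -!mulgA -expgD -EU.
    rewrite -[(al ^ al)%N]mul1n -(conjXC rel) expg1 -(conjgC A).
    by rewrite [LHS]mulgA (conjgC _ A) E2 !mulgA.
  have : (B ^+ al * A ^+ U) ^ (C ^- al) = B ^+ (al * g) by rewrite E4 conjgK.
  rewrite conjMg conjBC EU => /(canRL (mulKg _)) ->.
  by rewrite mulnDr expgD invMg mulgKV.
(* Conjugation by C^-alpha sends both A^U and B to powers of B, so they commute. *)
split=> //; apply: (@conjg_inj _ (C ^- al)); rewrite !conjMg E3.
rewrite -[B ^ _]/((B ^+ 1) ^ _) conjBC; apply: commute_sym.
by apply/commuteV; apply: commuteX2.
Qed.

End KeyRelation.

Lemma coprime_inv_mod u n : coprime n u -> exists v, (u * v)%N = 1 %[mod n].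
Proof.
rewrite coprime_sym => co_un; have := chinese_modl co_un 0 1.
rewrite mod0n => /eqP/dvdnP[v Ev]; exists v.
by rewrite mulnC -Ev chinese_modr.
Qed.

Lemma q2E p m : (p ^ (2 * m) = p ^ m * p ^ m)%N.
Proof. by rewrite -expnD addnn -mul2n. Qed.
Lemma q3E p m : (p ^ (3 * m) = p ^ (2 * m) * p ^ m)%N.
Proof. by rewrite -expnD; congr (_ ^ _)%N; lia. Qed.

Lemma q7E p m : (p ^ (7 * m) =
  p ^ m * p ^ m * p ^ m * p ^ m * p ^ m * p ^ m * p ^ m)%N.
Proof. by rewrite -!expnD; congr (_ ^ _)%N; lia. Qed.

Section Params.
Variables (p m x : nat).
Hypotheses (p_pr : prime p) (p_odd : odd p) (m_gt0 : 0 < m).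
Hypotheses (x_gt0 : 0 < x) (x_val : logn p x = m).
Hypothesis x3 : p = 3 -> m = 1%N -> (x %/ 3)%N = 1 %[mod 3].
Local Notation q2 := (p ^ (2 * m))%N.
Local Notation q3 := (p ^ (3 * m))%N.

Lemma q_gt0 k : 0 < p ^ k. Proof. by rewrite expn_gt0 prime_gt0. Qed.

Lemma exists_exp_p2m : exists U v,
  (x.+1 ^ x.+1)%N = (geom x.+1 x.+1 + U)%N /\ (U * v)%N = q2 %[mod q3].
Proof.
have [u [Eu pu]] := key_valuation p_pr p_odd m_gt0 x_gt0 x_val x3.
have [v uv] := coprime_inv_mod (coprimeXl (3 * m) pu).
exists (q2 * u)%N, v; split=> //.
by rewrite -mulnA -modnMmr uv modnMmr muln1.
Qed.

End Params.

Section Relations.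
Variables (p m x : nat).
Hypotheses (p_pr : prime p) (p_odd : odd p) (m_gt0 : 0 < m).
Hypotheses (x_gt0 : 0 < x) (x_val : logn p x = m).
Hypothesis x3 : p = 3 -> m = 1%N -> (x %/ 3)%N = 1 %[mod 3].
Local Notation q2 := (p ^ (2 * m))%N.
Local Notation q3 := (p ^ (3 * m))%N.

Definition relq (gT : finGroupType) (A B : gT) : Prop :=
  [/\ relpair x A B, A ^+ q3 = 1 & B ^+ q3 = 1].

Lemma relq_sym (gT : finGroupType) (A B : gT) : relq A B -> relq B A.
Proof. by case=> /relpair_sym. Qed.

(** A^U commutes with A and B, hence with C, and the key relation becomes A^U = B^(-alpha U). By
    symmetry C fixes B^U, whence B^(alpha U) = B^U and A^U B^U = 1. Finally U is q^2 times a unit,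
    so A^(q^2) and B^(q^2) are equal powers of A^U and B^U. *)
Lemma relq_central (gT : finGroupType) (A B : gT) : relq A B ->
  commute (A ^+ q2) B /\ A ^+ q2 * B ^+ q2 = 1.
Proof.
move=> [rel A1 B1]; have rel' := relpair_sym rel.
have [U [v [EU Uv]]] := exists_exp_p2m p_pr p_odd m_gt0 x_gt0 x_val x3.
have [cAB E] := key_commute rel EU; have [cBA _] := key_commute rel' EU.
have fixC (D E' : gT) : commute (D ^+ U) E' -> commute (D ^+ U) [~ D, E'].
  move=> cDE; rewrite commgEl; apply: commuteM.
    by apply/commuteV/commute_sym/commuteX.
  by rewrite conjgE; apply: commuteM; [exact: commuteV | apply: commuteM => //;
    exact/commute_sym/commuteX].
have BU : B ^+ (x.+1 * U) = B ^+ U.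
  rewrite expgM -rel'.1 -conjXg; apply/conjg_fixP/commgP/fixC.
  exact: cBA.
have AU : A ^+ U = B ^- U.
  rewrite -BU -E; apply/esym/conjg_fixP/commgP/commuteV/commuteX/fixC.
  exact: cAB.
have Eq (D : gT) : D ^+ q3 = 1 -> D ^+ q2 = (D ^+ U) ^+ v.
  by move=> D1; rewrite -expgM (expg_eq_mod D1 Uv).
rewrite !Eq //; split; first exact/commute_sym/commuteX/commute_sym.
by rewrite AU expgVn mulVg.
Qed.

Lemma dvd_q3_binx n : q2 %| n -> (x.+1 * geom x.+1 n)%N = n %[mod q3].
Proof.
move=> qn; have E := geom_mod p_pr p_odd m_gt0 x_gt0 x_val (leqnn (2 * m)) qn.
have E3 : (2 * m + m = 3 * m)%N by lia.
rewrite E3 in E; rewrite -modnMmr E modnMmr mulSn.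
by rewrite dvd_mod_add // -E3 expnD mulnC dvdn_mul // dvd_q_x.
Qed.

(** B fixes A^(q^2), whereas [conjXB] gives (A^(q^2))^B = C^(q^2) A^(q^2). *)
Lemma relq_C (gT : finGroupType) (A B : gT) : relq A B ->
  [~ A, B] ^+ q2 = 1.
Proof.
move=> relAB; have [cAB _] := relq_central relAB.
have [rel A1 _] := relAB.
have := conjXB rel q2.
rewrite (expg_eq_mod A1 (dvd_q3_binx (dvdnn _))).
have -> : (A ^+ q2) ^ B = A ^+ q2 by apply/conjg_fixP/commgP.
by rewrite -{1}[A ^+ q2]mul1g => /mulIg.
Qed.

End Relations.

Section Membership.
Variable gT : finGroupType.
Implicit Types (H J K : {group gT}) (y : gT).

Lemma memX_dvd H y d n : y ^+ d \in H -> d %| n -> y ^+ n \in H.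
Proof. by move=> Hy /dvdnP[k ->]; rewrite mulnC expgM groupX. Qed.

Lemma memX_mod H y d n k : y ^+ d \in H -> n = k %[mod d] ->
  y ^- k * y ^+ n \in H.
Proof.
move=> Hy /eqP nk; have [le_kn|/ltnW le_nk] := leqP k n.
  rewrite -(subnKC le_kn) expgD mulKg (memX_dvd Hy) //.
  by rewrite -eqn_mod_dvd.
rewrite -(subnKC le_nk) expgD invMg mulgKV groupV (memX_dvd Hy) //.
by rewrite -eqn_mod_dvd // eq_sym.
Qed.

Lemma sub_up_normal H J K : H <| J -> H \subset K -> K \subset up H J -> K <| J.
Proof.
move=> nHJ sHK sKU; rewrite /normal (subset_trans sKU (normal_sub (up_normal nHJ))).
apply/subsetP=> g Jg; rewrite inE; apply/subsetP=> _ /imsetP[w Ww ->].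
rewrite conjg_mulR groupM // (subsetP sHK) //.
by have /mem_up[//|_] := subsetP sKU w Ww; apply.
Qed.

Lemma upS H K J : H <| J -> K <| J -> H \subset K -> up H J \subset up K J.
Proof.
move=> nH nK /subsetP sHK; apply/subsetP=> y /mem_up[//|Jy Hy].
by apply/mem_up=> //; split=> // g Jg; apply/sHK/Hy.
Qed.

Lemma commV_mem H J y g : H <| J -> y \in J ->
  ([~ y^-1, g] \in H) = ([~ y, g] \in H).
Proof.
move=> /andP[_ /subsetP nHJ] Jy; rewrite -(memJ_norm _ (nHJ y Jy)).
rewrite -[RHS]groupV; congr (_ \in H).
by rewrite invg_comm !commgEl !conjgE invgK !mulgA mulVg mul1g.
Qed.

Lemma commC_mem H y g : ([~ y, g] \in H) = ([~ g, y] \in H).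
Proof. by rewrite -groupV invg_comm. Qed.

Lemma commM_mem H J y z g : H <| J -> z \in J -> g \in J -> [~ y, g] \in H ->
  ([~ y * z, g] \in H) = ([~ z, g] \in H).
Proof.
move=> /andP[_ /subsetP nHJ] Jz Jg Hy; rewrite commMgJ groupMl //.
by rewrite memJ_norm ?nHJ.
Qed.

Lemma ucnS_up n J : 'Z_n.+1(J) = up 'Z_n(J)%G J :> {set gT}.
Proof. by rewrite ucnSn. Qed.

End Membership.

(** * The upper central series *)

Section Chain.
Variables (p m x : nat).
Hypotheses (p_pr : prime p) (p_odd : odd p) (m_gt0 : 0 < m).
Hypotheses (x_gt0 : 0 < x) (x_val : logn p x = m).
Hypothesis x3 : p = 3 -> m = 1%N -> (x %/ 3)%N = 1 %[mod 3].
Local Notation q := (p ^ m)%N.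
Local Notation q2 := (p ^ (2 * m))%N.
Local Notation q3 := (p ^ (3 * m))%N.

Lemma dvd_q_q2 : q %| q2. Proof. by rewrite q2E dvdn_mulr. Qed.

Lemma exp_mod2 n : (x.+1 ^ n = 1 + n * x %[mod q2])%N.
Proof. exact: (exp_mod p_pr p_odd m_gt0 x_gt0 x_val (leq0n m) (dvd1n n)). Qed.

Lemma dvd_exp_sub1 n : (q2 %| x.+1 ^ n - 1) = (q %| n).
Proof.
rewrite -eqn_mod_dvd ?expn_gt0 // exp_mod2 eqn_mod_dvd // addKn.
by rewrite mul2n -addnn (dvd_x_q p_pr x_gt0 x_val).
Qed.

Lemma xx_mod_q n : (x.+1 * n = n %[mod q])%N.
Proof. by rewrite mulSn dvd_mod_add // dvdn_mulr // dvd_q_x. Qed.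

Lemma exp_mod_q n : (x.+1 ^ n = 1 %[mod q])%N.
Proof.
by rewrite -(modn_dvdm _ dvd_q_q2) exp_mod2 modn_dvdm ?dvd_q_q2 // dvd_mod_add //
  dvdn_mull // dvd_q_x.
Qed.

Lemma geom_al_mod_q n : (x.+1 * geom x.+1 n = n * x.+1 ^ n %[mod q])%N.
Proof.
rewrite xx_mod_q -modnMmr exp_mod_q modnMmr muln1.
exact: (geom_mod p_pr p_odd m_gt0 x_gt0 x_val (leq0n _) (dvd1n n)).
Qed.

Lemma geom_al_mod_q2 n : q %| n -> (x.+1 * geom x.+1 n = n * x.+1 ^ n %[mod q2])%N.
Proof.
move=> qn; have qx := dvd_q_x p_pr x_gt0 x_val.
have -> : (n * x.+1 ^ n = n %[mod q2])%N.
  rewrite -modnMmr exp_mod2 modnMmr mulnDr muln1 dvd_mod_add //.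
  by rewrite q2E dvdn_mul // dvdn_mull.
have le_m : m <= 2 * m by rewrite mul2n -addnn leq_addr.
have := geom_mod p_pr p_odd m_gt0 x_gt0 x_val le_m qn.
rewrite addnn -mul2n => E; rewrite -modnMmr E modnMmr mulSn dvd_mod_add //.
by rewrite q2E dvdn_mul.
Qed.

Section CommMod.
Variables (gT : finGroupType) (A B : gT) (H : {group gT}) (d : nat).
Hypotheses (rel : relpair x A B) (HA : A ^+ d \in H).
Local Notation C := [~ A, B].

(** [A^n, B] = C^n A^r with r = alpha + ... + alpha^n - n alpha^n; the congruence puts A^r in H. *)
Lemma commXB_mod n : (x.+1 * geom x.+1 n = n * x.+1 ^ n %[mod d])%N ->
  ([~ A ^+ n, B] \in H) = (C ^+ n \in H).
Proof.
move=> E; rewrite commgEl (conjXB rel) mulgA (conjgC _ (C ^+ n)).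
by rewrite conjVg (conjXC rel) -mulgA groupMr // (memX_mod HA).
Qed.

Lemma commCX_mem n : ([~ C ^+ n, A] \in H) = (A ^+ (x.+1 ^ n - 1) \in H).
Proof. by rewrite commC_mem; have := commXC rel 1 n; rewrite expg1 mul1n => ->. Qed.

End CommMod.

Variables (gT : finGroupType) (A B : gT) (J : {group gT}).
Implicit Types (H : {group gT}) (y : gT).
Hypotheses (relAB : relq p m x A B) (defJ : J = <<[set A; B]>> :> {set gT}).
Local Notation C := [~ A, B].

(* W3a and W5 are only intermediate steps; W1, .., W4 are Z_1, .., Z_4 when
   #|J| = p^(7m). *)
Definition W1 := (1 <*> <[A ^+ q2]>)%G.
Definition W2 := (W1 <*> <[C ^+ q]>)%G.
Definition W3a := (W2 <*> <[A ^+ q]>)%G.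
Definition W3 := (W3a <*> <[B ^+ q]>)%G.
Definition W4 := (W3 <*> <[C]>)%G.
Definition W5 := (W4 <*> <[A]>)%G.
Definition W6 := (W5 <*> <[B]>)%G.

Let JA : A \in J. Proof. by rewrite defJ mem_gen // !inE eqxx. Qed.
Let JB : B \in J. Proof. by rewrite defJ mem_gen // !inE eqxx orbT. Qed.
Let JC : C \in J. Proof. exact: groupR. Qed.
Let rel : relpair x A B. Proof. by case: relAB. Qed.
Let rel' : relpair x B A. Proof. exact: relpair_sym. Qed.
Let EBA : [~ B, A] = C^-1. Proof. by rewrite invg_comm. Qed.

Let mem_join_r (H : {group gT}) y : y \in H <*> <[y]>.
Proof. by rewrite (subsetP (joing_subr _ _)) // cycle_id. Qed.

Let sW12 : W1 \subset W2. Proof. exact: joing_subl. Qed.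
Let sW23a : W2 \subset W3a. Proof. exact: joing_subl. Qed.
Let sW3a3 : W3a \subset W3. Proof. exact: joing_subl. Qed.
Let sW23 : W2 \subset W3. Proof. exact: subset_trans sW3a3. Qed.
Let sW34 : W3 \subset W4. Proof. exact: joing_subl. Qed.
Let sW45 : W4 \subset W5. Proof. exact: joing_subl. Qed.

Let W1A : A ^+ q2 \in W1. Proof. exact: mem_join_r. Qed.
Let W1B : B ^+ q2 \in W1.
Proof.
have [_ E] := relq_central p_pr p_odd m_gt0 x_gt0 x_val x3 relAB.
have -> : B ^+ q2 = (A ^+ q2)^-1 by rewrite -[RHS]mulg1 -E mulKg.
by rewrite groupV.
Qed.
Let W2C : C ^+ q \in W2. Proof. exact: mem_join_r. Qed.
Let W3aA : A ^+ q \in W3a. Proof. exact: mem_join_r. Qed.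
Let W3A : A ^+ q \in W3. Proof. exact: (subsetP sW3a3). Qed.
Let W3B : B ^+ q \in W3. Proof. exact: mem_join_r. Qed.
Let W4C : C \in W4. Proof. exact: mem_join_r. Qed.

Lemma gen_up (H : {group gT}) y : H <| J -> y \in J -> [~ y, A] \in H -> [~ y, B] \in H ->
  y \in up H J.
Proof.
by move=> nH Jy yA yB; apply: (up_gen nH defJ) => // g; rewrite !inE => /pred2P[]->.
Qed.

Lemma W1_up : W1 \subset up 1%G J.
Proof.
rewrite join_subG sub_up ?normal1 //= cycle_subG.
have [/commgP/eqP c1 _] := relq_central p_pr p_odd m_gt0 x_gt0 x_val x3 relAB.
apply: gen_up; rewrite ?normal1 ?groupX // ?c1 ?group1 //.
by apply/set1P/eqP/commgP/commute_sym/commuteX.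
Qed.

Lemma W1_normal : W1 <| J.
Proof. by apply: sub_up_normal W1_up; rewrite ?normal1 // sub1G. Qed.

Lemma W2_up : W2 \subset up W1 J.
Proof.
have nW1 := W1_normal; rewrite join_subG sub_up //= cycle_subG.
have q2q : q2 %| x.+1 ^ q - 1 by rewrite dvd_exp_sub1.
apply: gen_up; rewrite ?groupX //.
  by rewrite (commCX_mem _ rel) (memX_dvd W1A).
rewrite -(commV_mem _ nW1) ?groupX // -expgVn -EBA.
by rewrite (commCX_mem _ rel') (memX_dvd W1B).
Qed.

Lemma W2_normal : W2 <| J.
Proof. by apply: sub_up_normal W2_up; rewrite ?W1_normal. Qed.

Lemma W3_up : W3 \subset up W2 J.
Proof.
have nW2 := W2_normal; rewrite join_subG join_subG sub_up //= !cycle_subG.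
apply/andP; split; apply: gen_up; rewrite ?groupX //.
- by rewrite (eqP (_ : [~ A ^+ q, A] == 1)) //; apply/commgP/commute_sym/commuteX.
- by rewrite (commXB_mod rel (subsetP sW12 _ W1A)) // geom_al_mod_q2.
- rewrite (commXB_mod rel' (subsetP sW12 _ W1B)) ?geom_al_mod_q2 //.
  by rewrite EBA expgVn groupV.
by rewrite (eqP (_ : [~ B ^+ q, B] == 1)) //; apply/commgP/commute_sym/commuteX.
Qed.

Lemma W3_normal : W3 <| J.
Proof. by apply: sub_up_normal W3_up; rewrite ?W2_normal. Qed.

Lemma W3a_normal : W3a <| J.
Proof. by apply: sub_up_normal (subset_trans sW3a3 W3_up); rewrite ?W2_normal. Qed.

Lemma W4_up : W4 \subset up W3 J.
Proof.
have nW3 := W3_normal; rewrite join_subG sub_up //= cycle_subG.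
have qx : q %| x.+1 ^ 1 - 1 by rewrite expn1 subn1 dvd_q_x.
apply: gen_up => //.
  by rewrite -[C]expg1 (commCX_mem _ rel) (memX_dvd W3A).
rewrite -(commV_mem _ nW3) // -EBA -[[~ B, A]]expg1.
by rewrite (commCX_mem _ rel') (memX_dvd W3B).
Qed.

Lemma W4_normal : W4 <| J.
Proof. by apply: sub_up_normal W4_up; rewrite ?W3_normal. Qed.

Lemma W5_up : W5 \subset up W4 J.
Proof.
have nW4 := W4_normal; rewrite join_subG sub_up //= cycle_subG.
by apply: gen_up => //; rewrite commgg group1.
Qed.

Lemma W5_normal : W5 <| J.
Proof. by apply: sub_up_normal W5_up; rewrite ?W4_normal. Qed.

Lemma W6E : W6 = J.
Proof.
apply/eqP; rewrite -val_eqE eqEsubset /= join_subG (normal_sub W5_normal) cycle_subG JB.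
rewrite {1}defJ gen_subG; apply/subsetP=> y; rewrite !inE => /pred2P[]->.
  by rewrite (subsetP (joing_subl _ _)) //= mem_join_r.
exact: mem_join_r.
Qed.

Let nJ (H : {group gT}) y : H <| J -> y \in J -> y \in 'N(H).
Proof. by move=> /normal_norm/subsetP; apply. Qed.

Lemma W_steps : [/\ (A ^+ q2) ^+ q \in 1%G, (C ^+ q) ^+ q \in W1,
  (A ^+ q) ^+ q \in W2, (B ^+ q) ^+ q \in W3a &
  [/\ C ^+ q \in W3, A ^+ q \in W4 & B ^+ q \in W5]].
Proof.
have [_ A1 B1] := relAB.
rewrite -!expgM -q3E -q2E A1 (relq_C p_pr p_odd m_gt0 x_gt0 x_val x3 relAB) !group1.
rewrite (subsetP sW12) // (subsetP sW23a) ?(subsetP sW12) //.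
rewrite (subsetP sW23) // (subsetP sW34) // (subsetP sW45) // (subsetP sW34) //.
Qed.

Lemma W_card_le : [/\ #|W1| <= q, #|W2| <= #|W1| * q, #|W3a| <= #|W2| * q,
  #|W3| <= #|W3a| * q & [/\ #|W4| <= #|W3| * q, #|W5| <= #|W4| * q
  & #|J| <= #|W5| * q]].
Proof.
have q0 := q_gt0 p_pr m.
have [s1 s2 s3 s4 [s5 s6 s7]] := W_steps.
have c1 := card_join_cycle (nJ (normal1 J) (groupX q2 JA)) s1 q0.
split; last split.
- by rewrite cards1 mul1n in c1.
- exact: (card_join_cycle (nJ W1_normal (groupX q JC)) s2 q0).
- exact: (card_join_cycle (nJ W2_normal (groupX q JA)) s3 q0).
- exact: (card_join_cycle (nJ W3a_normal (groupX q JB)) s4 q0).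
- exact: (card_join_cycle (nJ W3_normal JC) s5 q0).
- exact: (card_join_cycle (nJ W4_normal JA) s6 q0).
by rewrite -W6E; exact: (card_join_cycle (nJ W5_normal JB) s7 q0).
Qed.

Lemma relq_card_le : #|J| <= p ^ (7 * m).
Proof.
have [c1 c2 c3 c4 [c5 c6 c7]] := W_card_le.
rewrite q7E.
have M a b : a <= b -> a * q <= b * q by move=> ab; rewrite leq_mul2r ab orbT.
have := leq_trans c2 (M _ _ c1) => {}c2; have := leq_trans c3 (M _ _ c2) => {}c3.
have := leq_trans c4 (M _ _ c3) => {}c4; have := leq_trans c5 (M _ _ c4) => {}c5.
have := leq_trans c6 (M _ _ c5) => {}c6; exact: leq_trans c7 (M _ _ c6).
Qed.

Hypothesis cardJ : p ^ (7 * m) <= #|J|.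

Let q0 : 0 < q. Proof. exact: q_gt0. Qed.

(** Each of the seven steps has index at most q and the total is at least q^7, so every index is
    exactly q. *)
Lemma W_card : [/\ #|W1| = q, #|W2| = (q * q)%N, #|W3a| = (q * q * q)%N,
  #|W3| = (q * q * q * q)%N & [/\ #|W4| = (q * q * q * q * q)%N,
  #|W5| = (q * q * q * q * q * q)%N & #|J| = (p ^ (7 * m))%N]].
Proof.
have [c1 c2 c3 c4 [c5 c6 c7]] := W_card_le.
have := cardJ; rewrite q7E => c8.
have M a b : a <= b -> a * q <= b * q by move=> ab; rewrite leq_mul2r ab orbT.
have D a b : a * q <= b * q -> a <= b by rewrite leq_pmul2r.
have d2 := leq_trans c2 (M _ _ c1); have d3 := leq_trans c3 (M _ _ d2).
have d4 := leq_trans c4 (M _ _ d3); have d5 := leq_trans c5 (M _ _ d4).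
have d6 := leq_trans c6 (M _ _ d5); have d7 := leq_trans c7 (M _ _ d6).
have e6 := D _ _ (leq_trans c8 c7); have e5 := D _ _ (leq_trans e6 c6).
have e4 := D _ _ (leq_trans e5 c5); have e3 := D _ _ (leq_trans e4 c4).
have e2 := D _ _ (leq_trans e3 c3); have e1 := D _ _ (leq_trans e2 c2).
by split; last split; apply/eqP; rewrite eqn_leq; apply/andP; split.
Qed.

Let exact (H K : {group gT}) y k : H <| J -> y \in J -> y ^+ q \in H ->
  #|H <*> <[y]>| = (#|H| * q)%N -> y ^+ k \in H -> q %| k.
Proof.
move=> nH Jy Hy E; apply: join_cycle_exact => //; last by rewrite E.
exact: nJ.
Qed.

Lemma A_mem_W4 k : A ^+ k \in W4 -> q %| k.
Proof.
have [_ _ _ _ [_ s6 _]] := W_steps; have [_ _ _ _ [e5 e6 _]] := W_card.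
by apply: (exact W4 W4_normal) => //; rewrite e5 -e6.
Qed.

Lemma B_mem_W5 k : B ^+ k \in W5 -> q %| k.
Proof.
have [_ _ _ _ [_ _ s7]] := W_steps; have [_ _ _ _ [_ e6 e7]] := W_card.
apply: (exact W5 W5_normal) => //; rewrite -/(joinG _ _) e6 -q7E -e7.
by have /(congr1 (fun K : {group gT} => #|K|)) := W6E.
Qed.

Lemma C_mem_W3 k : C ^+ k \in W3 -> q %| k.
Proof.
have [_ _ _ _ [s5 _ _]] := W_steps; have [_ _ _ e4 [e5 _ _]] := W_card.
by apply: (exact W3 W3_normal) => //; rewrite e4 -e5.
Qed.

Let dvd_mul_q (H : {group gT}) y k : q %| k ->
  (forall i, (y ^+ q) ^+ i \in H -> q %| i) -> y ^+ k \in H -> q2 %| k.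
Proof.
case/dvdnP=> i -> Hy; rewrite mulnC expgM => /Hy qi.
by rewrite q2E dvdn_mul.
Qed.

Lemma C_mem_W1 k : C ^+ k \in W1 -> q2 %| k.
Proof.
have [_ s2 _ _ _] := W_steps; have [e1 e2 _ _ _] := W_card.
move=> Hk; apply: (dvd_mul_q _ _ Hk); last move=> i.
  by apply: C_mem_W3; rewrite (subsetP sW23) // (subsetP sW12).
by apply: (exact W1 W1_normal) => //; rewrite ?e1 -?e2 ?groupX.
Qed.

Lemma A_mem_W2 k : A ^+ k \in W2 -> q2 %| k.
Proof.
have [_ _ s3 _ _] := W_steps; have [_ e2 e3 _ _] := W_card.
move=> Hk; apply: (dvd_mul_q _ _ Hk); last move=> i.
  by apply: A_mem_W4; rewrite (subsetP sW34) // (subsetP sW23).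
by apply: (exact W2 W2_normal) => //; rewrite ?e2 -?e3 ?groupX.
Qed.

Lemma B_mem_W3a k : B ^+ k \in W3a -> q2 %| k.
Proof.
have [_ _ _ s4 _] := W_steps; have [_ _ e3 e4 _] := W_card.
move=> Hk; apply: (dvd_mul_q _ _ Hk); last move=> i.
  by apply: B_mem_W5; rewrite (subsetP sW45) // (subsetP sW34) // (subsetP sW3a3).
by apply: (exact W3a W3a_normal) => //; rewrite ?e3 -?e4 ?groupX.
Qed.

Lemma A_order k : A ^+ k = 1 -> q3 %| k.
Proof.
have [s1 _ _ _ _] := W_steps; have [e1 _ _ _ _] := W_card.
move=> Ak; have : q2 %| k by apply: A_mem_W2; rewrite Ak group1.
case/dvdnP=> i Ek; move: Ak; rewrite Ek mulnC expgM q3E => Ai.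
rewrite dvdn_mul //; apply: (exact 1%G (normal1 J) (groupX q2 JA) s1).
  by rewrite cards1 mul1n -e1.
by rewrite Ai group1.
Qed.

Lemma AB_mem_W4 i j : A ^+ i * B ^+ j \in W4 -> (q %| i) && (q %| j).
Proof.
move=> H; have qj : q %| j.
  apply: B_mem_W5; rewrite -(groupMl _ (_ : A ^+ i \in W5)).
    exact: (subsetP sW45).
  by rewrite groupX // mem_join_r.
rewrite qj andbT; apply: A_mem_W4; move: H; rewrite groupMr //.
by rewrite (subsetP sW34) // (memX_dvd W3B).
Qed.

Lemma AB_mem_W2 i j : A ^+ i * B ^+ j \in W2 -> (q2 %| i) && (q2 %| j).
Proof.
move=> H; have /AB_mem_W4/andP[qi qj] : A ^+ i * B ^+ j \in W4.
  by rewrite (subsetP sW34) // (subsetP sW23).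
have q2j : q2 %| j.
  apply: B_mem_W3a; rewrite -(groupMl _ (_ : A ^+ i \in W3a)).
    exact: (subsetP sW23a).
  exact: (memX_dvd W3aA).
rewrite q2j andbT; apply: A_mem_W2; move: H; rewrite groupMr //.
by rewrite (subsetP sW12) // (memX_dvd W1B).
Qed.

Lemma J_decomp g : g \in J ->
  exists2 w, w \in W4 & exists i j, g = w * A ^+ i * B ^+ j.
Proof.
rewrite -{1}W6E => /mem_join_cycle[]; first exact: nJ W5_normal JB.
move=> h /mem_join_cycle[|w Ww [i ->] [j ->]]; first exact: nJ W4_normal JA.
by exists w => //; exists i, j.
Qed.

Lemma W4_decomp g : g \in W4 -> exists2 w, w \in W3 & exists k, g = w * C ^+ k.
Proof. by case/mem_join_cycle=> [|w Ww [k ->]]; [exact: nJ W3_normal JC | exists w => //;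
  exists k]. Qed.

Lemma W3_decomp g : g \in W3 ->
  exists2 w, w \in W2 & exists i j, g = w * A ^+ (q * i) * B ^+ (q * j).
Proof.
case/mem_join_cycle; first exact: nJ W3a_normal (groupX q JB).
move=> h /mem_join_cycle[|w Ww [i ->] [j ->]]; first exact: nJ W2_normal (groupX q JA).
by exists w => //; exists i, j; rewrite !expgM.
Qed.

Lemma W2_decomp g : g \in W2 -> exists2 w, w \in W1 & exists k, g = w * C ^+ (q * k).
Proof.
case/mem_join_cycle=> [|w Ww [k ->]]; first exact: nJ W1_normal (groupX q JC).
by exists w => //; exists k; rewrite expgM.
Qed.

Lemma W1_decomp g : g \in W1 -> exists k, g = A ^+ (q2 * k).
Proof.
rewrite /= joing1G => /cycleP[k ->]; by exists k; rewrite expgM.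
Qed.

(** Write g = w A^i B^j with w in W4. Commuting with A and with B modulo W3 puts C^j and C^i in W3,
    so q divides i and j. Each of the next three inclusions uses the previous one to place g in a
    smaller subgroup, where its normal form is shorter. *)
Lemma up_W3 : up W3 J \subset W4.
Proof.
have nW3 := W3_normal; apply/subsetP=> g /mem_up[// | Jg Hg].
have [w Ww [i [j Eg]]] := J_decomp Jg; have sWJ := subsetP (normal_sub W4_normal).
have /mem_up[//|_ Hw] := subsetP W4_up w Ww.
have qj : q %| j.
  have := Hg A JA; rewrite Eg (commM_mem nW3) ?groupX //.
    rewrite (commXB_mod rel' W3B) ?geom_al_mod_q // EBA expgVn groupV.
    exact: C_mem_W3.
  rewrite (commM_mem nW3) ?groupX ?Hw //.
  by have /commgP/eqP-> : commute (A ^+ i) A by exact/commute_sym/commuteX.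
have qi : q %| i.
  apply: C_mem_W3; rewrite -(commXB_mod rel W3A) ?geom_al_mod_q //.
  have := Hg B JB; have W3Bj : B ^+ j \in W3 by exact: (memX_dvd W3B).
  have /normal_norm/subsetP nW3' := nW3.
  rewrite Eg commMgJ groupMr; last first.
    by have /commgP/eqP-> : commute (B ^+ j) B by exact/commute_sym/commuteX.
  by rewrite memJ_norm ?nW3' ?groupX // (commM_mem nW3) ?groupX ?Hw.
rewrite Eg !groupM //; first by rewrite (subsetP sW34) // (memX_dvd W3A).
by rewrite (subsetP sW34) // (memX_dvd W3B).
Qed.

Lemma up_W2 : up W2 J \subset W3.
Proof.
have nW2 := W2_normal; apply/subsetP=> g Ug.
have /(subsetP up_W3) Wg := subsetP (upS nW2 W3_normal sW23) g Ug.
have [w Ww [k Eg]] := W4_decomp Wg; have /mem_up[//|Jg Hg] := Ug.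
have /mem_up[//|_ Hw] := subsetP W3_up w Ww.
rewrite Eg groupM // ; have := Hg A JA; rewrite Eg (commM_mem nW2 (groupX k JC) JA (Hw A JA)).
rewrite (commCX_mem _ rel) => /A_mem_W2.
rewrite dvd_exp_sub1 => qk; exact: (memX_dvd (subsetP sW23 _ W2C)).
Qed.

Lemma up_W1 : up W1 J \subset W2.
Proof.
have nW1 := W1_normal; apply/subsetP=> g Ug.
have /(subsetP up_W2) Wg := subsetP (upS nW1 W2_normal sW12) g Ug.
have [w Ww [i [j Eg]]] := W3_decomp Wg; have /mem_up[//|Jg Hg] := Ug.
have /mem_up[//|_ Hw] := subsetP W2_up w Ww.
have qi : q2 %| q * i.
  apply: C_mem_W1; rewrite -(commXB_mod rel W1A) ?geom_al_mod_q2 ?dvdn_mulr //.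
  have := Hg B JB; have /normal_norm/subsetP nW1' := nW1.
  rewrite Eg commMgJ groupMr; last first.
    by have /commgP/eqP-> : commute (B ^+ (q * j)) B by exact/commute_sym/commuteX.
  by rewrite memJ_norm ?nW1' ?groupX // (commM_mem nW1) ?groupX ?Hw.
have qj : q2 %| q * j.
  have := Hg A JA; rewrite Eg (commM_mem nW1) ?groupX //.
    rewrite (commXB_mod rel' W1B (geom_al_mod_q2 (dvdn_mulr j (dvdnn q)))).
    by rewrite EBA expgVn groupV; apply: C_mem_W1.
  rewrite (commM_mem nW1) ?groupX ?Hw //.
  by have /commgP/eqP-> : commute (A ^+ (q * i)) A by exact/commute_sym/commuteX.
by rewrite Eg !groupM // (subsetP sW12) ?(memX_dvd W1A) ?(memX_dvd W1B).
Qed.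

(** Here g = w C^(q k) with w central, and commuting with A forces alpha^(q k) = 1 modulo q^3. Then
    q^2 divides q k, and C^(q k) = 1. *)
Lemma up_1 : up 1%G J \subset W1.
Proof.
have n1 := normal1 J; apply/subsetP=> g Ug.
have /(subsetP up_W1) Wg := subsetP (upS n1 W1_normal (sub1G _)) g Ug.
have [w Ww [k Eg]] := W2_decomp Wg; have /mem_up[//|Jg Hg] := Ug.
have /mem_up[//|_ Hw] := subsetP W1_up w Ww.
rewrite Eg groupM // ; have := Hg A JA; rewrite Eg (commM_mem n1 (groupX _ JC) JA (Hw A JA)).
rewrite (commCX_mem _ rel) => /set1P/A_order.
rewrite exp_order // => qk; rewrite (_ : _ ^+ _ = 1) //.
by case/dvdnP: qk => i ->; rewrite mulnC expgM (relq_C p_pr p_odd m_gt0 x_gt0 x_val x3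
  relAB) expg1n.
Qed.

Lemma ucn_W : [/\ 'Z_1(J) = W1, 'Z_2(J) = W2, 'Z_3(J) = W3 & 'Z_4(J) = W4].
Proof.
have E (H K : {group gT}) n : 'Z_n(J) = H -> up H J \subset K -> K \subset up H J ->
  'Z_n.+1(J) = K.
  move=> ZH s1 s2; rewrite ucnS_up (_ : 'Z_n(J)%G = H); last exact: val_inj.
  by apply/eqP; rewrite eqEsubset s1.
have E1 : 'Z_1(J) = W1 by apply: (E 1%G); rewrite ?ucn0 ?up_1 ?W1_up.
have E2 := E _ _ _ E1 up_W1 W2_up; have E3 := E _ _ _ E2 up_W2 W3_up.
by have E4 := E _ _ _ E3 up_W3 W4_up.
Qed.

End Chain.

Lemma expg_pair (gT1 gT2 : finGroupType) (a : gT1) (b : gT2) n :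
  (a, b) ^+ n = (a ^+ n, b ^+ n).
Proof. by elim: n => // n IH; rewrite !expgS IH. Qed.

(** * Automorphisms trivial modulo Z_3 *)

Section AutOfPair.
Variables (p m x : nat).
Hypotheses (p_pr : prime p) (p_odd : odd p) (m_gt0 : 0 < m).
Hypotheses (x_gt0 : 0 < x) (x_val : logn p x = m).
Hypothesis x3 : p = 3 -> m = 1%N -> (x %/ 3)%N = 1 %[mod 3].
Variables (gT : finGroupType) (J : {group gT}).

Lemma relq_pair (rT : finGroupType) (A B : gT) (A' B' : rT) :
  relq p m x A B -> relq p m x A' B' -> relq p m x (A, A') (B, B').
Proof.
move=> [[r1 r2] a1 b1] [[r1' r2'] a1' b1'].
by split; first split; rewrite expg_pair -1?r1 -1?r1' -1?r2 -1?r2' ?a1 ?b1 ?a1' ?b1'.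
Qed.

(* The subgroup of J * J generated by (A, A') and (B, B') satisfies the
   relations too, so it is no larger than J and must be the graph of an
   automorphism. *)
Lemma aut_of_pair (A B A' B' : gT) :
  J = <<[set A; B]>> :> {set gT} -> J = <<[set A'; B']>> :> {set gT} ->
  relq p m x A B -> relq p m x A' B' -> p ^ (7 * m) <= #|J| ->
  exists f : {perm gT}, [/\ f \in Aut J, f A = A' & f B = B'].
Proof.
move=> defJ defJ' rAB rAB' leJ.
pose D := <<[set (A, A'); (B, B')]>>%G.
have DA : (A, A') \in D by rewrite mem_gen // !inE eqxx.
have DB : (B, B') \in D by rewrite mem_gen // !inE eqxx orbT.
have leD : #|D| <= #|J|.
  apply: leq_trans leJ.
  exact: (relq_card_le p_pr p_odd m_gt0 x_gt0 x_val x3 (relq_pair rAB rAB')).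
pose f1 := restrm_morphism (subsetT D) [morphism of fst].
pose f2 := restrm_morphism (subsetT D) [morphism of snd].
have im1 : f1 @* D = J.
  rewrite morphim_restrm setIid morphim_gen ?subsetT // defJ; congr <<_>>.
  by rewrite morphimEsub ?subsetT // imsetU1 imset_set1.
have im2 : f2 @* D = J.
  rewrite morphim_restrm setIid morphim_gen ?subsetT // defJ'; congr <<_>>.
  by rewrite morphimEsub ?subsetT // imsetU1 imset_set1.
have inj1 : 'injm f1.
  by rewrite -card_im_injm eqn_leq leq_morphim im1.
have inj2 : 'injm f2.
  by rewrite -card_im_injm eqn_leq leq_morphim im2.
pose h g := f2 (invm inj1 g).
have Dinv g : g \in J -> invm inj1 g \in D.
  by rewrite -im1 => Jg; have := mem_morphim (invm_morphism inj1) Jg Jg; rewrite im_invm.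
have hM : {in J &, {morph h : u v / u * v}}.
  by move=> u v Ju Jv; rewrite /h (morphM (invm_morphism inj1)) ?im1.
pose hm := Morphism hM.
have hA : hm A = A' by rewrite /= /h -{1}[A]/(f1 (A, A')) invmE.
have hB : hm B = B' by rewrite /= /h -{1}[B]/(f1 (B, B')) invmE.
have JA : A \in J by rewrite defJ mem_gen // !inE eqxx.
have JB : B \in J by rewrite defJ mem_gen // !inE eqxx orbT.
have imh : hm @* J = J.
  have sABJ : [set A; B] \subset J by rewrite subUset !sub1set JA.
  transitivity (hm @* <<[set A; B]>>); first by rewrite -defJ.
  rewrite morphim_gen // [RHS]defJ'; congr <<_>>.
  by rewrite morphimEsub // imsetU1 imset_set1 hA hB.
have injh : 'injm hm by rewrite -card_im_injm imh.
by exists (aut injh imh); rewrite Aut_aut !autE.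
Qed.

Lemma pres_card_ge :
  J \isog Grp (a : b :
     a ^ [~ a, b] = a ^+ x.+1, b ^ [~ b, a] = b ^+ x.+1,
     a ^+ (p ^ (3 * m))%N = b ^+ (p ^ (3 * m))%N = 1) ->
  forall (rT : finGroupType) (a b : rT), relq p m x a b -> #|<<[set a; b]>>| <= #|J|.
Proof.
move=> isoJ rT a b [[r1 r2] a1 b1].
suff : <<[set a; b]>> \homg J by apply: leq_homg.
rewrite isoJ; apply/existsP; exists (a, b) => /=.
by rewrite !xpair_eqE /= r1 r2 a1 b1 !eqxx !andbT joing_idl joing_idr.
Qed.

End AutOfPair.

(** * Commutation and exponents within the upper central series *)

Section Center.
Variables (p m x : nat).
Hypotheses (p_pr : prime p) (p_odd : odd p) (m_gt0 : 0 < m).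
Hypotheses (x_gt0 : 0 < x) (x_val : logn p x = m).
Hypothesis x3 : p = 3 -> m = 1%N -> (x %/ 3)%N = 1 %[mod 3].
Variables (gT : finGroupType) (J : {group gT}) (A B : gT).
Hypotheses (relAB : relq p m x A B) (defJ : J = <<[set A; B]>> :> {set gT}).
Hypothesis cardJ : p ^ (7 * m) <= #|J|.
Local Notation q := (p ^ m)%N.
Local Notation q2 := (p ^ (2 * m))%N.
Local Notation q3 := (p ^ (3 * m))%N.
Local Notation C := [~ A, B].
Local Notation Z n := 'Z_n(J).
Implicit Types z g w h : gT.

Lemma genA : A \in J. Proof. by rewrite defJ mem_gen // !inE eqxx. Qed.
Lemma genB : B \in J. Proof. by rewrite defJ mem_gen // !inE eqxx orbT. Qed.
Lemma genC : C \in J. Proof. by rewrite groupR ?genA ?genB. Qed.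
Let JA := genA.
Let JB := genB.
Let JC := genC.

Lemma Z_W : [/\ 'Z_1(J) = W1 p m A, 'Z_2(J) = W2 p m A B, 'Z_3(J) = W3 p m A B
  & 'Z_4(J) = W4 p m A B].
Proof. exact: (ucn_W p_pr p_odd m_gt0 x_gt0 x_val x3 relAB defJ cardJ). Qed.

Lemma Z_comm n z g : z \in Z n.+1 -> g \in J -> [~ z, g] \in Z n.
Proof. by rewrite ucnS_up => /mem_up[|_ +]; [exact: ucn_normal | exact]. Qed.

Lemma Z_sub n k z : z \in Z n -> n <= k -> z \in Z k.
Proof. by move=> Zz nk; apply: (subsetP (ucn_sub_geq _ nk)). Qed.

Lemma Z_J n z : z \in Z n -> z \in J.
Proof. exact/subsetP/ucn_sub. Qed.

Lemma Z_card : [/\ #|Z 1| = q, #|Z 3| = (q * q * q * q)%N,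
  #|Z 4| = (q * q * q * q * q)%N & #|J| = (p ^ (7 * m))%N].
Proof.
have [-> _ -> ->] := Z_W.
by have [-> _ _ -> [-> _ ->]] :=
  W_card p_pr p_odd m_gt0 x_gt0 x_val x3 relAB defJ cardJ.
Qed.

Lemma A_Z1 : A ^+ q2 \in Z 1.
Proof. by have [-> _ _ _] := Z_W; rewrite /= joing1G cycle_id. Qed.

Lemma B_q2 : B ^+ q2 = A ^- q2.
Proof.
have [_ E] := relq_central p_pr p_odd m_gt0 x_gt0 x_val x3 relAB.
by rewrite -[RHS]mulg1 -E mulKg.
Qed.

Lemma B_Z1 : B ^+ q2 \in Z 1. Proof. by rewrite B_q2 groupV A_Z1. Qed.

Lemma C_Z2 : C ^+ q \in Z 2.
Proof. by have [_ -> _ _] := Z_W; rewrite mem_gen // inE cycle_id orbT. Qed.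

Lemma A_Z3 : A ^+ q \in Z 3.
Proof.
have [_ _ -> _] := Z_W; rewrite mem_gen // inE; apply/orP; left.
by rewrite mem_gen // inE cycle_id orbT.
Qed.

Lemma B_Z3 : B ^+ q \in Z 3.
Proof. by have [_ _ -> _] := Z_W; rewrite mem_gen // inE cycle_id orbT. Qed.

Lemma C_Z4 : C \in Z 4.
Proof. by have [_ _ _ ->] := Z_W; rewrite mem_gen // inE cycle_id orbT. Qed.

Lemma Z1_decomp g : g \in Z 1 -> exists k, g = A ^+ (q2 * k).
Proof. have [-> _ _ _] := Z_W; exact: W1_decomp. Qed.

Lemma Z2_decomp g : g \in Z 2 ->
  exists2 w, w \in Z 1 & exists k, g = w * C ^+ (q * k).
Proof.
have [-> -> _ _] := Z_W.
exact: (W2_decomp p_pr p_odd m_gt0 x_gt0 x_val x3 relAB defJ).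
Qed.

Lemma Z3_decomp g : g \in Z 3 -> exists2 w, w \in Z 2 &
  exists i j, g = w * A ^+ (q * i) * B ^+ (q * j).
Proof.
have [_ -> -> _] := Z_W.
exact: (W3_decomp p_pr p_odd m_gt0 x_gt0 x_val x3 relAB defJ).
Qed.

Lemma Z4_decomp g : g \in Z 4 -> exists2 w, w \in Z 3 & exists k, g = w * C ^+ k.
Proof.
have [_ _ -> ->] := Z_W.
exact: (W4_decomp p_pr p_odd m_gt0 x_gt0 x_val x3 relAB defJ).
Qed.

Lemma gen_decomp g : g \in J ->
  exists2 w, w \in Z 4 & exists i j, g = w * A ^+ i * B ^+ j.
Proof.
have [_ _ _ ->] := Z_W.
exact: (J_decomp p_pr p_odd m_gt0 x_gt0 x_val x3 relAB defJ).
Qed.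

Lemma AB_Z4 i j : A ^+ i * B ^+ j \in Z 4 -> (q %| i) && (q %| j).
Proof.
have [_ _ _ ->] := Z_W.
exact: (AB_mem_W4 p_pr p_odd m_gt0 x_gt0 x_val x3 relAB defJ cardJ).
Qed.

Lemma AB_Z2 i j : A ^+ i * B ^+ j \in Z 2 -> (q2 %| i) && (q2 %| j).
Proof.
have [_ -> _ _] := Z_W.
exact: (AB_mem_W2 p_pr p_odd m_gt0 x_gt0 x_val x3 relAB defJ cardJ).
Qed.

Lemma C_mem_Z3 k : C ^+ k \in Z 3 -> q %| k.
Proof.
have [_ _ -> _] := Z_W.
exact: (C_mem_W3 p_pr p_odd m_gt0 x_gt0 x_val x3 relAB defJ cardJ).
Qed.

Lemma C_mem_Z1 k : C ^+ k \in Z 1 -> q2 %| k.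
Proof.
have [-> _ _ _] := Z_W.
exact: (C_mem_W1 p_pr p_odd m_gt0 x_gt0 x_val x3 relAB defJ cardJ).
Qed.

Lemma A_ord k : A ^+ k = 1 -> q3 %| k.
Proof. exact: (A_order p_pr p_odd m_gt0 x_gt0 x_val x3 relAB defJ cardJ). Qed.

Lemma comm_Z4 g h : g \in J -> h \in J -> [~ g, h] \in Z 4.
Proof.
move=> Jg Jh; have nZ4 := ucn_normal 4 J.
have sJU : J \subset up 'Z_4(J)%G J.
  rewrite {1}defJ gen_subG; apply/subsetP=> y /set2P[]->;
    apply: (@up_gen _ 'Z_4(J)%G _ _ _ nZ4 defJ) => // k /set2P[]->.
  - by rewrite commgg group1.
  - exact: C_Z4.
  - by rewrite commC_mem C_Z4.
  by rewrite commgg group1.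
by have /mem_up[//|_] := subsetP sJU g Jg; apply.
Qed.

Lemma Z1_commute z g : z \in Z 1 -> g \in J -> commute z g.
Proof.
by move=> Zz Jg; apply/commgP; have := Z_comm Zz Jg; rewrite ucn0 => /set1P->.
Qed.

Lemma Z1_exp z : z \in Z 1 -> z ^+ q = 1.
Proof.
case/Z1_decomp=> k ->; have [_ A1 _] := relAB.
by rewrite -expgM mulnAC -q3E expgM A1 expg1n.
Qed.

Lemma Z2_exp z : z \in Z 2 -> z ^+ q = 1.
Proof.
case/Z2_decomp=> w Zw [k ->].
rewrite expgMn; last by apply: Z1_commute; rewrite ?groupX.
rewrite Z1_exp // mul1g -expgM mulnAC -q2E expgM.
by rewrite (relq_C p_pr p_odd m_gt0 x_gt0 x_val x3 relAB) expg1n.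
Qed.

Lemma expq_dvd z n : z ^+ q = 1 -> q %| n -> z ^+ n = 1.
Proof. by move=> zq /dvdnP[k ->]; rewrite mulnC expgM zq expg1n. Qed.

Lemma Z3_conjX z g n : z \in Z 3 -> g \in J ->
  z ^ (g ^+ n) = z * [~ z, g] ^+ n * [~ [~ z, g], g] ^+ 'C(n, 2).
Proof.
move=> Zz Jg; have Zy := Z_comm Zz Jg; have Zv := Z_comm Zy Jg.
set y := [~ z, g] in Zy Zv *; set v := [~ y, g] in Zv *.
elim: n => [|n IH]; first by rewrite conjg1 bin0n !mulg1.
rewrite expgSr conjgM IH !conjMg !conjXg.
have -> : v ^ g = v by apply/conjg_fixP/commgP/Z1_commute.
have -> : z ^ g = z * y by rewrite conjg_mulR.
have -> : y ^ g = y * v by rewrite conjg_mulR.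
have cyv : commute y v by apply/commute_sym/Z1_commute => //; apply: Z_J Zy.
rewrite expgMn // binS bin1 addnC expgD (expgS y) !mulgA.
by congr (_ * _); rewrite -!mulgA.
Qed.

(** Conjugation by g^q multiplies z by [z,g]^q [z,g,g]^C(q,2); both factors vanish, since Z_2 has
    exponent dividing q and q divides C(q,2) for odd p. *)
Lemma Z3_commXq z g : z \in Z 3 -> g \in J -> commute z (g ^+ q).
Proof.
move=> Zz Jg; have Zy := Z_comm Zz Jg; have Zv := Z_comm Zy Jg.
apply/commgP/conjg_fixP; rewrite Z3_conjX // Z2_exp // mulg1.
by rewrite expq_dvd ?mulg1 ?Z1_exp // dvd_q_bin2.
Qed.

(** Modulo the centre, Z_3 is generated by q-th powers of elements of J, which commute with Z_3. *)
Lemma Z3_abelian z w : z \in Z 3 -> w \in Z 3 -> commute z w.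
Proof.
move=> Zz /Z3_decomp[w2 /Z2_decomp[w1 Zw1 [k ->]] [i [j ->]]].
have Jz := Z_J Zz.
apply: commuteM; last by rewrite expgM; apply/commuteX/Z3_commXq.
apply: commuteM; last by rewrite expgM; apply/commuteX/Z3_commXq.
apply: commuteM; last by rewrite expgM; apply/commuteX/Z3_commXq.
exact/commute_sym/Z1_commute.
Qed.

Lemma Z2_Z4 z w : z \in Z 2 -> w \in Z 4 -> commute z w.
Proof.
move=> Zz /Z4_decomp[w3 Zw3 [k ->]]; have Z3z := Z_sub Zz (isT : 2 <= 3).
apply: commuteM; first exact: Z3_abelian.
case/Z2_decomp: Zz => w1 Zw1 [i ->]; apply/commute_sym/commuteM.
  by apply/commute_sym/Z1_commute; rewrite ?groupX.
exact/commute_sym/commuteX/commute_sym/commuteX.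
Qed.

(** Z_4 is generated by C over the abelian group Z_3, and [A^(q i), C^k] = A^(q i (alpha^k - 1)) is
    a power of A^(q^2); likewise for B. *)
Lemma Z3_Z4 z w : z \in Z 3 -> w \in Z 4 -> [~ z, w] \in Z 1.
Proof.
move=> Zz /Z4_decomp[w3 Zw3 [k ->]].
have nZ1 := ucn_normal 1 J.
rewrite commgMJ (eqP (_ : [~ z, w3] == 1)); last exact/commgP/Z3_abelian.
rewrite conj1g mulg1; case/Z3_decomp: Zz => w2 Zw2 [i [j ->]].
have Jw2 := Z_J Zw2; have [rel _ _] := relAB; have rel' := relpair_sym rel.
have qk : q %| x.+1 ^ k - 1 by rewrite -eqn_mod_dvd ?expn_gt0 // exp_mod_q.
have kA i' : [~ A ^+ (q * i'), C ^+ k] \in Z 1.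
  rewrite (commXC rel) (memX_dvd A_Z1) // q2E dvdn_mul // dvdn_mulr //.
have kB j' : [~ B ^+ (q * j'), C ^+ k] \in Z 1.
  rewrite commC_mem -(@commV_mem _ 'Z_1(J)%G J) ?groupX // commC_mem.
  rewrite -expgVn invg_comm (commXC rel').
  by rewrite (memX_dvd B_Z1) // q2E dvdn_mul // dvdn_mulr.
have kw2 : [~ w2, C ^+ k] \in Z 1 by apply: Z_comm; rewrite ?groupX.
by rewrite !(commM_mem nZ1) ?groupX.
Qed.

End Center.

(** * The defect of a relation under (A, B) -> (A z, B w) *)

Lemma conjg_commute (gT : finGroupType) (y z : gT) : commute y z -> y ^ z = y.
Proof. by move=> /commgP/conjg_fixP. Qed.

Lemma commute_comm1 (gT : finGroupType) (y z : gT) : commute y z -> [~ y, z] = 1.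
Proof. by move=> /commgP/eqP. Qed.

Lemma relpair_comm (gT : finGroupType) (x : nat) (y z : gT) :
  (y ^ z = y ^+ x.+1) <-> ([~ y, z] = y ^+ x).
Proof.
rewrite conjg_mulR expgS; split=> [/mulgI//|->//].
Qed.

(** For z, w in Z_3 the first three factors are what [A z, [A z, B w]] adds to [A, C] = A^x, and the
    last one divides by what (A z)^x adds to A^x. Exchanging the generators gives the defect of the
    other relation. *)
Definition Psi (gT : finGroupType) (x : nat) (A B z w : gT) :=
  [~ A, [~ z, B]] * [~ A, [~ A, w]] * [~ z, [~ A, B]]
    * (z ^+ x * [~ [~ z, A], A] ^+ 'C(x, 3))^-1.

Section PowerPsi.
Variables (p m x : nat).
Hypotheses (p_pr : prime p) (p_odd : odd p) (m_gt0 : 0 < m).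
Hypotheses (x_gt0 : 0 < x) (x_val : logn p x = m).
Hypothesis x3 : p = 3 -> m = 1%N -> (x %/ 3)%N = 1 %[mod 3].
Variables (gT : finGroupType) (J : {group gT}) (A B : gT).
Hypotheses (relAB : relq p m x A B) (defJ : J = <<[set A; B]>> :> {set gT}).
Hypothesis cardJ : p ^ (7 * m) <= #|J|.
Local Notation q := (p ^ m)%N.
Local Notation C := [~ A, B].
Local Notation Z n := 'Z_n(J).
Implicit Types z g w h : gT.
Let JA : A \in J := genA defJ.
Let JB : B \in J := genB defJ.
Let Zab z w : z \in Z 3 -> w \in Z 3 -> commute z w :=
  @Z3_abelian _ _ _ p_pr p_odd m_gt0 x_gt0 x_val x3 _ _ _ _ relAB defJ cardJ z w.
Let Z2e z : z \in Z 2 -> z ^+ q = 1 :=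
  @Z2_exp _ _ _ p_pr p_odd m_gt0 x_gt0 x_val x3 _ _ _ _ relAB defJ cardJ z.
Let Z12 z : z \in Z 1 -> z \in Z 2. Proof. by move=> /Z_sub; apply. Qed.
Let Z23 z : z \in Z 2 -> z \in Z 3. Proof. by move=> /Z_sub; apply. Qed.
Let Z13 z : z \in Z 1 -> z \in Z 3. Proof. by move=> /Z_sub; apply. Qed.
Let qx : q %| x := dvd_q_x p_pr x_gt0 x_val.

(** z, [z,g] and [z,g,g] commute with one another because Z_3 is abelian, so conjugating by g at
    each step builds up the exponents by Pascal's rule. *)
Lemma Z3_expM g z n : g \in J -> z \in Z 3 ->
  (g * z) ^+ n =
  g ^+ n * (z ^+ n * [~ z, g] ^+ 'C(n, 2) * [~ [~ z, g], g] ^+ 'C(n, 3)).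
Proof.
move=> Jg Zz; have Zy := Z_comm Zz Jg; have Zv := Z_comm Zy Jg.
set y := [~ z, g] in Zy Zv *; set v := [~ y, g] in Zv *.
have vg : v ^ g = v by apply: conjg_commute; apply: Z1_commute Zv Jg.
have zg : z ^ g = z * y by exact: conjg_mulR.
have yg : y ^ g = y * v by exact: conjg_mulR.
have [Z3y Z3v] := (Z23 Zy, Z13 Zv).
have [cz cy] := (Zab Zz Z3y, Zab Z3y Z3v).
elim: n => [|n IH]; first by rewrite !bin0n !mulg1.
rewrite expgSr IH mulgA -(mulgA (g ^+ n)) (conjgC _ g) mulgA -expgSr -mulgA.
have [E1 E2] := (expgMn n cz, expgMn 'C(n, 2) cy).
congr (_ * _); rewrite !conjMg !conjXg vg zg yg E1 E2 !binS bin1.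
set u := _ * v ^+ _; have Zu : u \in Z 3 by rewrite !groupM ?groupX.
rewrite (Zab Zu Zz) expgS /u -!mulgA; congr (_ * (_ * _)).
by rewrite (mulgA (y ^+ n)) -!expgD; congr (_ ^+ _ * _ ^+ _); exact: addnC.
Qed.

Lemma Z3_expq z : z \in Z 3 -> z ^+ q \in Z 1.
Proof.
case/(Z3_decomp p_pr p_odd m_gt0 x_gt0 x_val x3 relAB defJ cardJ) => w Zw [i [j ->]].
have A3 k : A ^+ (q * k) \in Z 3.
  by rewrite expgM groupX // (A_Z3 p_pr p_odd m_gt0 x_gt0 x_val x3 relAB defJ cardJ).
have B3 k : B ^+ (q * k) \in Z 3.
  by rewrite expgM groupX // (B_Z3 p_pr p_odd m_gt0 x_gt0 x_val x3 relAB defJ cardJ).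
have cwA := Zab (Z23 Zw) (A3 i); have cwB := Zab (groupM (Z23 Zw) (A3 i)) (B3 j).
rewrite expgMn // expgMn // Z2e // mul1g -!expgM mulnAC -q2E [(q * j * q)%N]mulnAC -q2E.
rewrite groupM // expgM groupX //.
  exact: (A_Z1 p_pr p_odd m_gt0 x_gt0 x_val x3 relAB defJ cardJ).
exact: (B_Z1 p_pr p_odd m_gt0 x_gt0 x_val x3 relAB defJ cardJ).
Qed.

Lemma Z3_expx z : z \in Z 3 -> z ^+ x \in Z 1.
Proof. by move=> Zz; apply: memX_dvd qx; apply: Z3_expq. Qed.

Let CZ4 : C \in Z 4 := C_Z4 p_pr p_odd m_gt0 x_gt0 x_val x3 relAB defJ cardJ.
Let Z24 z w : z \in Z 2 -> w \in Z 4 -> commute z w :=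
  @Z2_Z4 _ _ _ p_pr p_odd m_gt0 x_gt0 x_val x3 _ _ _ _ relAB defJ cardJ z w.
Let Z34 z w : z \in Z 3 -> w \in Z 4 -> [~ z, w] \in Z 1 :=
  @Z3_Z4 _ _ _ p_pr p_odd m_gt0 x_gt0 x_val x3 _ _ _ _ relAB defJ cardJ z w.
Let comm' n g z : z \in Z n.+1 -> g \in J -> [~ g, z] \in Z n.
Proof. by move=> Zz Jg; rewrite commC_mem Z_comm. Qed.

Lemma comm_shift z w : z \in Z 3 -> w \in Z 3 ->
  exists2 c, c \in Z 1 & [~ A * z, B * w] = C * ([~ A, w] * [~ z, B] * c).
Proof.
move=> Zz Zw; have Zc : [~ C, w * z] \in Z 1.
  by rewrite commC_mem; apply: (Z34 _ CZ4); apply: groupM.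
exists [~ C, w * z] => //; have Zzw := Z_comm Zz JB; have Zaw := comm' Zw JA.
rewrite commMgJ (commgMJ A) (commgMJ z) (commute_comm1 (Zab Zz Zw)) mul1g.
rewrite (conjg_commute (Zab (Z23 Zzw) Zw)) conjMg.
rewrite (conjg_commute (Zab (Z23 Zaw) Zz)) -conjgM (conjg_mulR C).
move: (Z24 Zaw CZ4) (Z1_commute Zc (Z_J Zzw)).
move: C [~ A, w] [~ z, B] [~ C, _] => d a b c ad cb.
by rewrite (mulgA a) ad -!mulgA cb.
Qed.

Let exp0 z n : z ^+ q = 1 -> q %| n -> z ^+ n = 1.
Proof. by move=> zq /dvdnP[k ->]; rewrite mulnC expgM zq expg1n. Qed.

Let rel : relpair x A B. Proof. by case: relAB. Qed.

Lemma commAC : [~ A, C] = A ^+ x. Proof. exact/relpair_comm/(rel.1). Qed.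

Lemma AX_Z3 : A ^+ x \in Z 3.
Proof. exact: memX_dvd (A_Z3 p_pr p_odd m_gt0 x_gt0 x_val x3 relAB defJ cardJ) qx. Qed.

Lemma Psi_rel z w : z \in Z 3 -> w \in Z 3 ->
  ((A * z) ^ [~ A * z, B * w] = (A * z) ^+ x.+1) <-> (Psi x A B z w = 1).
Proof.
move=> Zz Zw; have [c Zc ->] := comm_shift Zz Zw.
have Zzb := Z_comm Zz JB; have Zaw := comm' Zw JA.
set u := [~ A, w] * [~ z, B] * c.
have Zu : u \in Z 2 := groupM (groupM Zaw Zzb) (Z12 Zc).
have Eu : [~ A, u] = [~ A, [~ z, B]] * [~ A, [~ A, w]].
  have Z1b := comm' Zzb JA; have Z1w := comm' Zaw JA.
  rewrite /u (commgMJ A _ c) (commgMJ A _ [~ z, B]).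
  rewrite (commute_comm1 (commute_sym (Z1_commute Zc JA))) mul1g.
  rewrite (conjg_commute (Z1_commute Z1w (Z_J Zzb))).
  by rewrite (conjg_commute (Z1_commute (groupM Z1b Z1w) (Z_J Zc))).
have Z1zC : [~ z, C] \in Z 1 by exact: Z34.
have EL : [~ A * z, C * u] = A ^+ x * ([~ A, u] * [~ z, C]).
  have Z1u := comm' Zu JA.
  rewrite commMgJ !(commgMJ _ C) (commute_comm1 (Zab Zz (Z23 Zu))) mul1g.
  rewrite conjMg commAC (conjg_commute (Z1_commute Z1u (Z_J Zz))).
  rewrite (conjg_commute (Zab AX_Z3 (Z23 Zu))) (conjg_commute (Zab AX_Z3 Zz)).
  rewrite (conjg_commute (Z1_commute Z1zC (Z_J Zu))).
  move: (Z1_commute Z1u (groupX x JA)); move: [~ A, u] [~ z, C] => a b ab.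
  by rewrite ab mulgA.
rewrite relpair_comm EL Z3_expM // /Psi -Eu.
rewrite (exp0 (Z2e (Z_comm Zz JA)) (dvd_q_bin2 p_pr p_odd qx)) mulg1.
split=> [/mulgI->|E]; first by rewrite mulgV.
by congr (_ * _); apply/eqP; rewrite eq_mulgV1 E.
Qed.

End PowerPsi.

Section CentralHom.
Variables (gT : finGroupType) (H K : {group gT}).
Hypothesis cK : {in K &, commutative mulg}.

(** Kept as a property of plain functions, so that products, inverses and powers of homomorphisms
    can be formed pointwise. *)
Definition chom (F : gT -> gT) : Prop :=
  {in H, forall z, F z \in K} /\ {in H &, {morph F : z w / z * w}}.

Lemma chomM F G : chom F -> chom G -> chom (fun z => F z * G z).
Proof.
move=> [FK FM] [GK GM]; split=> [z Hz|z w Hz Hw]; first by rewrite groupM ?FK ?GK.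
by rewrite FM // GM // !mulgA -(mulgA (F z) (F w)) (cK (FK w Hw) (GK z Hz)) !mulgA.
Qed.

Lemma chomV F : chom F -> chom (fun z => (F z)^-1).
Proof.
move=> [FK FM]; split=> [z Hz|z w Hz Hw]; first by rewrite groupV FK.
by rewrite FM // invMg cK ?groupV ?FK.
Qed.

Lemma chomX F n : chom F -> chom (fun z => F z ^+ n).
Proof.
move=> [FK FM]; split=> [z Hz|z w Hz Hw]; first by rewrite groupX ?FK.
by rewrite FM // expgMn //; apply: cK; apply: FK.
Qed.

End CentralHom.

Section PsiHom.
Variables (p m x : nat).
Hypotheses (p_pr : prime p) (p_odd : odd p) (m_gt0 : 0 < m).
Hypotheses (x_gt0 : 0 < x) (x_val : logn p x = m).
Hypothesis x3 : p = 3 -> m = 1%N -> (x %/ 3)%N = 1 %[mod 3].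
Variables (gT : finGroupType) (J : {group gT}) (A B : gT).
Hypotheses (relAB : relq p m x A B) (defJ : J = <<[set A; B]>> :> {set gT}).
Hypothesis cardJ : p ^ (7 * m) <= #|J|.
Local Notation q := (p ^ m)%N.
Local Notation q2 := (p ^ (2 * m))%N.
Local Notation q3 := (p ^ (3 * m))%N.
Local Notation C := [~ A, B].
Local Notation Z n := 'Z_n(J).
Implicit Types z g w h : gT.
Let defJ' : J = <<[set B; A]>> :> {set gT}. Proof. by rewrite defJ setUC. Qed.
Let JA : A \in J := genA defJ.
Let JB : B \in J := genB defJ.
Let JC : C \in J := genC defJ.
Let Zab z w : z \in Z 3 -> w \in Z 3 -> commute z w :=
  @Z3_abelian _ _ _ p_pr p_odd m_gt0 x_gt0 x_val x3 _ _ _ _ relAB defJ cardJ z w.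
Let Z12 z : z \in Z 1 -> z \in Z 2. Proof. by move=> /Z_sub; apply. Qed.
Let Z23 z : z \in Z 2 -> z \in Z 3. Proof. by move=> /Z_sub; apply. Qed.
Let qx : q %| x := dvd_q_x p_pr x_gt0 x_val.
Let CZ4 : C \in Z 4 := C_Z4 p_pr p_odd m_gt0 x_gt0 x_val x3 relAB defJ cardJ.
Let Z34 z w : z \in Z 3 -> w \in Z 4 -> [~ z, w] \in Z 1 :=
  @Z3_Z4 _ _ _ p_pr p_odd m_gt0 x_gt0 x_val x3 _ _ _ _ relAB defJ cardJ z w.
Let comm' n g z : z \in Z n.+1 -> g \in J -> [~ g, z] \in Z n.
Proof. by move=> Zz Jg; rewrite commC_mem Z_comm. Qed.
Let rel : relpair x A B. Proof. by case: relAB. Qed.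

Let cZ1 : {in Z 1 &, commutative mulg}.
Proof. by move=> z w Zz /Z_J Jw; apply: (Z1_commute Zz Jw). Qed.

Lemma comm_Z3M z w g : z \in Z 3 -> w \in Z 3 -> g \in J ->
  [~ z * w, g] = [~ z, g] * [~ w, g].
Proof.
move=> Zz Zw Jg; have Z3zg := Z23 (Z_comm Zz Jg).
by rewrite commMgJ (conjg_commute (Zab Z3zg Zw)).
Qed.

Lemma comm_Z2M z w g : z \in Z 2 -> w \in Z 2 -> g \in J ->
  [~ z * w, g] = [~ z, g] * [~ w, g].
Proof. by move=> Zz Zw; apply: (comm_Z3M (Z23 Zz) (Z23 Zw)). Qed.

Lemma comm_ZM' z w g : z \in Z 3 -> w \in Z 3 -> g \in J ->
  [~ g, z * w] = [~ g, z] * [~ g, w].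
Proof.
move=> Zz Zw Jg; rewrite -[LHS]invg_comm (comm_Z3M Zz Zw Jg) invMg !invg_comm.
exact: Zab (Z23 (comm' Zw Jg)) (Z23 (comm' Zz Jg)).
Qed.

Local Notation chom := (chom 'Z_3(J)%G 'Z_1(J)%G).

Lemma Psi_chom1 : chom (fun z => Psi x A B z 1).
Proof.
have h1 : chom (fun z => [~ A, [~ z, B]]).
  split=> [z Zz|z w Zz Zw]; first exact: comm' (Z_comm Zz JB) JA.
  by rewrite (comm_Z3M Zz Zw JB) (comm_ZM' (Z23 (Z_comm Zz JB)) (Z23 (Z_comm Zw JB)) JA).
have h2 : chom (fun z => [~ A, [~ A, 1]]).
  by split=> [z Zz|z w Zz Zw]; rewrite !commg1 ?group1 ?mulg1.
have h3 : chom (fun z => [~ z, C]).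
  by split=> [z Zz|z w Zz Zw]; [exact: (Z34 Zz CZ4) | exact: (comm_Z3M Zz Zw JC)].
have h4 : chom (fun z => z ^+ x).
  split=> [z Zz|z w Zz Zw]; last exact: (expgMn x (Zab Zz Zw)).
  exact: (Z3_expx p_pr p_odd m_gt0 x_gt0 x_val x3 relAB defJ cardJ Zz).
have h5 : chom (fun z => [~ [~ z, A], A]).
  split=> [z Zz|z w Zz Zw]; first exact: Z_comm (Z_comm Zz JA) JA.
  by rewrite (comm_Z3M Zz Zw JA) (comm_Z2M (Z_comm Zz JA) (Z_comm Zw JA) JA).
exact: (chomM cZ1 (chomM cZ1 (chomM cZ1 h1 h2) h3)
          (chomV cZ1 (chomM cZ1 h4 (chomX cZ1 _ h5)))).
Qed.

Lemma Psi_chom2 : chom (fun w => Psi x A B 1 w).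
Proof.
have E w : Psi x A B 1 w = [~ A, [~ A, w]].
  by rewrite /Psi !comm1g !commg1 !expg1n !mulg1 invg1 mul1g mulg1.
split=> [w Zw|z w Zz Zw]; rewrite !E; first exact: comm' (comm' Zw JA) JA.
by rewrite (comm_ZM' Zz Zw JA) (comm_ZM' (Z23 (comm' Zz JA)) (Z23 (comm' Zw JA)) JA).
Qed.

Lemma Psi_split z w : z \in Z 3 -> w \in Z 3 ->
  Psi x A B z w = Psi x A B z 1 * Psi x A B 1 w.
Proof.
move=> Zz Zw; have K2 := Psi_chom2.1 w Zw.
have E : Psi x A B 1 w = [~ A, [~ A, w]].
  by rewrite /Psi !comm1g !commg1 !expg1n !mulg1 invg1 mul1g mulg1.
have Z1w : [~ A, [~ A, w]] \in Z 1 by rewrite -E.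
rewrite E /Psi !commg1 mulg1.
have Z1b : [~ z, C] \in Z 1 := Z34 Zz CZ4.
have Zd : z ^+ x * [~ [~ z, A], A] ^+ 'C(x, 3) \in Z 1.
  apply: groupM; last exact: groupX (Z_comm (Z_comm Zz JA) JA).
  exact: (Z3_expx p_pr p_odd m_gt0 x_gt0 x_val x3 relAB defJ cardJ Zz).
move: Z1b Zd Z1w; move: [~ A, [~ z, B]] [~ A, [~ A, w]] [~ z, C] (_ * _ ^+ 'C(x, 3)).
move=> a b c d Zc Zd Zb; rewrite -!mulgA; congr (_ * _).
by rewrite (cZ1 Zb (groupM Zc (groupVr Zd))) mulgA.
Qed.

Lemma B_qx : B ^+ (q * x) = A ^- (q * x).
Proof.
case/dvdnP: qx => y Ey; have -> : (q * x = q2 * y)%N by rewrite Ey mulnCA q2E mulnC.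
rewrite !(expgM _ q2).
by rewrite (B_q2 p_pr p_odd m_gt0 x_gt0 x_val x3 relAB) expgVn.
Qed.

(* The value is B^(-q x (2 - e)) with e = 'C(x, 3); q x (2 - e) is not
   divisible by p q x, which is where the restriction on alpha for p = 3 is
   needed again. *)
Lemma Psi_Bq : Psi x A B (B ^+ q) 1 = B ^- (q * x) * (B ^+ (q * x) * B ^- (q * x * 'C(x,
  3)))^-1.
Proof.
have B3 : B ^+ q \in Z 3 := B_Z3 p_pr p_odd m_gt0 x_gt0 x_val x3 relAB defJ cardJ.
have rel' := relpair_sym rel; have EBA : [~ B, A] = C^-1 by rewrite invg_comm.
have nZ1 := ucn_normal 1 J.
have cBC : [~ B ^+ q, C] = B ^- (q * x).
  have EC' : [~ B ^+ q, C^-1] = B ^+ (q * x).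
    by have := commXC rel' q 1; rewrite EBA [C^-1 ^+ 1]expg1 expn1 subSS subn0 => ->.
  have := commgMJ (B ^+ q) C C^-1.
  rewrite mulgV commg1 (conjg_commute (Z1_commute (Z34 B3 CZ4) (groupVr JC))) EC'.
  by move/esym/(canRL (mulKg _)); rewrite mulg1.
(* Modulo Z_1 the commutator [B^q, A] is C^-q, and [C^-q, A] = [A, C^q] = A^(alpha^q - 1) = A^(q x),
   as alpha^q = 1 + q x modulo q^3. *)
have vE : [~ [~ B ^+ q, A], A] = B ^- (q * x).
  have [c Zc Ec] : exists2 c, c \in Z 1 & [~ B ^+ q, A] = C ^- q * c.
    exists ((C ^- q)^-1 * [~ B ^+ q, A]); last by rewrite mulKVg.
    rewrite (commgEl (B ^+ q)) (conjXB rel') EBA expgVn (mulgA (B ^- q)) (conjgC _ (C ^- q)).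
    rewrite -(mulgA (C ^- q)) mulKg.
    have := conjXC rel' q q; rewrite EBA expgVn conjVg => ->.
    have B1 := B_Z1 p_pr p_odd m_gt0 x_gt0 x_val x3 relAB defJ cardJ.
    exact: (memX_mod B1 (geom_al_mod_q2 p_pr p_odd m_gt0 x_gt0 x_val (dvdnn q))).
  have C2' := C_Z2 p_pr p_odd m_gt0 x_gt0 x_val x3 relAB defJ cardJ.
  have C2 := groupVr C2'.
  rewrite Ec (comm_Z2M C2 (Z12 Zc) JA) (commute_comm1 (Z1_commute Zc JA)) mulg1.
  have := comm_Z2M C2' C2 JA; rewrite mulgV comm1g.
  move/esym/(canRL (mulKg _)); rewrite mulg1 => ->.
  have := commXC rel 1 q; rewrite expg1 mul1n -invg_comm => /(canRL invgK) ->.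
  rewrite B_qx !invgK.
  have A1 : A ^+ q3 = 1 by case: relAB.
  apply: (expg_eq_mod A1); have := exp_mod p_pr p_odd m_gt0 x_gt0 x_val (leqnn m) (dvdnn q).
  rewrite (_ : m + 2 * m = 3 * m)%N; last by rewrite -mulSn.
  have a0 : 0 < x.+1 ^ q by rewrite expn_gt0.
  by move/eqP; rewrite -{1}(subnKC a0) eqn_modDl => /eqP.
have cBB : [~ B ^+ q, B] = 1 by apply: commute_comm1; apply/commute_sym/commuteX.
rewrite /Psi cBB !commg1 !mul1g cBC vE -(expgM B q x) expgVn.
by rewrite -(expgM B (q * x)).
Qed.

(** So replacing A by A B^q disturbs only the first of the two relations. *)
Lemma Psi_Bq_swap : Psi x B A 1 (B ^+ q) = 1.
Proof.
have cBB : [~ B, B ^+ q] = 1 by apply: commute_comm1; apply: commuteX.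
by rewrite /Psi cBB !comm1g !commg1 !expg1n !mul1g invg1.
Qed.

Lemma Psi_Bq_order k : Psi x A B (B ^+ q) 1 ^+ k = 1 -> q %| k.
Proof.
set e := 'C(x, 3); pose b := B ^+ (q * x); have q0 := q_gt0 p_pr m.
have [_ _ B1] := relAB.
have bq : b ^+ q = 1.
  case/dvdnP: qx => y Ey; rewrite -expgM Ey (_ : q * (y * q) * q = q3 * y)%N.
    by rewrite expgM B1 expg1n.
  by rewrite q3E q2E; ring.
have bV : b^-1 = b ^+ q.-1.
  by apply: (mulgI b); rewrite mulgV -expgS prednK.
have -> : Psi x A B (B ^+ q) 1 = b ^+ (q.-1 + e + q.-1).
  rewrite Psi_Bq -/b -/e invMg expgM -/b invgK.
  by rewrite !expgD -bV mulgA.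
rewrite -!expgM; set N := (_ + _ + _)%N => E.
have H := A_ord p_pr p_odd m_gt0 x_gt0 x_val x3 (relq_sym relAB) defJ' cardJ E.
(* N is e - 2 modulo q, and adding the number 2 + (p - 1) e of [bin3_unit1] gives 2 q + p e, a
   multiple of p. *)
have pN : ~~ (p %| N).
  apply: contra (bin3_unit1 p_pr p_odd m_gt0 x_gt0 x_val x3) => pN.
  have p0 := prime_gt0 p_pr; have := dvd_p_q p m_gt0 => pq.
  rewrite -(dvdn_addr _ pN) -/e (_ : N + _ = 2 * q + p * e)%N.
    exact: dvdn_add (dvdn_mull 2 pq) (dvdn_mulr e (dvdnn p)).
  have -> : (p * e = e + p.-1 * e)%N by rewrite -mulSn prednK.
  have -> : (2 * q = q.-1 + q.-1 + 2)%N.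
    by case: (q) q0 => // k' _; rewrite mul2n -addnn addn2 !addSn !addnS.
  by rewrite /N; ring.
rewrite -(pexp_mulK p_pr m k pN) -(dvd_x_q p_pr x_gt0 x_val) -(dvdn_pmul2l q0).
rewrite -expnD (_ : m + (m + m) = 3 * m)%N; last by rewrite !mulSn addn0.
by rewrite (_ : q * (k * N * x) = q * x * (N * k))%N //; ring.
Qed.

End PsiHom.

(** * Counting the pairs that preserve the relations *)

Section KerCount.
Variables (p m x : nat).
Hypotheses (p_pr : prime p) (p_odd : odd p) (m_gt0 : 0 < m).
Hypotheses (x_gt0 : 0 < x) (x_val : logn p x = m).
Hypothesis x3 : p = 3 -> m = 1%N -> (x %/ 3)%N = 1 %[mod 3].
Variables (gT : finGroupType) (J : {group gT}) (A B : gT).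
Hypotheses (relAB : relq p m x A B) (defJ : J = <<[set A; B]>> :> {set gT}).
Hypothesis cardJ : p ^ (7 * m) <= #|J|.
Local Notation q := (p ^ m)%N.
Local Notation q2 := (p ^ (2 * m))%N.
Local Notation q3 := (p ^ (3 * m))%N.
Local Notation C := [~ A, B].
Local Notation Z n := 'Z_n(J).
Implicit Types z g w h : gT.
Let defJ' : J = <<[set B; A]>> :> {set gT}. Proof. by rewrite defJ setUC. Qed.
Let JA : A \in J := genA defJ.
Let JB : B \in J := genB defJ.
Let relBA := relq_sym relAB.
Let cZ1 : {in Z 1 &, commutative mulg}.
Proof. by move=> z w Zz /Z_J Jw; apply: (Z1_commute Zz Jw). Qed.
Let PAB1 := Psi_chom1 p_pr p_odd m_gt0 x_gt0 x_val x3 relAB defJ cardJ.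
Let PAB2 := Psi_chom2 p_pr p_odd m_gt0 x_gt0 x_val x3 relAB defJ cardJ.
Let PBA1 := Psi_chom1 p_pr p_odd m_gt0 x_gt0 x_val x3 relBA defJ' cardJ.
Let PBA2 := Psi_chom2 p_pr p_odd m_gt0 x_gt0 x_val x3 relBA defJ' cardJ.
Let SAB z w : z \in Z 3 -> w \in Z 3 ->
    Psi x A B z w = Psi x A B z 1 * Psi x A B 1 w :=
  @Psi_split _ _ _ p_pr p_odd m_gt0 x_gt0 x_val x3 _ _ _ _ relAB defJ cardJ z w.
Let SBA z w : z \in Z 3 -> w \in Z 3 ->
    Psi x B A z w = Psi x B A z 1 * Psi x B A 1 w :=
  @Psi_split _ _ _ p_pr p_odd m_gt0 x_gt0 x_val x3 _ _ _ _ relBA defJ' cardJ z w.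

Lemma Psi_Z1 z w : z \in Z 3 -> w \in Z 3 ->
  Psi x A B z w \in Z 1 /\ Psi x B A w z \in Z 1.
Proof.
move=> Zz Zw; rewrite (SAB Zz Zw) (SBA Zw Zz); split.
  exact: groupM (PAB1.1 z Zz) (PAB2.1 w Zw).
exact: groupM (PBA1.1 w Zw) (PBA2.1 z Zz).
Qed.

Lemma chom_split_mul (F G : gT -> gT) z w z' w' :
  chom 'Z_3(J)%G 'Z_1(J)%G F -> chom 'Z_3(J)%G 'Z_1(J)%G G ->
  z \in Z 3 -> w \in Z 3 -> z' \in Z 3 -> w' \in Z 3 ->
  F (z * z') * G (w * w') = (F z * G w) * (F z' * G w').
Proof.
move=> [FK FM] [GK GM] Zz Zw Zz' Zw'; rewrite FM // GM //.
by rewrite -!mulgA; congr (_ * _); rewrite !mulgA (cZ1 (FK _ Zz') (GK _ Zw)).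
Qed.

Definition rel_defect (u : gT * gT) : gT * gT :=
  (Psi x A B u.1 u.2, Psi x B A u.2 u.1).

Lemma rel_defectM :
  {in setX (Z 3) (Z 3) &, {morph rel_defect : u v / u * v}}.
Proof.
move=> [z w] [z' w'] /setXP[/= Zz Zw] /setXP[/= Zz' Zw'].
rewrite /rel_defect /=; congr (_, _).
  rewrite (SAB (groupM Zz Zz') (groupM Zw Zw')) (SAB Zz Zw) (SAB Zz' Zw').
  exact: (chom_split_mul PAB1 PAB2).
rewrite (SBA (groupM Zw Zw') (groupM Zz Zz')) (SBA Zw Zz) (SBA Zw' Zz').
exact: (chom_split_mul PBA1 PBA2).
Qed.

Definition good_pairs :=
  [set u in setX (Z 3) (Z 3) | (Psi x A B u.1 u.2 == 1) && (Psi x B A u.2 u.1 == 1)].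

(** These pairs are the kernel of [rel_defect]. The images of (B^q, 1) and (1, A^q) generate the two
    factors of Z_1 * Z_1, so the kernel has order q^8 / q^2. *)
Lemma card_good_pairs : #|good_pairs| = (q * q * q * q * q * q)%N.
Proof.
have [c1 c3 _ _] := Z_card p_pr p_odd m_gt0 x_gt0 x_val x3 relAB defJ cardJ.
pose D := setX_group 'Z_3(J)%G 'Z_3(J)%G.
pose f := Morphism (rel_defectM : {in D &, {morph rel_defect : u v / u * v}}).
have kerE : 'ker f = good_pairs.
  apply/setP=> u; rewrite !inE; apply: andb_id2l => _.
  by rewrite /rel_defect xpair_eqE.
have sub1 (a b : gT) : relq p m x a b -> J = <<[set a; b]>> :> {set gT} ->
    Z 1 = <[Psi x a b (b ^+ q) 1]>.
  move=> rab dJ; have B3 := B_Z3 p_pr p_odd m_gt0 x_gt0 x_val x3 rab dJ cardJ.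
  have Zt := (Psi_chom1 p_pr p_odd m_gt0 x_gt0 x_val x3 rab dJ cardJ).1 _ B3.
  apply/esym/eqP; rewrite eqEcard cycle_subG Zt c1 /= dvdn_leq //.
  apply: (Psi_Bq_order p_pr p_odd m_gt0 x_gt0 x_val x3 rab dJ cardJ).
  exact: expg_order.
have imE : f @* D = setX (Z 1) (Z 1).
  apply/eqP; rewrite eqEsubset; apply/andP; split; apply/subsetP.
    move=> _ /morphimP[[z w] _ /setXP[Zz Zw] ->].
    by have [h1 h2] := Psi_Z1 Zz Zw; apply/setXP.
  move=> [u v] /setXP[/= Zu Zv].
  have B3 := B_Z3 p_pr p_odd m_gt0 x_gt0 x_val x3 relAB defJ cardJ.
  have A3 := A_Z3 p_pr p_odd m_gt0 x_gt0 x_val x3 relAB defJ cardJ.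
  have i1 : (Psi x A B (B ^+ q) 1, 1) \in f @* D.
    have DB : (B ^+ q, 1) \in D by apply/setXP; split; [exact: B3 | exact: group1].
    have := mem_morphim f DB DB; rewrite /= /rel_defect /=.
    by have -> : Psi x B A 1 (B ^+ q) = 1 by exact: Psi_Bq_swap.
  have i2 : (1, Psi x B A (A ^+ q) 1) \in f @* D.
    have DA : (1, A ^+ q) \in D by apply/setXP; split; [exact: group1 | exact: A3].
    have := mem_morphim f DA DA; rewrite /= /rel_defect /=.
    by have -> : Psi x A B 1 (A ^+ q) = 1 by exact: Psi_Bq_swap.
  have [k Eu] : exists k, u = Psi x A B (B ^+ q) 1 ^+ k.
    by apply/cycleP; rewrite -(sub1 _ _ relAB defJ).
  have [l Ev] : exists l, v = Psi x B A (A ^+ q) 1 ^+ l.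
    by apply/cycleP; rewrite -(sub1 _ _ relBA defJ').
  rewrite (_ : (u, v) = (Psi x A B (B ^+ q) 1, 1) ^+ k * (1, Psi x B A (A ^+ q) 1) ^+ l).
    exact: groupM (groupX k i1) (groupX l i2).
  by rewrite !expg_pair !expg1n Eu Ev; congr (_, _); rewrite ?mulg1 ?mul1g.
have := card_morphim f D; rewrite imE setIid cardsX c1 => cI.
have E : (#|good_pairs| * #|D : 'ker f| = #|D|)%N.
  by rewrite -kerE Lagrange // normal_sub // ker_normal.
move: E; rewrite -cI cardsX c3 => E.
have q0 : 0 < q * q by rewrite muln_gt0 q_gt0.
by apply/eqP; rewrite -(eqn_pmul2r q0) E; apply/eqP; ring.
Qed.

Lemma Z3_q3 z : z \in Z 3 -> (A * z) ^+ q3 = 1.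
Proof.
move=> Zz; have [_ A1 _] := relAB.
rewrite (Z3_expM p_pr p_odd m_gt0 x_gt0 x_val x3 relAB defJ cardJ _ JA Zz) A1 mul1g.
have q23 : q2 %| q3 by rewrite q3E dvdn_mulr.
have qq3 : q %| q3 by rewrite q3E dvdn_mull.
have Zy := Z_comm Zz JA; have Zv := Z_comm Zy JA.
have -> : z ^+ q3 = 1.
  have Zq := Z3_expq p_pr p_odd m_gt0 x_gt0 x_val x3 relAB defJ cardJ Zz.
  have := Z1_exp p_pr p_odd m_gt0 x_gt0 x_val x3 relAB defJ cardJ Zq.
  by rewrite -expgM -q2E => z2; apply: (expq_dvd z2).
have Ey := Z2_exp p_pr p_odd m_gt0 x_gt0 x_val x3 relAB defJ cardJ Zy.
have Ev := Z1_exp p_pr p_odd m_gt0 x_gt0 x_val x3 relAB defJ cardJ Zv.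
rewrite (expq_dvd Ey (dvd_q_bin2 p_pr p_odd qq3)) !mul1g.
(* C(q^3, 3) may lose one power of p, which is harmless since m + 1 <= 3 m. *)
apply: (expq_dvd Ev); apply: (dvd_bin3 p_pr).
by rewrite dvdn_exp2l // mulSn -[m.+1]addn1 leq_add2l muln_gt0.
Qed.

(** Z_3 is generated by q-th powers, hence lies in the Frattini subgroup of the p-group J. *)
Lemma gen_Z3 z w : z \in Z 3 -> w \in Z 3 -> J = <<[set A * z; B * w]>> :> {set gT}.
Proof.
move=> Zz Zw; have [_ _ _ oJ] := Z_card p_pr p_odd m_gt0 x_gt0 x_val x3 relAB defJ cardJ.
have pJ : p.-group J by rewrite /pgroup oJ pnatX pnat_id.
have Jp y : y \in J -> y ^+ q \in 'Phi(J).
  move=> Jy; rewrite -(prednK m_gt0) expnS mulnC expgM.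
  rewrite (Phi_joing pJ) mem_gen // inE; apply/orP; right.
  have Jz := groupX (p ^ m.-1) Jy.
  by have := Mho_p_elt 1 Jz (mem_p_elt pJ Jz); rewrite expn1.
have AP := Jp _ JA; have BP := Jp _ JB; have CP := Jp _ (groupR JA JB).
have J1 : C \in 'Phi(J).
  by rewrite (Phi_joing pJ) mem_gen // inE mem_commg.
have Z3P y : y \in Z 3 -> y \in 'Phi(J).
  case/(Z3_decomp p_pr p_odd m_gt0 x_gt0 x_val x3 relAB defJ cardJ) => y2 Zy2 [i [j ->]].
  rewrite groupM //; last by rewrite expgM groupX.
  rewrite groupM //; last by rewrite expgM groupX.
  case/(Z2_decomp p_pr p_odd m_gt0 x_gt0 x_val x3 relAB defJ cardJ): Zy2 => y1 Zy1 [k ->].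
  rewrite groupM //; last by rewrite expgM groupX.
  case/(Z1_decomp p_pr p_odd m_gt0 x_gt0 x_val x3 relAB defJ cardJ): Zy1 => l ->.
  by rewrite q2E -mulnA expgM groupX.
apply/esym/Phi_nongen/eqP; rewrite eqEsubset join_subG Phi_sub subUset !sub1set.
rewrite (groupM JA (Z_J Zz)) (groupM JB (Z_J Zw)) /= {1}defJ gen_subG.
set S := [set A * z; B * w].
have mS y : y \in S -> y \in 'Phi(J) <*> S by apply/subsetP/joing_subr.
have mPhi y : y \in Z 3 -> y \in 'Phi(J) <*> S.
  by move=> Zy; apply: (subsetP (joing_subl _ _)); apply: Z3P.
apply/subsetP=> y /set2P[]->.
  have := groupM (mS _ (set21 _ _)) (groupVr (mPhi z Zz)).
  by rewrite mulgK.
have := groupM (mS _ (set22 _ _)) (groupVr (mPhi w Zw)).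
by rewrite mulgK.
Qed.

End KerCount.

(** * Automorphisms trivial modulo Z_4 *)

Section AutBasics.
Variables (gT : finGroupType) (J : {group gT}).
Implicit Types (f : {perm gT}) (g h : gT).

Lemma autJ f g : f \in Aut J -> g \in J -> f g \in J.
Proof. by move=> Af Jg; rewrite -(autmE Af) -{2}(im_autm Af) mem_morphim. Qed.

Lemma autM f : f \in Aut J -> {in J &, {morph f : g h / g * h}}.
Proof. by move=> Af g h Jg Jh; rewrite -(autmE Af) morphM. Qed.

Lemma autV f g : f \in Aut J -> g \in J -> f g^-1 = (f g)^-1.
Proof. by move=> Af Jg; rewrite -(autmE Af) morphV. Qed.

Lemma autX f g n : f \in Aut J -> g \in J -> f (g ^+ n) = f g ^+ n.
Proof. by move=> Af Jg; rewrite -(autmE Af) morphX. Qed.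

Lemma autR f g h : f \in Aut J -> g \in J -> h \in J -> f [~ g, h] = [~ f g, f h].
Proof. by move=> Af Jg Jh; rewrite -(autmE Af) morphR. Qed.

Lemma aut_ucn f n g : f \in Aut J -> g \in 'Z_n(J) -> f g \in 'Z_n(J).
Proof.
move=> Af Zg; have chZ : 'Z_n(J) \char J by apply: ucn_char.
have /charP[sZJ /(_ _ (injm_autm Af) (im_autm Af)) imZ] := chZ.
by rewrite -(autmE Af) -imZ mem_morphim // (subsetP sZJ).
Qed.

Lemma aut1 f : f \in Aut J -> f 1 = 1.
Proof. by move=> Af; rewrite -(autmE Af) morph1. Qed.

Lemma Auti_Aut n f : f \in Auti J n -> f \in Aut J.
Proof. by case/AutiP. Qed.

Lemma Auti_mem n f g : f \in Auti J n -> g \in J -> g^-1 * f g \in 'Z_n(J).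
Proof.
case/AutiP=> Af Ef Jg; have nZ := subsetP (ucn_norm n J).
have [Ng Nfg] := (nZ g Jg, nZ _ (autJ Af Jg)).
apply: coset_idr; first by rewrite groupM ?groupV.
have -> : coset 'Z_n(J) (g^-1 * f g) = (coset 'Z_n(J) g)^-1 * coset 'Z_n(J) (f g).
  by rewrite morphM ?groupV // morphV.
by rewrite Ef // mulVg.
Qed.

(** The g with g^-1 f(g) in Z_n form a subgroup, because Z_n is normal in J. *)
Lemma Auti_gen n f (S : {set gT}) : J = <<S>> :> {set gT} -> f \in Aut J ->
  {in S, forall g, g^-1 * f g \in 'Z_n(J)} -> f \in Auti J n.
Proof.
move=> defJ Af HS; have nZ := subsetP (ucn_norm n J).
pose K := [set g in J | g^-1 * f g \in 'Z_n(J)].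
have gK : group_set K.
  apply/group_setP; split; first by rewrite inE group1 aut1 // mulg1 invg1 group1.
  move=> g h; rewrite !inE => /andP[Jg Zg] /andP[Jh Zh].
  rewrite groupM //= autM // invMg.
  have -> : h^-1 * g^-1 * (f g * f h) = (g^-1 * f g) ^ h * (h^-1 * f h).
    by rewrite conjgE !mulgA mulgK.
  by rewrite groupM // memJ_norm // nZ.
have sJK : J \subset Group gK.
  rewrite {1}defJ gen_subG; apply/subsetP=> g Sg.
  by rewrite inE HS // {1}defJ mem_gen.
apply/AutiP; split=> // g Jg; have := subsetP sJK g Jg; rewrite inE => /andP[_ Zg].
have [Ng Nfg] := (nZ g Jg, nZ _ (autJ Af Jg)).
apply: (mulgI (coset 'Z_n(J) g)^-1).
have <- : coset 'Z_n(J) (g^-1 * f g) = (coset 'Z_n(J) g)^-1 * coset 'Z_n(J) (f g).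
  by rewrite morphM ?groupV // morphV.
by rewrite mulVg coset_id.
Qed.

Lemma AutiS n k : n <= k -> Auti J n \subset Auti J k.
Proof.
move=> nk; apply/subsetP=> f Af; apply: (@Auti_gen k f J); rewrite ?genGid //.
  exact: Auti_Aut Af.
by move=> g Jg; apply: (subsetP (ucn_sub_geq _ nk)); apply: Auti_mem.
Qed.

Lemma eq_Aut_gen f1 f2 (S : {set gT}) : J = <<S>> :> {set gT} ->
  f1 \in Aut J -> f2 \in Aut J -> {in S, f1 =1 f2} -> f1 = f2.
Proof.
move=> defJ A1 A2 E; apply: (eq_Aut A1 A2) => g Jg.
have A12 : f1 * f2^-1 \in Aut J by rewrite groupM ?groupV.
(* Z_0 is trivial, so membership in Aut_0 means being the identity on J. *)
have : f1 * f2^-1 \in Auti J 0.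
  apply: (Auti_gen defJ A12) => h Sh; rewrite permM E // permK mulVg.
  by rewrite ucn0 group1.
move/Auti_mem/(_ Jg); rewrite ucn0 permM => /set1P/(congr1 (mulg g)).
by rewrite mulKVg mulg1 => E12; rewrite -{2}E12 permKV.
Qed.

Lemma conj_autJ g h : g \in J -> h \in J -> conj_aut J g h = h ^ g.
Proof. exact: conj_autE. Qed.

Lemma conj_aut_Aut g : g \in J -> conj_aut J g \in Aut J.
Proof. by move=> Jg; apply: (subsetP (Aut_conj_aut J J)); apply: mem_morphim;
  rewrite // (subsetP (normG J)). Qed.

Lemma conj_aut_Auti n g : g \in J -> (conj_aut J g \in Auti J n) = (g \in 'Z_n.+1(J)).
Proof.
move=> Jg; apply/idP/idP=> [Cg|Zg].
  rewrite ucnS_up; apply/mem_up; first exact: ucn_normal.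
  split=> // h Jh; rewrite commC_mem; have := Auti_mem Cg Jh.
  by rewrite conj_autJ // -commgEl.
apply: (@Auti_gen n _ J); rewrite ?genGid ?conj_aut_Aut // => h Jh.
by rewrite conj_autJ // -commgEl commC_mem Z_comm.
Qed.

Lemma card_Inn : (#|Inn J| * #|'Z_1(J)| = #|J|)%N.
Proof.
have := card_morphim (conj_aut_morphism J) J.
rewrite /= (setIidPr (normG J)) ker_conj_aut -/(Inn J) => ->.
by rewrite ucn1 mulnC /= -indexgI Lagrange // /center subsetIl.
Qed.

End AutBasics.

(** Here a, b, c, i are the orders of Inn, Aut_3, Aut_4 and the intersection of Inn with Aut_3: q^6,
    q^6, q^8 and q^4. *)
Lemma card_arith q a b c i : 0 < q ->
  (a * q = q * q * q * q * q * q * q)%N -> (i * q = q * q * q * q * q)%N ->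
  (b = q * q * q * q * q * q)%N -> (a * b = c * i)%N ->
  c = (q * q * q * q * q * q * q * q)%N.
Proof.
move=> q0 /eqP; rewrite eqn_pmul2r // => /eqP -> /eqP; rewrite eqn_pmul2r // => /eqP -> ->.
have q4 : 0 < q * q * q * q by rewrite !muln_gt0 q0.
by move=> E; apply/eqP; rewrite -(eqn_pmul2r q4) -E; apply/eqP; ring.
Qed.

Lemma q8E p m : (p ^ (8 * m) =
  p ^ m * p ^ m * p ^ m * p ^ m * p ^ m * p ^ m * p ^ m * p ^ m)%N.
Proof. by rewrite -!expnD; congr (_ ^ _)%N; lia. Qed.

Section Aut34.
Variables (p m x : nat).
Hypotheses (p_pr : prime p) (p_odd : odd p) (m_gt0 : 0 < m).
Hypotheses (x_gt0 : 0 < x) (x_val : logn p x = m).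
Hypothesis x3 : p = 3 -> m = 1%N -> (x %/ 3)%N = 1 %[mod 3].
Variables (gT : finGroupType) (J : {group gT}) (A B : gT).
Hypotheses (relAB : relq p m x A B) (defJ : J = <<[set A; B]>> :> {set gT}).
Hypothesis cardJ : p ^ (7 * m) <= #|J|.
Local Notation q := (p ^ m)%N.
Local Notation C := [~ A, B].
Local Notation Z n := 'Z_n(J).
Implicit Types z g w h : gT.
Let defJ' : J = <<[set B; A]>> :> {set gT}. Proof. by rewrite defJ setUC. Qed.
Let JA : A \in J := genA defJ.
Let JB : B \in J := genB defJ.
Let JC : C \in J := genC defJ.
Let relBA := relq_sym relAB.

Lemma aut_relq f : f \in Aut J -> relq p m x (f A) (f B).
Proof.
move=> Af; have [[r1 r2] a1 b1] := relAB.
have fJ g h : g \in J -> h \in J -> f (g ^ h) = f g ^ f h.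
  by move=> Jg Jh; rewrite -(autmE Af) morphJ.
split; last 2 first.
- by rewrite -(autX _ Af JA) a1 (aut1 Af).
- by rewrite -(autX _ Af JB) b1 (aut1 Af).
split.
  by rewrite -(autR Af JA JB) -(autX _ Af JA) -r1 fJ.
by rewrite -(autR Af JB JA) -(autX _ Af JB) -r2 fJ // groupR.
Qed.

Lemma card_Aut3 : #|Auti J 3| = (q * q * q * q * q * q)%N.
Proof.
rewrite -(card_good_pairs p_pr p_odd m_gt0 x_gt0 x_val x3 relAB defJ cardJ).
pose F (f : {perm gT}) := (A^-1 * f A, B^-1 * f B).
have injF : {in Auti J 3 &, injective F}.
  move=> f1 f2 /Auti_Aut A1 /Auti_Aut A2 [/mulgI E1 /mulgI E2].
  by apply: (eq_Aut_gen defJ A1 A2) => g /set2P[]->.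
rewrite -(card_in_imset injF); congr #|pred_of_set _|.
apply/eqP; rewrite eqEsubset; apply/andP; split; apply/subsetP.
  move=> _ /imsetP[f A3f ->]; have Af := Auti_Aut A3f.
  have Zz := Auti_mem A3f JA; have Zw := Auti_mem A3f JB.
  have [[r1 r2] _ _] := aut_relq Af.
  have P1 : Psi x A B (A^-1 * f A) (B^-1 * f B) = 1.
    apply/(Psi_rel p_pr p_odd m_gt0 x_gt0 x_val x3 relAB defJ cardJ Zz Zw).
    by rewrite !mulKVg.
  have P2 : Psi x B A (B^-1 * f B) (A^-1 * f A) = 1.
    apply/(Psi_rel p_pr p_odd m_gt0 x_gt0 x_val x3 relBA defJ' cardJ Zw Zz).
    by rewrite !mulKVg.
  by rewrite inE /= P1 P2 !eqxx /= andbT; apply/setXP.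
move=> [z w]; rewrite inE /= => /andP[/setXP[/= Zz Zw] /andP[/eqP P1 /eqP P2]].
have rzw : relq p m x (A * z) (B * w).
  split; first split.
  - exact/(Psi_rel p_pr p_odd m_gt0 x_gt0 x_val x3 relAB defJ cardJ Zz Zw).
  - exact/(Psi_rel p_pr p_odd m_gt0 x_gt0 x_val x3 relBA defJ' cardJ Zw Zz).
  - exact: (Z3_q3 p_pr p_odd m_gt0 x_gt0 x_val x3 relAB defJ cardJ Zz).
  exact: (Z3_q3 p_pr p_odd m_gt0 x_gt0 x_val x3 relBA defJ' cardJ Zw).
have dJ := gen_Z3 p_pr p_odd m_gt0 x_gt0 x_val x3 relAB defJ cardJ Zz Zw.
have [f [Af fA fB]] :=
  aut_of_pair p_pr p_odd m_gt0 x_gt0 x_val x3 defJ dJ relAB rzw cardJ.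
apply/imsetP; exists f; last by rewrite /F fA fB !mulKg.
by apply: (Auti_gen defJ Af) => g /set2P[]->; rewrite ?fA ?fB mulKg.
Qed.

Lemma Inn_sub_Aut4 : Inn J \subset Auti J 4.
Proof.
apply/subsetP=> _ /morphimP[g _ Jg ->]; rewrite conj_aut_Auti // ucnS_up.
apply/mem_up; first exact: ucn_normal.
split=> // h Jh.
exact: (comm_Z4 p_pr p_odd m_gt0 x_gt0 x_val x3 relAB defJ cardJ).
Qed.

(* Modulo Z_3, conjugation by A^-l B^k multiplies A by C^k and B by C^l. *)
Lemma conj_mod_Z3 k l : exists2 g, g \in J &
  (A * C ^+ k)^-1 * A ^ g \in Z 3 /\ (B * C ^+ l)^-1 * B ^ g \in Z 3.
Proof.
have nZ := subsetP (ucn_norm 3 J).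
pose g := A ^- l * B ^+ k; have Jg : g \in J by rewrite groupM ?groupV ?groupX.
exists g => //.
have C4 := C_Z4 p_pr p_odd m_gt0 x_gt0 x_val x3 relAB defJ cardJ.
set a := coset (Z 3) A; set b := coset (Z 3) B.
have Ec : coset (Z 3) C = [~ a, b] by rewrite morphR ?nZ.
have cc h : h \in J -> commute [~ a, b] (coset (Z 3) h).
  move=> Jh; apply/commgP; rewrite -Ec -morphR ?nZ //; apply/eqP/coset_id.
  exact: Z_comm C4 Jh.
have [ca cb] := (cc A JA, cc B JB).
have cg : coset (Z 3) g = a ^- l * b ^+ k.
  by rewrite /g morphM ?morphV ?morphX ?nZ ?groupV ?groupX.
clearbody g; have toZ3 D n : D \in J -> (coset (Z 3) D) ^ (a ^- l * b ^+ k) = coset (Z 3) D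
  * [~ a, b] ^+ n ->
   (D * C ^+ n)^-1 * D ^ g \in Z 3.
  move=> JD E; have JDC := groupM JD (groupX n JC); have JDg := groupJ JD Jg.
  apply: coset_idr; first exact: nZ (groupM (groupVr JDC) JDg).
  rewrite morphM ?nZ ?groupV // morphV ?nZ // morphJ ?nZ //= cg E.
  by rewrite morphM ?nZ ?groupX // morphX ?nZ //= Ec mulVg.
have cX (u v : coset_of (Z 3)) n : commute [~ u, v] v -> u ^ (v ^+ n) = u * [~ u, v] ^+ n.
  move=> cuv; rewrite conjg_mulR; congr (_ * _).
  by apply: commgX; apply: commute_sym.
split; apply: toZ3 => //; rewrite conjgM.
  have -> : a ^ (a ^- l) = a by apply: conjg_commute; apply/commuteV/commuteX.
  exact: cX.
have cbX n : ([~ a, b] ^+ n) ^ (b ^+ k) = [~ a, b] ^+ n.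
  by apply: conjg_commute; apply: commuteX2.
have -> : b ^ (a ^- l) = b * [~ a, b] ^+ l.
  apply: (@conjg_inj _ (a ^+ l)); rewrite conjgKV conjMg cX; last first.
    by rewrite -invg_comm; apply/commute_sym/commuteV/commute_sym.
  rewrite (conjg_commute (commuteX2 l l ca)) -invg_comm expgVn mulgKV //.
rewrite conjMg cbX; congr (_ * _).
by apply: conjg_commute; apply: commuteX.
Qed.

Lemma Aut4_Inn_Aut3 : Auti J 4 = Inn J * Auti J 3.
Proof.
have nInn : Inn J \subset 'N(Auti J 3).
  have : 'dom (can_aut J 3) \subset 'N(Auti J 3) := ker_norm _.
  rewrite dom_can_aut; apply: subset_trans.
  apply/subsetP=> _ /morphimP[g _ Jg ->]; exact: conj_aut_Aut.
(* The inner correction c is undone after f, in the form f = (f c^-1) c, which puts Aut_3 on the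
   left. *)
rewrite (normC nInn); apply/eqP; rewrite eqEsubset; apply/andP; split.
  apply/subsetP=> f A4f; have Af := Auti_Aut A4f.
  have dec := Z4_decomp p_pr p_odd m_gt0 x_gt0 x_val x3 relAB defJ cardJ.
  have [z Zz [k Ek]] := dec _ (Auti_mem A4f JA).
  have [w Zw [l El]] := dec _ (Auti_mem A4f JB).
  have [g Jg [gA gB]] := conj_mod_Z3 k l.
  have Ac := conj_aut_Aut Jg.
  have Ai : (conj_aut J g)^-1 \in Aut J by rewrite groupV.
  apply/mulsgP; exists (f * (conj_aut J g)^-1) (conj_aut J g); last by rewrite mulgKV.
    have toZ3 D n u : D \in J -> u \in Z 3 -> D^-1 * f D = u * C ^+ n ->
        (D * C ^+ n)^-1 * D ^ g \in Z 3 -> D^-1 * (f * (conj_aut J g)^-1) D \in Z 3.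
      move=> JD Zu E Zv; set v := (_ * _ ^+ _)^-1 * _ in Zv.
      have Zs : v^-1 * u ^ (C ^+ n) \in Z 3.
        apply: groupM (groupVr Zv) _; rewrite memJ_norm //.
        by rewrite (subsetP (ucn_norm 3 J)) ?groupX.
      have -> : (f * (conj_aut J g)^-1) D =
                D * (conj_aut J g)^-1 (v^-1 * u ^ (C ^+ n)).
        rewrite permM; have -> : f D = conj_aut J g D * (v^-1 * u ^ (C ^+ n)).
          have key (d c y s : gT) :
              d * (s * c) = y * (((d * c)^-1 * y)^-1 * s ^ c).
            by rewrite invMg invgK conjgE !mulgA mulgV mul1g mulgK.
          by rewrite conj_autJ // -[LHS](mulKVg D) E; apply: key.
        rewrite (autM Ai) ?permK // ?(Z_J Zs) //; exact: autJ Ac JD.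
      by rewrite mulKg; apply: aut_ucn.
    apply: (Auti_gen defJ); first by rewrite groupM.
    move=> D /set2P[]->; [exact: toZ3 JA Zz Ek gA | exact: toZ3 JB Zw El gB].
  by rewrite /Inn; apply: mem_morphim => //; apply: (subsetP (normG J)).
apply/subsetP=> _ /mulsgP[f1 f2 A3 I2 ->].
apply: groupM; last exact: (subsetP Inn_sub_Aut4 _ I2).
exact: (subsetP (AutiS J (isT : 3 <= 4)) _ A3).
Qed.

(** Conjugation by g lies in Aut_3 exactly when g is in Z_4, so Inn meets Aut_3 in a copy of Z_4 /
    Z_1, of order q^4. *)
Lemma card_Aut4 : #|Auti J 4| = (p ^ (8 * m))%N.
Proof.
have [c1 _ c4 c7] := Z_card p_pr p_odd m_gt0 x_gt0 x_val x3 relAB defJ cardJ.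
have q0 : 0 < q := q_gt0 p_pr m.
have I34 : Inn J :&: Auti J 3 = conj_aut J @* Z 4.
  apply/setP=> f; apply/setIP/morphimP=> [[/morphimP[g Ng Jg ->] A3]|[g Ng Zg ->]].
    by exists g => //; rewrite -(conj_aut_Auti 3 Jg).
  have Jg := Z_J Zg; split; last by rewrite conj_aut_Auti.
  by rewrite /Inn; apply: mem_morphim.
have cI : (#|Inn J :&: Auti J 3| * q = #|Z 4|)%N.
  rewrite I34 card_morphim ker_conj_aut.
  have sZJ : Z 4 \subset J := ucn_sub 4 J.
  rewrite (setIidPr (subset_trans sZJ (normG J))) -c1 ucn1.
  have -> : 'Z(J) = Z 4 :&: 'C(J).
    have s14 : 'Z(J) \subset Z 4 by rewrite -ucn1; apply: ucn_sub_geq.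
    by apply/eqP; rewrite eqEsubset subsetI s14 subsetIr setSI.
  by rewrite -indexgI mulnC Lagrange ?subsetIl.
have E : (#|Inn J| * #|Auti J 3| = #|Auti J 4| * #|Inn J :&: Auti J 3|)%N.
  rewrite Aut4_Inn_Aut3; exact: (mul_cardG (conj_aut J @* J)%G ('ker (can_aut J 3))%G).
have c7' := etrans (etrans (congr1 (muln _) (esym c1)) (card_Inn J)) (etrans c7 (q7E p m)).
rewrite q8E.
exact: (card_arith q0 c7' (etrans cI c4) card_Aut3 E).
Qed.

End Aut34.

(** * Arbitrary automorphisms *)

Section ClassThree.
Variables (gT : finGroupType).
Implicit Types X Y D E F : gT.

Lemma conjX_class2 X Y D F n : X ^ Y = X * D -> D ^ Y = D * F ->
  commute F D -> commute F Y ->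
  X ^ (Y ^+ n) = X * D ^+ n * F ^+ 'C(n, 2).
Proof.
move=> EX ED cFD cFY.
elim: n => [|n IH]; first by rewrite conjg1 bin0n !mulg1.
rewrite expgSr conjgM IH !conjMg !conjXg (conjg_commute cFY) EX ED.
rewrite expgMn; last exact: commute_sym.
by rewrite binS bin1 addnC expgD (expgS D) !mulgA.
Qed.

(** Collection with D = [Y,X], E = [D,X], F = [D,Y]. In the step from n to n + 1, moving X past Y^n
    produces F^C(n,2) and moving Y past D^(n + C(n,2)) produces F^(n + C(n,2)); the total n + 2
    C(n,2) is the increment of C(n,2) + 2 C(n,3). *)
Lemma expMg_class3 X Y D E F n : Y ^ X = Y * D -> D ^ X = D * E ->
  D ^ Y = D * F ->
  commute E X -> commute E Y -> commute F X -> commute F Y ->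
  (X * Y) ^+ n = X ^+ n * Y ^+ n * D ^+ 'C(n, 2) * E ^+ 'C(n, 3) *
                 F ^+ ('C(n, 2) + 2 * 'C(n, 3)).
Proof.
move=> EX EDX EDY cEX cEY cFX cFY.
have cD G : commute G X -> commute G Y -> commute G D.
  move=> GX GY; rewrite -[D](mulKg Y) -EX conjgE.
  by do ?apply: commuteM => //; exact: commuteV.
have [cED cFD] := (cD _ cEX cEY, cD _ cFX cFY).
have cFE : commute F E.
  rewrite -[E](mulKg D) -EDX conjgE.
  by do ?apply: commuteM => //; exact: commuteV.
have YnX k : Y ^+ k * X = X * (Y ^+ k * D ^+ k * F ^+ 'C(k, 2)).
  have EF : [~ D, Y] = F by rewrite commgEl EDY mulKg.
  rewrite conjgC conjXg EX expMg_Rmul EF //; exact: commute_sym.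
have DX k : D ^+ k * X = X * (D ^+ k * E ^+ k).
  by rewrite conjgC conjXg EDX expgMn //; exact: commute_sym.
have DY k : D ^+ k * Y = Y * (D ^+ k * F ^+ k).
  by rewrite conjgC conjXg EDY expgMn //; exact: commute_sym.
elim: n => [|n IH]; first by rewrite !bin0n !mulg1.
set b := 'C(n, 2) in YnX IH *; set c := 'C(n, 3) in IH *.
have eX e k : commute (E ^+ k) X -> commute (F ^+ e) X ->
  D ^+ b * E ^+ k * F ^+ e * X = D ^+ b * X * (E ^+ k * F ^+ e).
  by move=> kX eX; rewrite -!mulgA eX (mulgA (E ^+ k)) kX !mulgA.
have cX (G H : gT) k : commute G H -> commute (G ^+ k) H.
  by move=> cGH; apply/commute_sym/commuteX/commute_sym.
rewrite expgSr IH -/b -/c.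
transitivity (X ^+ n * (Y ^+ n * (D ^+ b * E ^+ c * F ^+ (b + 2 * c) * X) * Y)).
  by rewrite !mulgA.
rewrite (eX _ _ (cX _ _ _ cEX) (cX _ _ _ cFX)) DX.
transitivity (X ^+ n * (Y ^+ n * X) * (D ^+ b * E ^+ b * (E ^+ c * F ^+ (b + 2 * c)) * Y)).
  by rewrite !mulgA.
rewrite YnX.
have cFE' i k : commute (F ^+ i) (E ^+ k) by apply: cX; apply: commuteX.
have cFD' i k : commute (F ^+ i) (D ^+ k) by apply: cX; apply: commuteX.
have cYF k : commute (F ^+ k) Y by apply: cX.
have cYE k : commute (E ^+ k) Y by apply: cX.
transitivity (X ^+ n.+1 * Y ^+ n * (D ^+ n * (F ^+ b * D ^+ b) * E ^+ b * E ^+ c * F ^+ (b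
  + 2 * c) * Y)).
  by rewrite expgSr !mulgA.
rewrite cFD'.
transitivity (X ^+ n.+1 * Y ^+ n * (D ^+ (n + b) * Y) * (F ^+ b * E ^+ (b + c)) * F ^+ (b +
  2 * c)).
  rewrite (expgD D n) (expgD E) -!mulgA; do 4!congr (_ * _).
  move: (F ^+ _) (F ^+ (b + 2 * c)) (E ^+ b) (E ^+ c) (cYF b) (cYF (b + 2 * c)%N) (cYE b)
    (cYE c).
  move=> f1 f2 e1 e2 c1 c2 c3 c4.
  by rewrite c2 (mulgA e2) c4 -mulgA (mulgA e1) c3 -mulgA (mulgA f1) c1 -mulgA.
rewrite DY cFE' !binS bin1 -/b -/c.
rewrite (addnC b n) (addnC c b) (_ : n + b + 2 * (b + c) = (n + b) + (b + (b + 2 * c)))%N;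
  last by ring.
rewrite !(expgD F (n + b)) !(expgD F b) (expgSr Y) !mulgA; congr (_ * _ * _).
rewrite -!mulgA; do 3!congr (_ * _).
by rewrite (mulgA (F ^+ (n + b))) cFE' -mulgA.
Qed.

Lemma conjXX_central (c a s : gT) N i : c ^ a = c * s -> commute s a ->
  commute s c -> (c ^+ N) ^ (a ^+ i) = c ^+ N * s ^+ (N * i).
Proof.
move=> ca sa sc; rewrite conjXg.
have -> : c ^ (a ^+ i) = c * s ^+ i.
  have s1 : s ^ a = s * 1 by rewrite mulg1 conjg_commute.
  have [c1 c2] : commute 1 s /\ commute 1 a by split; apply: commute_sym; apply: commute1.
  by rewrite (conjX_class2 i ca s1 c1 c2) expg1n mulg1.
by rewrite expgMn ?(mulnC N) ?expgM //; apply/commuteX/commute_sym.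
Qed.

(* With e = C(x,3) and 3e = 0 mod q, the factor F^(2e) of the class-three
   power formula is F^-e. *)
Lemma expMg_class3_rel (a b c u : gT) (q x i j : nat) :
  commute u a -> commute u b -> commute u c ->
  c ^ a = c * a ^- x -> c ^ b = c * b ^+ x ->
  commute (a ^+ x) b -> commute (a ^+ x) c ->
  commute (b ^+ x) a -> commute (b ^+ x) c ->
  [~ a ^+ i, b ^+ j] = u * c ^+ (i * j) ->
  u ^+ q = 1 -> c ^+ q = 1 -> (a ^+ x) ^+ q = 1 -> (b ^+ x) ^+ q = 1 ->
  q %| 'C(x, 2) -> q %| 3 * 'C(x, 3) ->
  (a ^+ i * b ^+ j) ^+ x =
  a ^+ (x * (i + 'C(x, 3) * (i * i * j))) * b ^+ (x * (j + 'C(x, 3) * (i * j * j))).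
Proof.
move=> ua ub uc ca cb axb axc bxa bxc; set e := 'C(x, 3); set N :=
  (i * j)%N => EN uq cq aq bq q2 q3.
have zz (g : gT) n : g ^+ q = 1 -> q %| n -> g ^+ n = 1.
  by move=> gq /dvdnP[k ->]; rewrite mulnC expgM gq expg1n.
pose D := (u * c ^+ N)^-1.
have EX : (b ^+ j) ^ (a ^+ i) = b ^+ j * D.
  by rewrite conjg_mulR -invg_comm EN.
have axa : commute (a ^+ x) a by apply/commute_sym/commuteX.
have bxb : commute (b ^+ x) b by apply/commute_sym/commuteX.
have cX (G H : gT) k : commute G H -> commute (G ^+ k) H.
  by move=> cGH; apply/commute_sym/commuteX/commute_sym.
have ED : D ^ (a ^+ i) = D * (a ^+ x) ^+ (N * i).
  have axV : commute (a ^- x) a by apply/commute_sym/commuteV/commute_sym.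
  have axVc : commute (a ^- x) c by apply/commute_sym/commuteV/commute_sym.
  rewrite conjVg conjMg (conjXX_central N i ca axV axVc) (conjg_commute (commuteX i ua)).
  have axD : commute (a ^+ x) (u * c ^+ N).
    by apply: commuteM; [apply: cX; exact: commute_sym | exact: commuteX].
  by rewrite mulgA invMg expgVn invgK; apply/cX/commuteV.
have EF : D ^ (b ^+ j) = D * (b ^+ x) ^- (N * j).
  rewrite conjVg conjMg (conjXX_central N j cb bxb bxc) (conjg_commute (commuteX j ub)).
  have bxD : commute (b ^+ x) (u * c ^+ N).
    by apply: commuteM; [apply: cX; exact: commute_sym | exact: commuteX].
  rewrite mulgA invMg.
  by do 2!apply/commuteV/commute_sym; apply/commute_sym/commuteX/commute_sym.
have aX k : commute (a ^+ x ^+ k) (b ^+ j) by apply: cX; apply: commuteX.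
have bX k : commute (b ^+ x ^+ k) (a ^+ i) by apply: cX; apply: commuteX.
have Dq : D ^+ q = 1.
  rewrite expgVn expgMn ?uq -?expgM; last exact: commuteX.
  by rewrite mul1g mulnC expgM cq expg1n invg1.
have cE1 : commute (a ^+ x ^+ (N * i)) (a ^+ i) by apply: cX; apply: commuteX.
have cF1 : commute (b ^+ x ^- (N * j)) (a ^+ i).
  by apply/commute_sym/commuteV/commute_sym/bX.
have cF2 : commute (b ^+ x ^- (N * j)) (b ^+ j).
  by apply/commute_sym/commuteV/commuteX/commute_sym/commuteX.
rewrite (expMg_class3 x EX ED EF cE1 (aX _) cF1 cF2).
rewrite (zz D) // mulg1 -/e expgD expgVn.
have -> : (b ^+ x ^+ (N * j)) ^- 'C(x, 2) = 1.
  by rewrite zz ?invg1 // -expgM mulnC expgM bq expg1n.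
rewrite mul1g.
have -> : (b ^+ x ^- (N * j)) ^+ (2 * e) = b ^+ x ^+ (N * j * e).
  move: (b ^+ x) bq => s sq; apply: (mulgI (s ^+ (N * j * (2 * e)))).
  rewrite expgVn -!expgM mulgV -expgD (_ : N * j * _ + _ = 3 * e * (N * j))%N; last by ring.
  by rewrite expgM (zz s (3 * e)%N) // expg1n.
rewrite -2!mulgA (mulgA (b ^+ j ^+ x)).
have -> : b ^+ j ^+ x * a ^+ x ^+ (N * i) ^+ e = a ^+ x ^+ (N * i) ^+ e * b ^+ j ^+ x.
  by apply/commute_sym/cX/commuteX/aX.
rewrite -!expgM -(mulgA (a ^+ _)) (mulgA (a ^+ (i * x))) -!expgD.
by congr (_ ^+ _ * _ ^+ _); rewrite /N; ring.
Qed.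

End ClassThree.

(** The commutator is bilinear in class two, so its exponent is the determinant i l - j k; the
    negative term is moved to the other side to stay in nat. *)
Lemma commg_class2 (gT : finGroupType) (a b u v : gT) i j k l :
  commute a [~ a, b] -> commute b [~ a, b] -> commute u a -> commute u b ->
  commute u v -> commute v a -> commute v b ->
  [~ u * a ^+ i * b ^+ j, v * a ^+ k * b ^+ l] * [~ a, b] ^+ (j * k) =
  [~ a, b] ^+ (i * l).
Proof.
move=> ca cb ua ub uv va vb; set c := [~ a, b].
have cX (G H : gT) n : commute G H -> commute (G ^+ n) H.
  by move=> cGH; apply/commute_sym/commuteX/commute_sym.
have uY : commute u (v * a ^+ k * b ^+ l).
  by do !apply: commuteM => //; apply: commuteX.
have vX : commute v (a ^+ i * b ^+ j) by apply: commuteM; apply: commuteX.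
have cba : [~ b, a] = c^-1 by rewrite invg_comm.
have caV : commute b [~ b, a] by rewrite cba; apply: commuteV.
have cbV : commute a [~ b, a] by rewrite cba; apply: commuteV.
rewrite -(mulgA u) commMgJ (commute_comm1 uY) conj1g mul1g -(mulgA v) commgMJ.
rewrite (commute_comm1 (commute_sym vX)) conj1g mulg1 commMgJ !commgMJ.
rewrite (commute_comm1 (commuteX2 i k (commute_refl a))) conj1g mulg1.
rewrite (commute_comm1 (commuteX2 j l (commute_refl b))) mul1g.
rewrite (commXXg _ _ ca cb) (commXXg _ _ caV cbV) cba.
have cbX n e : (c ^+ e) ^ (b ^+ n) = c ^+ e.
  by apply/conjg_commute/commuteX2/commute_sym.
by rewrite cbX expgVn conjVg cbX mulgKV.
Qed.

(** * The relations modulo Z_2 *)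

Section ModZ2.
Variables (p m x : nat).
Hypotheses (p_pr : prime p) (p_odd : odd p) (m_gt0 : 0 < m).
Hypotheses (x_gt0 : 0 < x) (x_val : logn p x = m).
Hypothesis x3 : p = 3 -> m = 1%N -> (x %/ 3)%N = 1 %[mod 3].
Variables (gT : finGroupType) (J : {group gT}) (A B : gT).
Hypotheses (relAB : relq p m x A B) (defJ : J = <<[set A; B]>> :> {set gT}).
Hypothesis cardJ : p ^ (7 * m) <= #|J|.
Local Notation q := (p ^ m)%N.
Local Notation C := [~ A, B].
Local Notation Z n := 'Z_n(J).
Local Notation phi := (coset (Z 2)).
Implicit Types z g w h : gT.
Let JA : A \in J := genA defJ.
Let JB : B \in J := genB defJ.
Let JC : C \in J := genC defJ.

Lemma coset_Z3_commute z h : z \in Z 3 -> h \in J -> commute (phi z) (phi h).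
Proof.
move=> Zz Jh; have nZ := subsetP (ucn_norm 2 J).
have [Nz Nh] := (nZ z (Z_J Zz), nZ h Jh).
by apply/commgP; rewrite -morphR //; apply/eqP/coset_id/Z_comm.
Qed.

Lemma comm_mod_Z3 w w' i j k l : w \in Z 4 -> w' \in Z 4 ->
  exists2 z, z \in Z 3 &
  [~ w * A ^+ i * B ^+ j, w' * A ^+ k * B ^+ l] * C ^+ (j * k) = z * C ^+ (i * l).
Proof.
move=> Zw Zw'; have nZ := subsetP (ucn_norm 3 J).
have [Jw Jw'] := (Z_J Zw, Z_J Zw').
have c4 z h : z \in Z 4 -> h \in J -> commute (coset (Z 3) z) (coset (Z 3) h).
  move=> Zz Jh; apply/commgP; have [Nz Nh] := (nZ z (Z_J Zz), nZ h Jh).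
  by rewrite -morphR //; apply/eqP/coset_id/Z_comm.
have CZ4 := C_Z4 p_pr p_odd m_gt0 x_gt0 x_val x3 relAB defJ cardJ.
have [[wA w'A] CA] := (c4 w A Zw JA, c4 w' A Zw' JA, c4 C A CZ4 JA).
have [[wB w'B] CB] := (c4 w B Zw JB, c4 w' B Zw' JB, c4 C B CZ4 JB).
have ww' := c4 w w' Zw Jw'.
have [Nw Nw' NA NB] : [/\ w \in 'N(Z 3), w' \in 'N(Z 3), A \in 'N(Z 3) & B \in 'N(Z 3)].
  by split; apply: nZ.
exists ([~ w * A ^+ i * B ^+ j, w' * A ^+ k * B ^+ l] * C ^+ (j * k) * C ^- (i * l));
  last by rewrite mulgKV.
set X := w * _ * _; set Y := w' * _ * _.
have JX : X \in J by rewrite /X !groupM ?groupX.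
have JY : Y \in J by rewrite /Y !groupM ?groupX.
have [[NX NY] NC] := (nZ X JX, nZ Y JY, nZ C JC).
apply: coset_idr; first by rewrite !groupM ?groupV ?groupX ?groupR.
have NXY : [~ X, Y] \in 'N(Z 3) by rewrite groupR.
rewrite morphM ?groupM ?groupV ?groupX //= morphM ?groupX //=.
rewrite morphV ?groupX // !morphX //= morphR //=.
apply: (canLR (mulgK _)); rewrite mul1g.
have EX : coset (Z 3) X = coset (Z 3) w * coset (Z 3) A ^+ i * coset (Z 3) B ^+ j.
  by rewrite /X !morphM ?groupM ?groupX // !morphX.
have EY : coset (Z 3) Y = coset (Z 3) w' * coset (Z 3) A ^+ k * coset (Z 3) B ^+ l.
  by rewrite /Y !morphM ?groupM ?groupX // !morphX.
have EC : coset (Z 3) C = [~ coset (Z 3) A, coset (Z 3) B] by rewrite morphR.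
rewrite EX EY; move: wA w'A CA wB w'B CB ww'; rewrite EC.
move: (coset (Z 3) A) (coset (Z 3) B) (coset (Z 3) w) (coset (Z 3) w').
move=> a b u v ua va ca ub vb cb uv.
exact: (commg_class2 _ _ _ _ (commute_sym ca) (commute_sym cb)).
Qed.

Lemma coset_Z3_exp z : z \in Z 3 -> phi z ^+ q = 1.
Proof.
move=> Zz; rewrite -morphX ?(subsetP (ucn_norm 2 J)) ?(Z_J Zz) //; apply: coset_id.
apply: (Z_sub (n := 1)) => //.
exact: (Z3_expq p_pr p_odd m_gt0 x_gt0 x_val x3 relAB defJ cardJ).
Qed.

Lemma coset_ZX z : z \in Z 4 -> phi z ^+ q = 1.
Proof.
have nZ := subsetP (ucn_norm 2 J); have C2 :=
  C_Z2 p_pr p_odd m_gt0 x_gt0 x_val x3 relAB defJ cardJ.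
case/(Z4_decomp p_pr p_odd m_gt0 x_gt0 x_val x3 relAB defJ cardJ)=> w Zw [k ->].
have [Nw NC] := (nZ w (Z_J Zw), nZ _ (groupX k JC)).
rewrite morphM // expgMn; last exact: coset_Z3_commute (Zw) (groupX k JC).
rewrite coset_Z3_exp // mul1g -morphX //; apply: coset_id.
by rewrite -expgM mulnC expgM groupX.
Qed.

Lemma coset_Z4_commute z n : z \in Z 4 -> commute (phi z) (phi C ^+ n).
Proof.
have nZ := subsetP (ucn_norm 2 J).
case/(Z4_decomp p_pr p_odd m_gt0 x_gt0 x_val x3 relAB defJ cardJ)=> w Zw [k ->].
have [[Nw NC] NCk] := (nZ w (Z_J Zw), nZ _ JC, nZ _ (groupX k JC)).
rewrite morphM // morphX //; apply/commute_sym/commuteM; last exact: commuteX2.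
by apply/commute_sym/commuteX; exact: coset_Z3_commute Zw JC.
Qed.

Lemma coset_CA : phi C ^ phi A = phi C * phi A ^- x.
Proof.
have nZ := subsetP (ucn_norm 2 J); have [NA NC] := (nZ A JA, nZ C JC).
have EA := commAC relAB.
by rewrite conjg_mulR -[[~ phi C, phi A]]invg_comm -(morphR _ NA NC) EA morphX.
Qed.

Lemma coset_AX_commute g : g \in J -> commute (phi A ^+ x) (phi g).
Proof.
have NA := subsetP (ucn_norm 2 J) A JA; rewrite -morphX // => Jg.
apply: coset_Z3_commute Jg.
exact: (AX_Z3 p_pr p_odd m_gt0 x_gt0 x_val x3 relAB defJ cardJ).
Qed.

End ModZ2.

Section ModZ2Rel.
Variables (p m x : nat).
Hypotheses (p_pr : prime p) (p_odd : odd p) (m_gt0 : 0 < m).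
Hypotheses (x_gt0 : 0 < x) (x_val : logn p x = m).
Hypothesis x3 : p = 3 -> m = 1%N -> (x %/ 3)%N = 1 %[mod 3].
Variables (gT : finGroupType) (J : {group gT}) (A B : gT).
Hypotheses (relAB : relq p m x A B) (defJ : J = <<[set A; B]>> :> {set gT}).
Hypothesis cardJ : p ^ (7 * m) <= #|J|.
Local Notation q := (p ^ m)%N.
Local Notation C := [~ A, B].
Local Notation Z n := 'Z_n(J).
Local Notation phi := (coset (Z 2)).
Implicit Types z g w h : gT.
Let defJ' : J = <<[set B; A]>> :> {set gT}. Proof. by rewrite defJ setUC. Qed.
Let JA : A \in J := genA defJ.
Let JB : B \in J := genB defJ.
Let JC : C \in J := genC defJ.
Let relBA := relq_sym relAB.
Let qx : q %| x := dvd_q_x p_pr x_gt0 x_val.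
Let nZ g : g \in J -> g \in 'N(Z 2) := subsetP (ucn_norm 2 J) g.

Lemma coset_CB : phi C ^ phi B = phi C * phi B ^+ x.
Proof.
have [[NA NB] NC] := (nZ JA, nZ JB, nZ JC).
have E : phi B ^ (phi C)^-1 = phi B * phi B ^+ x.
  have EB : [~ B, C^-1] = B ^+ x by rewrite invg_comm; apply: commAC relBA.
  by rewrite conjg_mulR -(morphV _ NC) -(morphR _ NB (groupVr NC)) EB morphX.
have cB : commute (phi B ^+ x) (phi C) :=
  coset_AX_commute p_pr p_odd m_gt0 x_gt0 x_val x3 relBA defJ' cardJ JC.
have E' : phi C * phi B = phi B * (phi B ^+ x * phi C).
  by rewrite mulgA -E conjgE invgK -!mulgA mulVg mulg1.
by rewrite conjgE E' mulKg cB.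
Qed.

(** Modulo Z_2 the commutator is A^(x i d) B^(-x j d), and by the class-three formula the power is
    A^(x (i + e i^2 j)) B^(x (j + e i j^2)). By [AB_Z2] the exponents agree modulo q^2, and x
    accounts for one factor q. The coefficient q - 1 stands for -1. *)
Lemma rel_mod_Z2 w w3 i j d : w \in Z 4 -> w3 \in Z 3 ->
  [~ w * A ^+ i * B ^+ j, w3 * C ^+ d] = (w * A ^+ i * B ^+ j) ^+ x ->
  (q %| i + 'C(x, 3) * (i * i * j) + (q - 1) * (i * d))%N &&
  (q %| j + 'C(x, 3) * (i * j * j) + j * d)%N.
Proof.
move=> Zw Zw3 E; set e := 'C(x, 3).
have [[NA NB] NC] := (nZ JA, nZ JB, nZ JC).
have [Nw Nw3] := (nZ (Z_J Zw), nZ (Z_J Zw3)).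
have Cc z g : z \in Z 3 -> g \in J -> commute (phi z) (phi g) := @coset_Z3_commute _ J z g.
have Ax := coset_AX_commute p_pr p_odd m_gt0 x_gt0 x_val x3 relAB defJ cardJ.
have Bx := coset_AX_commute p_pr p_odd m_gt0 x_gt0 x_val x3 relBA defJ' cardJ.
have [z0 Zz0 Ez] := comm_mod_Z3 p_pr p_odd m_gt0 x_gt0 x_val x3 relAB defJ cardJ i 0 0 j
  (group1 _) (group1 _).
have {}Ez : [~ phi A ^+ i, phi B ^+ j] = phi z0 * phi C ^+ (i * j).
  move: Ez; rewrite !mul1g !mulg1 => Ez.
  have Nz0 := nZ (Z_J Zz0).
  by rewrite -!morphX // -morphR ?groupX // -morphM ?groupX // -Ez.
have X3 := coset_Z3_exp p_pr p_odd m_gt0 x_gt0 x_val x3 relAB defJ cardJ.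
have X4 := coset_ZX p_pr p_odd m_gt0 x_gt0 x_val x3 relAB defJ cardJ.
have XA : (phi A ^+ x) ^+ q = 1.
  rewrite -(morphX _ _ NA); apply: X3.
  exact: (AX_Z3 p_pr p_odd m_gt0 x_gt0 x_val x3 relAB defJ cardJ).
have XB : (phi B ^+ x) ^+ q = 1.
  rewrite -(morphX _ _ NB); apply: X3.
  exact: (AX_Z3 p_pr p_odd m_gt0 x_gt0 x_val x3 relBA defJ' cardJ).
have CZ4 := C_Z4 p_pr p_odd m_gt0 x_gt0 x_val x3 relAB defJ cardJ.
have cCA := coset_CA relAB defJ.
have P := expMg_class3_rel (Cc _ _ Zz0 JA) (Cc _ _ Zz0 JB) (Cc _ _ Zz0 JC)
  cCA coset_CB (Ax _ JB) (Ax _ JC) (Bx _ JA) (Bx _ JC) Ez (X3 _ Zz0) (X4 _ CZ4) XA XB.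
have {P} := P (dvd_q_bin2 p_pr p_odd qx) (dvd_q_3bin3 p_pr x_gt0 x_val).
set G := A ^+ i * B ^+ j; have JG : G \in J by rewrite groupM ?groupX.
have EG : phi G = phi A ^+ i * phi B ^+ j by rewrite morphM ?groupX // !morphX.
have zz (s : coset_of (Z 2)) n : s ^+ q = 1 -> q %| n -> s ^+ n = 1.
  by move=> sq /dvdnP[k ->]; rewrite mulnC expgM sq expg1n.
rewrite -EG -/e => P; have NG := nZ JG.
(* Modulo Z_2 the elements w and [G, w] have order dividing q, and [G, w] is central, so w drops out
   of the x-th power. *)
have Er : phi (w * G) ^+ x = phi G ^+ x.
  have Z3G : [~ G, w] \in Z 3 by rewrite commC_mem Z_comm.
  have ER : [~ phi G, phi w] = phi [~ G, w] by rewrite morphR.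
  rewrite morphM // expMg_Rmul ER; last 2 first.
  - exact/commute_sym/Cc.
  - by apply/commute_sym/Cc; rewrite // (Z_J Zw).
  by rewrite (zz _ _ (X4 _ Zw) qx) mul1g (zz _ _ (X3 _ Z3G) (dvd_q_bin2 p_pr p_odd qx)) mulg1.
have cCd := coset_Z4_commute p_pr p_odd m_gt0 x_gt0 x_val x3 relAB defJ cardJ d Zw.
have El : phi [~ w * G, w3 * C ^+ d] = (phi A ^+ x) ^+ (i * d) * (phi B ^+ x) ^- (j * d).
  have JwG : w * G \in J := groupM (Z_J Zw) JG.
  rewrite morphR ?nZ //; last by rewrite groupM ?groupX // (Z_J Zw3).
  rewrite (morphM _ Nw3) ?groupX // commgMJ.
  rewrite (commute_comm1 (commute_sym (Cc _ _ Zw3 JwG))) conj1g mulg1.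
  rewrite (morphM _ Nw NG) commMgJ morphX //= (commute_comm1 cCd) conj1g mul1g EG commMgJ.
  have EAC : [~ phi A, phi C] = phi A ^+ x.
    by rewrite -(morphR _ NA NC) (commAC relAB) morphX.
  have EBC : [~ phi B, phi C] = (phi B ^+ x)^-1.
    by apply: invg_inj; rewrite invg_comm invgK commgEl coset_CB mulKg.
  have [cA1 cA2] : commute (phi A) [~ phi A, phi C] /\ commute (phi C) [~ phi A, phi C].
    by rewrite EAC; split; [apply: commuteX | apply: commute_sym; apply: Ax].
  have [cB1 cB2] : commute (phi B) [~ phi B, phi C] /\ commute (phi C) [~ phi B, phi C].
    rewrite EBC; split; apply: commuteV; first exact: commuteX.
    by apply: commute_sym; apply: Bx.
  rewrite (commXXg i d cA1 cA2) (commXXg j d cB1 cB2) EAC EBC.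
  rewrite expgVn; congr (_ * _); apply: conjg_commute.
  by apply/commuteX/commute_sym/commuteX/commute_sym/Ax.
set n1 := (i + e * _)%N in P *; set n2 := (j + e * _)%N in P *.
have q0 := q_gt0 p_pr m.
have st : commute (phi A ^+ x) (phi B ^+ x) by apply/commuteX/Ax.
have K : (phi A ^+ x) ^+ (n1 + (q - 1) * (i * d)) * (phi B ^+ x) ^+ (n2 + j * d) = 1.
  rewrite -!(mulgA w) -/G in E.
  move: P; rewrite -Er -(morphX _ _ (groupM Nw NG)) /= -E El !(expgM _ x).
  move: (phi A ^+ x) (phi B ^+ x) st XA XB => s t st sq tq Est.
  clearbody n1 n2; rewrite (addnC n1) !expgD -mulgA (mulgA (s ^+ n1)) -Est -(mulgA (s ^+ (i
    * d))) mulVg mulg1 -expgD.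
  by rewrite addnC -mulSn subn1 (prednK q0) expgM sq expg1n.
have q2dvd n : (p ^ (2 * m) %| x * n)%N = (q %| n).
  by rewrite (mulnC x) mul2n -addnn (dvd_x_q p_pr x_gt0 x_val).
have : A ^+ (x * (n1 + (q - 1) * (i * d))) * B ^+ (x * (n2 + j * d)) \in Z 2.
  apply: coset_idr; first by rewrite groupM ?groupX.
  by rewrite morphM ?groupX // !morphX //= !(expgM _ x).
move/(AB_Z2 p_pr p_odd m_gt0 x_gt0 x_val x3 relAB defJ cardJ).
by rewrite !q2dvd.
Qed.

End ModZ2Rel.

(** * Congruences for the matrix of an automorphism on J / Z_4 *)

Section Congruences.
Import GRing.Theory.
Local Open Scope ring_scope.
Variables (p m : nat).
Hypotheses (p_pr : prime p) (p_odd : odd p) (m_gt0 : (0 < m)%N).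
Local Notation q := (p ^ m)%N.

Lemma coprimez_prime_power (n : int) : ~~ (p %| n)%Z -> coprimez q n.
Proof.
move=> pn; rewrite /coprimez /gcdz absz_nat eqz_nat -/(coprime _ _).
by rewrite coprimeXl // prime_coprime.
Qed.

Lemma dvdz_comb (d a b u v : int) : (d %| u)%Z -> (d %| v)%Z ->
  (d %| a * u + b * v)%Z.
Proof. by move=> du dv; rewrite rpredD // dvdz_mull. Qed.

(* The matrix (i j; k l) is the action of an automorphism on J / Z_4 and d its
   determinant; e = C(x,3). *)
Lemma diag_congruences (i j k l d e : int) :
  (q %| d + j * k - i * l)%Z -> ~~ (p %| d)%Z -> ~~ (p %| i)%Z ->
  (q %| i * (1 + e * (i * j) - d))%Z -> (q %| j * (1 + e * (i * j) + d))%Z ->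
  (q %| l * (1 + e * (l * k) - d))%Z -> (q %| k * (1 + e * (l * k) + d))%Z ->
  [/\ (q %| j)%Z, (q %| k)%Z, (q %| d - 1)%Z & (q %| i * l - 1)%Z].
Proof.
move=> hD pd pI h1 h2 h3 h4.
have pq : (p %| q%:Z)%Z by rewrite dvdzE !absz_nat dvd_p_q.
have q2 : coprimez q 2.
  by rewrite /coprimez /gcdz !absz_nat eqz_nat -/(coprime _ _) coprimeXl // coprimen2.
rewrite (Gauss_dvdzr _ (coprimez_prime_power pI)) in h1.
(* Subtracting j times the first congruence from the second leaves 2 d j, and 2 d is prime to p. *)
have qj : (q %| j)%Z.
  rewrite -(Gauss_dvdzr _ (coprimez_prime_power pd)) -(Gauss_dvdzr _ q2).
  have := dvdz_comb 1 (- j) h2 h1.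
  by rewrite (_ : _ + _ = 2 * (d * j)) //; ring.
have qd : (q %| d - 1)%Z.
  have := dvdz_comb (-1) (e * i) h1 qj.
  by rewrite (_ : _ + _ = d - 1) //; ring.
have ql : (q %| i * l - 1)%Z.
  have := dvdz_comb (-1) 1 hD (dvdz_comb k 1 qj qd).
  by rewrite (_ : _ + _ = i * l - 1) //; ring.
have pl : ~~ (p %| l)%Z.
  apply/negP=> pl; have := dvdz_comb i (-1) pl (dvdz_trans pq ql).
  rewrite (_ : _ + _ = 1); last by ring.
  by rewrite dvdzE absz_nat dvdn1 => /eqP p1; move: p_pr; rewrite p1.
rewrite (Gauss_dvdzr _ (coprimez_prime_power pl)) in h3.
split=> //; rewrite -(Gauss_dvdzr _ q2).
(* The same elimination for k ends in 2 k, as d = 1 modulo q. *)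
have := dvdz_comb 1 (- k) h4 (dvdz_comb 1 1 h3 (dvdz_comb 1 0 qd qd)).
rewrite (_ : _ + _ = k * (1 + d)); last by ring.
move=> H; have := dvdz_comb 1 (- k) H qd.
by rewrite (_ : _ + _ = 2 * k) //; ring.
Qed.

End Congruences.

Lemma dvdz_cong1 q d i n e : 0 < q ->
  (q %| i + e * n + (q - 1) * (i * d))%N ->
  (q %| (i%:Z + e%:Z * n%:Z - i%:Z * d%:Z)%R)%Z.
Proof.
move=> q0 H; have : (q %| (i + e * n + (q - 1) * (i * d))%N%:Z)%Z by [].
rewrite !PoszD !PoszM -subzn // => H'.
have -> : (i%:Z + e%:Z * n%:Z - i%:Z * d%:Z =
  1 * (i%:Z + e%:Z * n%:Z + (q%:Z - 1%:Z) * (i%:Z * d%:Z)) + (- (i%:Z * d%:Z)) * q%:Z)%R by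
    ring.
exact: dvdz_comb H' (dvdzz q).
Qed.

Lemma dvdz_cong2 q a b : a = b %[mod q] -> (q %| (a%:Z - b%:Z)%R)%Z.
Proof. by move=> ab; rewrite -eqz_mod_dvd; apply/eqP; rewrite !modz_nat ab. Qed.

Section Diagonal.
Variables (p m x : nat).
Hypotheses (p_pr : prime p) (p_odd : odd p) (m_gt0 : 0 < m).
Hypotheses (x_gt0 : 0 < x) (x_val : logn p x = m).
Hypothesis x3 : p = 3 -> m = 1%N -> (x %/ 3)%N = 1 %[mod 3].
Variables (gT : finGroupType) (J : {group gT}) (A B : gT).
Hypotheses (relAB : relq p m x A B) (defJ : J = <<[set A; B]>> :> {set gT}).
Hypothesis cardJ : p ^ (7 * m) <= #|J|.
Local Notation q := (p ^ m)%N.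
Local Notation C := [~ A, B].
Local Notation Z n := 'Z_n(J).
Implicit Types z g w h : gT.
Let JA : A \in J := genA defJ.
Let JB : B \in J := genB defJ.
Let JC : C \in J := genC defJ.
Let q0 : 0 < q := q_gt0 p_pr m.

Lemma C_exp_mod_Z3 z z' u v : z \in Z 3 -> z' \in Z 3 ->
  z * C ^+ u = z' * C ^+ v -> u = v %[mod q].
Proof.
move=> Zz Zz' E; have nZ := subsetP (ucn_norm 3 J).
have [[NC Nz] Nz'] := (nZ C JC, nZ z (Z_J Zz), nZ z' (Z_J Zz')).
have Euv : coset (Z 3) C ^+ u = coset (Z 3) C ^+ v.
  have := congr1 (coset (Z 3)) E.
  by rewrite (morphM _ Nz (groupX u NC)) (morphM _ Nz' (groupX v NC)) !(morphX _ _ NC) /=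
    (coset_id Zz) (coset_id Zz') !mul1g.
have dv n : coset (Z 3) C ^+ n = 1 -> q %| n.
  rewrite -morphX // => /coset_idr -/(_ (groupX n NC)).
  exact: (C_mem_Z3 p_pr p_odd m_gt0 x_gt0 x_val x3 relAB defJ cardJ).
have qd : q %| #[coset (Z 3) C] by apply/dv/expg_order.
by move/eqP: Euv; rewrite eq_expg_mod_order => /eqP Euv;
  rewrite -(modn_dvdm u qd) Euv modn_dvdm.
Qed.

(** If p divided d, then f would send C^(p^(m-1)) into Z_3; but Z_3 is characteristic and C has
    order q modulo Z_3. *)
Lemma aut_C_unit f d w : f \in Aut J -> w \in Z 3 -> f C = w * C ^+ d -> ~~ (p %| d).
Proof.
move=> Af Zw E; apply/negP=> /dvdnP[d' Ed].
have Eq : (q = p * p ^ m.-1)%N by rewrite -expnS prednK.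
have nZ := subsetP (ucn_norm 3 J).
have [NC Nw] := (nZ C JC, nZ w (Z_J Zw)).
have C3 : C ^+ q \in Z 3.
  exact: Z_sub (C_Z2 p_pr p_odd m_gt0 x_gt0 x_val x3 relAB defJ cardJ) _.
have fZ : f (C ^+ (p ^ m.-1)) \in Z 3.
  have Nf : f (C ^+ (p ^ m.-1)) \in 'N(Z 3) by apply/nZ/(autJ Af)/groupX.
  apply: coset_idr => //; rewrite (autX _ Af JC) E morphX ?groupM ?groupX //.
  rewrite morphM ?groupX //= (coset_id Zw) mul1g -morphX ?groupX //.
  apply: coset_id; rewrite -expgM Ed -mulnA -Eq mulnC expgM groupX //.
have Afi : f^-1 \in Aut J by rewrite groupV.
have := aut_ucn Afi fZ; rewrite permK.
move/(C_mem_Z3 p_pr p_odd m_gt0 x_gt0 x_val x3 relAB defJ cardJ).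
by rewrite dvdn_Pexp2l ?prime_gt1 // -ltnS prednK // ltnn.
Qed.

Lemma aut_rel_mod f w w3 i j d : f \in Aut J -> w \in Z 4 -> w3 \in Z 3 ->
  f A = w * A ^+ i * B ^+ j -> f C = w3 * C ^+ d ->
  (q %| (i%:Z * (1 + 'C(x, 3)%:Z * (i%:Z * j%:Z) - d%:Z))%R)%Z /\
  (q %| (j%:Z * (1 + 'C(x, 3)%:Z * (i%:Z * j%:Z) + d%:Z))%R)%Z.
Proof.
move=> Af Zw Zw3 EA EC; have r := commAC (aut_relq relAB defJ Af).
rewrite -(autR Af JA JB) EA EC in r.
have /andP[h1 h2] := rel_mod_Z2 p_pr p_odd m_gt0 x_gt0 x_val x3 relAB defJ cardJ Zw Zw3 r.
split.
  have -> : (i%:Z * (1 + 'C(x, 3)%:Z * (i%:Z * j%:Z) - d%:Z) =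
    i%:Z + 'C(x, 3)%:Z * (i%:Z * i%:Z * j%:Z) - i%:Z * d%:Z)%R by ring.
  by have := dvdz_cong1 q0 h1; rewrite !PoszM.
have -> : (j%:Z * (1 + 'C(x, 3)%:Z * (i%:Z * j%:Z) + d%:Z) =
  j%:Z + 'C(x, 3)%:Z * (i%:Z * j%:Z * j%:Z) + j%:Z * d%:Z)%R by ring.
have : (q %| (j + 'C(x, 3) * (i * j * j) + j * d)%N%:Z)%Z by [].
by rewrite !PoszD !PoszM.
Qed.

End Diagonal.

Section DiagonalForm.
Variables (p m x : nat).
Hypotheses (p_pr : prime p) (p_odd : odd p) (m_gt0 : 0 < m).
Hypotheses (x_gt0 : 0 < x) (x_val : logn p x = m).
Hypothesis x3 : p = 3 -> m = 1%N -> (x %/ 3)%N = 1 %[mod 3].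
Variables (gT : finGroupType) (J : {group gT}) (A B : gT).
Hypotheses (relAB : relq p m x A B) (defJ : J = <<[set A; B]>> :> {set gT}).
Hypothesis cardJ : p ^ (7 * m) <= #|J|.
Local Notation q := (p ^ m)%N.
Local Notation C := [~ A, B].
Local Notation Z n := 'Z_n(J).
Implicit Types z g w h : gT.
Let defJ' : J = <<[set B; A]>> :> {set gT}. Proof. by rewrite defJ setUC. Qed.
Let JA : A \in J := genA defJ.
Let JB : B \in J := genB defJ.
Let JC : C \in J := genC defJ.
Let relBA := relq_sym relAB.

Lemma Z_conj n z g : z \in Z n -> g \in J -> z ^ g \in Z n.
Proof. by move=> Zz Jg; rewrite memJ_norm // (subsetP (ucn_norm n J)). Qed.

Lemma swap_mod_Z n z g h : z \in Z n -> g \in J -> h \in J -> [~ g, h] \in Z n ->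
  exists2 z', z' \in Z n & z * g * h = z' * h * g.
Proof.
move=> Zz Jg Jh Zgh; exists (z * [~ g, h] ^ (h * g)^-1).
  exact: groupM Zz (Z_conj Zgh (groupVr (groupM Jh Jg))).
have E : g * h = [~ g, h] ^ (h * g)^-1 * (h * g).
  by rewrite [_ ^ _]conjgE invgK (mulgA (h * g)) mulgKV -commgC.
by rewrite -mulgA E (mulgA z) (mulgA _ h).
Qed.

Lemma aut_congruences f w w' w3 i j k l d : f \in Aut J ->
  w \in Z 4 -> w' \in Z 4 -> w3 \in Z 3 ->
  f A = w * A ^+ i * B ^+ j -> f B = w' * A ^+ k * B ^+ l -> f C = w3 * C ^+ d ->
  let e := Posz 'C(x, 3) in
  (q %| (d%:Z + j%:Z * k%:Z - i%:Z * l%:Z)%R)%Z /\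
  [/\ (q %| (i%:Z * (1 + e * (i%:Z * j%:Z) - d%:Z))%R)%Z,
    (q %| (j%:Z * (1 + e * (i%:Z * j%:Z) + d%:Z))%R)%Z,
    (q %| (l%:Z * (1 + e * (l%:Z * k%:Z) - d%:Z))%R)%Z &
    (q %| (k%:Z * (1 + e * (l%:Z * k%:Z) + d%:Z))%R)%Z].
Proof.
move=> Af Zw Zw' Zw3 EA EB EC e; split.
  have [z Zz] := comm_mod_Z3 p_pr p_odd m_gt0 x_gt0 x_val x3 relAB defJ cardJ i j k l Zw Zw'.
  rewrite -EA -EB -(autR Af JA JB) EC -mulgA -expgD => E.
  have := C_exp_mod_Z3 p_pr p_odd m_gt0 x_gt0 x_val x3 relAB defJ cardJ Zw3 Zz E.
  by move/dvdz_cong2; rewrite PoszD !PoszM.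
have [h1 h2] := aut_rel_mod p_pr p_odd m_gt0 x_gt0 x_val x3 relAB defJ cardJ Af Zw Zw3 EA EC.
(* The other two congruences are the first two with A and B exchanged. The determinant d is
   unchanged, because [B, A] = C^-1 is also sent to its d-th power modulo Z_3. *)
have [v Zv Ev] : exists2 v, v \in Z 4 & f B = v * B ^+ l * A ^+ k.
  rewrite EB; apply: (swap_mod_Z Zw' (groupX k JA) (groupX l JB)).
  exact: (comm_Z4 p_pr p_odd m_gt0 x_gt0 x_val x3 relAB defJ cardJ (groupX k JA) (groupX l
    JB)).
have EC' : f [~ B, A] = w3^-1 ^ (C ^+ d) * [~ B, A] ^+ d.
  by rewrite -invg_comm (autV Af JC) EC invMg conjgE -expgVn -!mulgA expgVn mulgV mulg1.
have Zv3 := Z_conj (groupVr Zw3) (groupX d JC).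
by have [h3 h4] := aut_rel_mod p_pr p_odd m_gt0 x_gt0 x_val x3 relBA defJ' cardJ Af Zv Zv3
  Ev EC'.
Qed.

(** Otherwise p would divide the determinant d = i l - j k, against [aut_C_unit]. *)
Lemma aut_row_unit f w w' i j k l : f \in Aut J -> w \in Z 4 -> w' \in Z 4 ->
  f A = w * A ^+ i * B ^+ j -> f B = w' * A ^+ k * B ^+ l ->
  ~~ (p %| i) || ~~ (p %| k).
Proof.
move=> Af Zw Zw' EA EB; rewrite -negb_and; apply/negP => /andP[pi pk].
have CZ4 := C_Z4 p_pr p_odd m_gt0 x_gt0 x_val x3 relAB defJ cardJ.
have [w3 Zw3 [d EC]] := Z4_decomp p_pr p_odd m_gt0 x_gt0 x_val x3 relAB defJ cardJ (aut_ucn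
  Af CZ4).
have /negP[] := aut_C_unit p_pr p_odd m_gt0 x_gt0 x_val x3 relAB defJ cardJ Af Zw3 EC.
have [z Zz] := comm_mod_Z3 p_pr p_odd m_gt0 x_gt0 x_val x3 relAB defJ cardJ i j k l Zw Zw'.
rewrite -EA -EB -(autR Af JA JB) EC -mulgA -expgD => E.
have Em := C_exp_mod_Z3 p_pr p_odd m_gt0 x_gt0 x_val x3 relAB defJ cardJ Zw3 Zz E.
have pq : p %| q := dvd_p_q p m_gt0.
have := dvdn_mulr l pi; rewrite /dvdn -(modn_dvdm _ pq) -Em modn_dvdm //.
by rewrite -/(p %| _) dvdn_addl // dvdn_mull.
Qed.

Lemma aut_diag f w i j : f \in Aut J -> w \in Z 4 -> f A = w * A ^+ i * B ^+ j ->
  ~~ (p %| i) -> exists l u v w3, [/\ u \in Z 4, v \in Z 4 & w3 \in Z 3] /\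
  [/\ f A = u * A ^+ i, f B = v * B ^+ l, f C = w3 * C & i * l = 1 %[mod q]].
Proof.
move=> Af Zw EA pi.
have [w' Zw' [k [l EB]]] := gen_decomp p_pr p_odd m_gt0 x_gt0 x_val x3 relAB defJ cardJ
  (autJ Af JB).
have CZ4 := C_Z4 p_pr p_odd m_gt0 x_gt0 x_val x3 relAB defJ cardJ.
have [w3 Zw3 [d EC]] := Z4_decomp p_pr p_odd m_gt0 x_gt0 x_val x3 relAB defJ cardJ (aut_ucn
  Af CZ4).
have pd := aut_C_unit p_pr p_odd m_gt0 x_gt0 x_val x3 relAB defJ cardJ Af Zw3 EC.
have [h0 [h1 h2 h3 h4]] := aut_congruences Af Zw Zw' Zw3 EA EB EC.
have [qj qk qd ql] := diag_congruences p_pr p_odd m_gt0 h0 pd pi h1 h2 h3 h4.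
have [v Zv Ev] : exists2 v, v \in Z 4 & f A = v * B ^+ j * A ^+ i.
  rewrite EA; apply: (swap_mod_Z Zw (groupX i JA) (groupX j JB)).
  exact: (comm_Z4 p_pr p_odd m_gt0 x_gt0 x_val x3 relAB defJ cardJ (groupX i JA) (groupX j
    JB)).
have ZX (D : gT) n : D ^+ q \in Z 3 -> (q %| Posz n)%Z -> D ^+ n \in Z 4.
  rewrite dvdzE !absz_nat => DZ qn.
  exact: Z_sub (memX_dvd (H := 'Z_3(J)%G) DZ qn) (isT : 3 <= 4).
have A3 := A_Z3 p_pr p_odd m_gt0 x_gt0 x_val x3 relAB defJ cardJ.
have B3 := B_Z3 p_pr p_odd m_gt0 x_gt0 x_val x3 relAB defJ cardJ.
have i_gt0 : 0 < i by case: (i) pi; rewrite ?dvdn0.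
have modq a b : (q %| (Posz a - Posz b)%R)%Z -> a = b %[mod q].
  by rewrite -eqz_mod_dvd !modz_nat => /eqP[].
exists l, (v * B ^+ j), (w' * A ^+ k), (w3 * C ^+ d * C^-1).
have Cd : C ^+ d * C^-1 \in Z 3.
  have d1 : d = 1 %[mod q] := modq d 1%N qd.
  have C3 := Z_sub (C_Z2 p_pr p_odd m_gt0 x_gt0 x_val x3 relAB defJ cardJ) (isT : 2 <= 3).
  have cCC : commute (C ^+ d) C^-1 by apply/commuteV/commute_sym/commuteX.
  by rewrite cCC; exact: (memX_mod (H := 'Z_3(J)%G) C3 d1).
split; first split.
- exact: groupM Zv (ZX _ _ B3 qj).
- exact: groupM Zw' (ZX _ _ A3 qk).
- by rewrite -mulgA; exact: groupM Zw3 Cd.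
split=> //; first by rewrite mulgKV.
by apply: modq; rewrite PoszM.
Qed.

End DiagonalForm.

Lemma bin2_unit_mod p m i l : prime p -> odd p -> 0 < m -> ~~ (p %| i) ->
  (i * l = 1 %[mod p ^ m])%N -> (p ^ m %| i * 'C(l, 2))%N -> (l = 1 %[mod p ^ m])%N.
Proof.
move=> p_pr p_odd m_gt0 pi il qC.
have pl : ~~ (p %| l).
  apply/negP=> pl; have := dvdn_mull i pl; rewrite /dvdn -(modn_dvdm _ (dvd_p_q p m_gt0)) il.
  by rewrite modn_dvdm ?dvd_p_q // -/(p %| 1) dvdn1 => /eqP p1; move: p_pr; rewrite p1.
have l0 : 0 < l by case: (l) pl; rewrite ?dvdn0.
have H : p ^ m %| l.-1.
  rewrite -(pexp_mulK p_pr _ _ pl) mulnC -(bin1 l.-1) mul_bin_diag dvdn_mull //.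
  by rewrite -(pexp_mulK p_pr _ _ pi) mulnC.
by rewrite -[in LHS](prednK l0) -addn1 -modnDml (eqP H).
Qed.

(** * The relations modulo Z_1 for diagonal automorphisms *)

Section Unipotent.
Variables (p m x : nat).
Hypotheses (p_pr : prime p) (p_odd : odd p) (m_gt0 : 0 < m).
Hypotheses (x_gt0 : 0 < x) (x_val : logn p x = m).
Hypothesis x3 : p = 3 -> m = 1%N -> (x %/ 3)%N = 1 %[mod 3].
Variables (gT : finGroupType) (J : {group gT}) (A B : gT).
Hypotheses (relAB : relq p m x A B) (defJ : J = <<[set A; B]>> :> {set gT}).
Hypothesis cardJ : p ^ (7 * m) <= #|J|.
Local Notation q := (p ^ m)%N.
Local Notation C := [~ A, B].
Local Notation Z n := 'Z_n(J).
Local Notation phi := (coset (Z 2)).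
Implicit Types z g w h : gT.
Let defJ' : J = <<[set B; A]>> :> {set gT}. Proof. by rewrite defJ setUC. Qed.
Let JA : A \in J := genA defJ.
Let JB : B \in J := genB defJ.
Let JC : C \in J := genC defJ.
Let relBA := relq_sym relAB.

(** Modulo Z_2, B sends A^i to A^i C^i z0 with z0 a power of A, and C^i to C^i B^(x i). Iterating l
    times yields B^(x i C(l,2)) and C^(i l) = C. Only conjugation of A by the result matters later,
    so z0^l is recorded merely as commuting with A. *)
Lemma comm_pow_mod_Z2 i l : i * l = 1 %[mod q] ->
  exists y z, [/\ y \in Z 2, z \in J, commute z A &
    [~ A ^+ i, B ^+ l] = y * (z * B ^+ (x * (i * 'C(l, 2)))) * C].
Proof.
move=> il; pose z0 := A ^- (i * x.+1 ^ i) * A ^+ (x.+1 * geom x.+1 i).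
have rel : relpair x A B by case: relAB.
have A3 := A_Z3 p_pr p_odd m_gt0 x_gt0 x_val x3 relAB defJ cardJ.
have Zz0 : z0 \in Z 3.
  exact: (memX_mod (H := 'Z_3(J)%G) A3 (geom_al_mod_q p_pr p_odd m_gt0 x_gt0 x_val i)).
have cz0 : commute z0 A.
  apply: commute_sym; apply: commuteM; last exact: commuteX.
  by apply: commuteV; apply: commuteX.
have nZ g : g \in J -> g \in 'N(Z 2) := subsetP (ucn_norm 2 J) g.
have [[NA NB] NC] := (nZ A JA, nZ B JB, nZ C JC); have Nz0 := nZ _ (Z_J Zz0).
have Ed : (A ^+ i) ^ B = A ^+ i * (C ^+ i * z0).
  rewrite (conjXB rel) mulgA (conjgC (A ^+ i)) (conjXC rel) -mulgA; congr (_ * _).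
  by rewrite mulKVg.
have EX : (phi A ^+ i) ^ phi B = phi A ^+ i * (phi C ^+ i * phi z0).
  have := congr1 phi Ed.
  rewrite morphJ ?groupX //= (morphM _ (groupX i NA) (groupM (groupX i NC) Nz0)).
  by rewrite (morphM _ (groupX i NC) Nz0) !(morphX _ _ NA) (morphX _ _ NC).
have Cc z g : z \in Z 3 -> g \in J -> commute (phi z) (phi g) := @coset_Z3_commute _ J z g.
have Bx := coset_AX_commute p_pr p_odd m_gt0 x_gt0 x_val x3 relBA defJ' cardJ.
have CB := coset_CB p_pr p_odd m_gt0 x_gt0 x_val x3 relAB defJ cardJ.
have bxb := commute_sym (commuteX x (commute_refl (phi B))).
have ED : (phi C ^+ i * phi z0) ^ phi B = (phi C ^+ i * phi z0) * (phi B ^+ x) ^+ i.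
  have := conjXX_central i 1 CB bxb (Bx C JC); rewrite expg1 muln1 conjMg => ->.
  rewrite (conjg_commute (Cc _ _ Zz0 JB)) -!mulgA; congr (_ * _).
  by apply/commute_sym/commuteX/commuteX/Cc.
have xX (s t : coset_of (Z 2)) n : commute s t -> commute (s ^+ n) t.
  by move=> st; apply/commute_sym/commuteX/commute_sym.
have cF1 : commute ((phi B ^+ x) ^+ i) (phi C ^+ i * phi z0).
  apply: xX; apply: commuteM; first by apply: commuteX; apply: Bx.
  by apply: Bx; apply: Z_J Zz0.
have EG := conjX_class2 l EX ED cF1 (xX _ _ i bxb).
have E1 : [~ phi A ^+ i, phi B ^+ l] =
    phi z0 ^+ l * phi B ^+ (x * (i * 'C(l, 2))) * phi C.
  rewrite commgEl EG -mulgA mulKg -expgM -expgM.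
  have czc : commute (phi C ^+ i) (phi z0) by apply/commute_sym/commuteX/Cc.
  rewrite expgMn // -expgM.
  have -> : phi C ^+ (i * l) = phi C.
    have X4 := coset_ZX p_pr p_odd m_gt0 x_gt0 x_val x3 relAB defJ cardJ.
    have CZ4 := C_Z4 p_pr p_odd m_gt0 x_gt0 x_val x3 relAB defJ cardJ.
    by rewrite (expg_eq_mod (X4 _ CZ4) il).
  have cc : commute (phi C) (phi z0 ^+ l * phi B ^+ (x * (i * 'C(l, 2)))).
    apply: commuteM; first by apply/commuteX/commute_sym/Cc.
    by rewrite expgM; apply/commuteX/commute_sym/Bx.
  by rewrite -mulgA cc.
set n := (x * _)%N in E1 *.
pose G := [~ A ^+ i, B ^+ l]; pose h := z0 ^+ l * B ^+ n.
have JG : G \in J by rewrite groupR ?groupX.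
have Jh : h \in J by apply: groupM; [apply/groupX/Z_J/Zz0 | apply: groupX].
have [NG Nh] := (nZ G JG, nZ h Jh).
exists (G * (h * C)^-1), (z0 ^+ l); split.
- apply: coset_idr; first exact: groupM NG (groupVr (groupM Nh NC)).
  rewrite (morphM _ NG (groupVr (groupM Nh NC))) (morphV _ (groupM Nh NC)) /=.
  apply: (canLR (mulgK _)); rewrite mul1g.
  rewrite (morphM _ Nh NC) (morphM _ (groupX l Nz0) (groupX n NB)).
  rewrite (morphR _ (groupX i NA) (groupX l NB)) /= !(morphX _ _ NA) !(morphX _ _ NB).
  by rewrite (morphX _ _ Nz0).
- exact/groupX/Z_J/Zz0.
- by apply/commute_sym/commuteX/commute_sym.
by rewrite -mulgA mulgKV.
Qed.

(** Modulo Z_1 the hypothesis says that G = [A^i, B^l] raises A to the power alpha, as C does. By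
    [comm_pow_mod_Z2] the element B^n with n = x i C(l,2) then centralizes A modulo Z_1, so C^n lies
    in Z_1 and q^2 divides n. Hence q divides i C(l,2), which forces l = 1. *)
Lemma comm_pow_unit i l z y : z \in Z 3 -> y \in Z 2 -> ~~ (p %| i) ->
  i * l = 1 %[mod q] ->
  [~ A ^+ i * z, [~ A ^+ i, B ^+ l] * y] = (A ^+ i * z) ^+ x ->
  l = 1 %[mod q].
Proof.
move=> Zz Zy pi il E; set G := [~ A ^+ i, B ^+ l] in E.
have [y' [h [Zy' Jh hA EG]]] := comm_pow_mod_Z2 il.
have nZ g : g \in J -> g \in 'N(Z 1) := subsetP (ucn_norm 1 J) g.
have JAi := groupX i JA.
have ZG : G \in Z 4 := comm_Z4 p_pr p_odd m_gt0 x_gt0 x_val x3 relAB defJ cardJ JAi (groupX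
  l JB).
have JG := Z_J ZG; have [Jz Jy] := (Z_J Zz, Z_J Zy).
have [NA NG] := (nZ A JA, nZ G JG).
have ZAG : [~ A ^+ i, G] \in Z 3 by rewrite commC_mem; apply: Z_comm ZG JAi.
have E1 : [~ A ^+ i * z, G * y] = [~ A ^+ i * z, y] * ([~ A ^+ i, G] * [~ z, G]) ^ y.
  rewrite commgMJ [[~ _ * z, G]]commMgJ.
  by rewrite (conjg_commute (Z3_abelian p_pr p_odd m_gt0 x_gt0 x_val x3 relAB defJ cardJ
    ZAG Zz)).
have ZzG : [~ z, G] \in Z 1 := Z3_Z4 p_pr p_odd m_gt0 x_gt0 x_val x3 relAB defJ cardJ Zz ZG.
have ZXy : [~ A ^+ i * z, y] \in Z 1 by rewrite commC_mem; apply: Z_comm Zy (groupM JAi Jz).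
have cAGy : commute ([~ A ^+ i, G] * [~ z, G]) y.
  apply: (Z3_abelian p_pr p_odd m_gt0 x_gt0 x_val x3 relAB defJ cardJ).
    exact: groupM ZAG (Z_sub ZzG (isT : 1 <= 3)).
  exact: Z_sub Zy (isT : 2 <= 3).
rewrite (conjg_commute cAGy) in E1.
have E2 := Z3_expM p_pr p_odd m_gt0 x_gt0 x_val x3 relAB defJ cardJ x JAi Zz.
have Z1r : z ^+ x * [~ z, A ^+ i] ^+ 'C(x, 2) * [~ [~ z, A ^+ i], A ^+ i] ^+ 'C(x, 3) \in Z 1.
  have Zv := Z_comm Zz JAi.
  have Ev := Z2_exp p_pr p_odd m_gt0 x_gt0 x_val x3 relAB defJ cardJ Zv.
  have qx : q %| x := dvd_q_x p_pr x_gt0 x_val.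
  rewrite (expq_dvd Ev (dvd_q_bin2 p_pr p_odd qx)) mulg1.
  apply: groupM; first exact: (Z3_expx p_pr p_odd m_gt0 x_gt0 x_val x3 relAB defJ cardJ Zz).
  exact: groupX (Z_comm Zv JAi).
have E3 : coset (Z 1) [~ A ^+ i, G] = coset (Z 1) (A ^+ i ^+ x).
  have := congr1 (coset (Z 1)) E; rewrite E1 E2.
  have NAG := nZ _ (Z_J ZAG).
  have NzG := nZ _ (Z_J ZzG); have NXy := nZ _ (Z_J ZXy); have Nr := nZ _ (Z_J Z1r).
  rewrite (morphM _ NXy (groupM NAG NzG)) (morphM _ NAG NzG) (morphM _ (groupX x (groupX i
    NA)) Nr) /=.
  by rewrite (coset_id ZXy) (coset_id ZzG) (coset_id Z1r) mul1g !mulg1.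
set n := (x * _)%N in EG; set a := coset (Z 1) A.
have [NB NC] := (nZ B JB, nZ C JC).
have Ny' := nZ _ (Z_J Zy').
have a2 : a ^+ (p ^ (2 * m)) = 1.
  by rewrite -morphX //; apply/coset_id/(A_Z1 p_pr p_odd m_gt0 x_gt0 x_val x3 relAB defJ
    cardJ).
(* a^(q^2) = 1, so an inverse of i modulo q^2 recovers a from a^i. *)
have [v iv] : exists v, i * v = 1 %[mod p ^ (2 * m)].
  by apply: coprime_inv_mod; apply: coprimeXl; rewrite prime_coprime.
have aG : a ^ coset (Z 1) G = a ^+ x.+1.
  have E4 : a ^+ i ^ coset (Z 1) G = a ^+ i ^+ x.+1.
    rewrite conjg_mulR expgS; congr (_ * _).
    by move: E3; rewrite morphR ?groupX //= !morphX ?groupX.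
  have Ea : a = a ^+ i ^+ v by rewrite -expgM (expg_eq_mod a2 iv).
  by rewrite {1}Ea conjXg E4 -expgM mulnC expgM -Ea.
have aC : a ^ coset (Z 1) C = a ^+ x.+1.
  have rel : relpair x A B by case: relAB.
  by rewrite -morphJ //= rel.1 morphX.
have Nh := nZ h Jh.
have ay' : a ^ coset (Z 1) y' = a.
  apply/conjg_fixP; rewrite -(morphR _ NA Ny') /=; apply/eqP/coset_id.
  by rewrite commC_mem; apply: Z_comm Zy' JA.
have ah : a ^ coset (Z 1) h = a.
  by apply/conjg_fixP; rewrite -(morphR _ NA Nh) /= (commute_comm1 (commute_sym hA)) morph1.
have aB : a ^ coset (Z 1) (B ^+ n) = a.
  apply: (@conjg_inj _ (coset (Z 1) C)); rewrite aC -aG /G EG.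
  have NhB := groupM Nh (groupX n NB).
  rewrite (morphM _ (groupM Ny' NhB) NC) (morphM _ Ny' NhB) (morphM _ Nh (groupX n NB)) /=.
  by rewrite !conjgM ay' ah.
have AB1 : [~ A, B ^+ n] \in Z 1.
  apply: coset_idr; first by rewrite groupR ?groupX.
  by rewrite (morphR _ NA (groupX n NB)) /= -/a; apply/eqP/conjg_fixP.
have qn : q %| n by rewrite dvdn_mulr // dvd_q_x.
have B1 := B_Z1 p_pr p_odd m_gt0 x_gt0 x_val x3 relAB defJ cardJ.
have rel' : relpair x B A by case: relBA.
have C1 : C ^+ n \in Z 1.
  have := commXB_mod (H := 'Z_1(J)%G) rel' B1 (geom_al_mod_q2 p_pr p_odd m_gt0 x_gt0 x_val qn).
  rewrite commC_mem AB1 -invg_comm expgVn groupV => <- //.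
have := C_mem_Z1 p_pr p_odd m_gt0 x_gt0 x_val x3 relAB defJ cardJ C1.
rewrite /n (mulnC x) mul2n -addnn (dvd_x_q p_pr x_gt0 x_val).
exact: bin2_unit_mod.
Qed.

End Unipotent.

Section AutJ.
Variables (p m x : nat).
Hypotheses (p_pr : prime p) (p_odd : odd p) (m_gt0 : 0 < m).
Hypotheses (x_gt0 : 0 < x) (x_val : logn p x = m).
Hypothesis x3 : p = 3 -> m = 1%N -> (x %/ 3)%N = 1 %[mod 3].
Variables (gT : finGroupType) (J : {group gT}) (A B : gT).
Hypotheses (relAB : relq p m x A B) (defJ : J = <<[set A; B]>> :> {set gT}).
Hypothesis cardJ : p ^ (7 * m) <= #|J|.
Local Notation q := (p ^ m)%N.
Local Notation C := [~ A, B].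
Local Notation Z n := 'Z_n(J).
Implicit Types z g w h : gT.
Let defJ' : J = <<[set B; A]>> :> {set gT}. Proof. by rewrite defJ setUC. Qed.
Let JA : A \in J := genA defJ.
Let JB : B \in J := genB defJ.
Let JC : C \in J := genC defJ.
Let relBA := relq_sym relAB.
Let q0 : 0 < q := q_gt0 p_pr m.

(** The factors z and w are central modulo Z_2, so f C is [A^i, B^l] up to an element of Z_2, as
    [comm_pow_unit] requires. *)
Lemma aut_normal_Aut4 f z w i l : f \in Aut J -> z \in Z 3 -> w \in Z 3 ->
  f A = A ^+ i * z -> f B = B ^+ l * w -> ~~ (p %| i) -> i * l = 1 %[mod q] ->
  f \in Auti J 4.
Proof.
move=> Af Zz Zw EA EB pi il; have E := commAC (aut_relq relAB defJ Af).
have nZ g : g \in J -> g \in 'N(Z 2) := subsetP (ucn_norm 2 J) g.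
have [JAi JBl] := (groupX i JA, groupX l JB).
pose G := [~ A ^+ i, B ^+ l]; have JG : G \in J by rewrite groupR.
have Zy : G^-1 * [~ f A, f B] \in Z 2.
  have JR : [~ f A, f B] \in J by rewrite groupR ?(autJ Af).
  apply: coset_idr; first exact/nZ/(groupM (groupVr JG) JR).
  rewrite (morphM _ (nZ _ (groupVr JG)) (nZ _ JR)) (morphV _ (nZ _ JG)) /=.
  apply: (canLR (mulKg _)); rewrite mulg1.
  rewrite (morphR _ (nZ _ (autJ Af JA)) (nZ _ (autJ Af JB))) /= EA EB.
  rewrite (morphM _ (nZ _ JAi) (nZ _ (Z_J Zz))) (morphM _ (nZ _ JBl) (nZ _ (Z_J Zw))) /=.
  rewrite (morphR _ (nZ _ JAi) (nZ _ JBl)) /=.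
  have cz g : g \in J -> commute (coset (Z 2) z) (coset (Z 2) g).
    exact: coset_Z3_commute Zz.
  have cw g : g \in J -> commute (coset (Z 2) w) (coset (Z 2) g).
    exact: coset_Z3_commute Zw.
  move: (cz _ JAi) (cz _ JBl) (cz _ (Z_J Zw)) (cw _ JAi) (cw _ JBl).
  move: (coset (Z 2) (A ^+ i)) (coset (Z 2) (B ^+ l)) (coset (Z 2) z) (coset (Z 2) w).
  move=> a b u v ua ub uv va vb; rewrite commMgJ.
  have -> : [~ u, b * v] = 1 by apply: commute_comm1; apply: commuteM.
  rewrite mulg1 commgMJ (commute_comm1 (commute_sym va)) mul1g.
  have cab s : commute s a -> commute s b -> [~ a, b] ^ s = [~ a, b].
    by move=> sa sb; rewrite conjRg !conjg_commute //; apply: commute_sym.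
  by rewrite cab // cab.
have l1 : l = 1 %[mod q].
  apply: (comm_pow_unit p_pr p_odd m_gt0 x_gt0 x_val x3 relAB defJ cardJ Zz Zy pi il).
  by rewrite mulKVg -EA.
have i1 : i = 1 %[mod q] by rewrite -il -[RHS]modnMmr l1 modnMmr muln1.
have ZX (D u : gT) n : D ^+ q \in Z 3 -> u \in Z 3 -> n = 1 %[mod q] ->
    D^-1 * (D ^+ n * u) \in Z 4.
  move=> DZ Zu n1; rewrite mulgA.
  exact: Z_sub (groupM (memX_mod (H := 'Z_3(J)%G) DZ n1) Zu) (isT : 3 <= 4).
have A3 := A_Z3 p_pr p_odd m_gt0 x_gt0 x_val x3 relAB defJ cardJ.
have B3 := B_Z3 p_pr p_odd m_gt0 x_gt0 x_val x3 relAB defJ cardJ.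
apply: (Auti_gen defJ Af) => g /set2P[]->.
  by rewrite EA; exact: ZX A3 Zz i1.
by rewrite EB; exact: ZX B3 Zw l1.
Qed.

(** Composing f with a suitable inner automorphism removes the powers of C from the images of A and
    B, which leaves A^i and B^l modulo Z_3. Inner automorphisms lie in Aut_4, so the conclusion
    passes back to f. *)
Lemma aut_unit_Aut4 f w i j : f \in Aut J -> w \in Z 4 ->
  f A = w * A ^+ i * B ^+ j -> ~~ (p %| i) -> f \in Auti J 4.
Proof.
move=> Af Zw E pi.
have [l [u [v [w3 [[Zu Zv Zw3] [EA EB EC il]]]]]] :=
  aut_diag p_pr p_odd m_gt0 x_gt0 x_val x3 relAB defJ cardJ Af Zw E pi.
have [z Zz [k Ek]] := Z4_decomp p_pr p_odd m_gt0 x_gt0 x_val x3 relAB defJ cardJ Zu.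
have [z' Zz' [n En]] := Z4_decomp p_pr p_odd m_gt0 x_gt0 x_val x3 relAB defJ cardJ Zv.
(* (q - 1) k stands for -k, as C^q lies in Z_3. *)
have [g Jg [gA gB]] := conj_mod_Z3 p_pr p_odd m_gt0 x_gt0 x_val x3 relAB defJ cardJ ((q -
  1) * k) ((q - 1) * n).
have Ag := conj_aut_Aut Jg.
have nZ h : h \in J -> h \in 'N(Z 3) := subsetP (ucn_norm 3 J) h.
have CZ4 := C_Z4 p_pr p_odd m_gt0 x_gt0 x_val x3 relAB defJ cardJ.
have C3 := Z_sub (C_Z2 p_pr p_odd m_gt0 x_gt0 x_val x3 relAB defJ cardJ) (isT : 2 <= 3).
have key (D X t : gT) e : D \in J -> X \in J -> t \in Z 3 -> f D = t * C ^+ e * X ->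
    (D * C ^+ ((q - 1) * e))^-1 * D ^ g \in Z 3 ->
    X^-1 * (conj_aut J g * f) D \in Z 3.
  move=> JD JX Zt ED; set s := _ * _ ^ _ => Zs.
  have JDC := groupM JD (groupX ((q - 1) * e) JC).
  have -> : (conj_aut J g * f) D = f D * f C ^+ ((q - 1) * e) * f s.
    rewrite permM conj_autJ // -(autX _ Af JC) -(autM Af JD (groupX _ JC)) -(autM Af JDC
      (Z_J Zs)).
    by rewrite mulKVg.
  have Zfs := aut_ucn Af Zs.
  have [[[NX Nt] NC] Nfs] := (nZ _ JX, nZ _ (Z_J Zt), nZ _ JC, nZ _ (Z_J Zfs)).
  have Nw3 := nZ _ (Z_J Zw3).
  have N1 := groupM (groupM Nt (groupX e NC)) NX.
  rewrite ED EC; apply: coset_idr.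
    exact: groupM (groupVr NX) (groupM (groupM N1 (groupX _ (groupM Nw3 NC))) Nfs).
  rewrite (morphM _ (groupVr NX) (groupM (groupM N1 (groupX _ (groupM Nw3 NC))) Nfs))
    (morphV _ NX).
  rewrite (morphM _ (groupM N1 (groupX _ (groupM Nw3 NC))) Nfs) (morphM _ N1 (groupX _
    (groupM Nw3 NC))).
  rewrite (morphM _ (groupM Nt (groupX e NC)) NX) (morphM _ Nt (groupX e NC)).
  rewrite (morphX _ _ (groupM Nw3 NC)) (morphM _ Nw3 NC) (morphX _ _ NC) /=.
  rewrite (coset_id Zt) (coset_id Zw3) (coset_id Zfs) !mul1g mulg1.
  have cq : coset (Z 3) C ^+ q = 1 by rewrite -(morphX _ _ NC); apply: coset_id.
  have cC : commute (coset (Z 3) C) (coset (Z 3) X).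
    apply/commgP; rewrite -(morphR _ NC NX) /=; apply/eqP/coset_id.
    exact: Z_comm CZ4 JX.
  rewrite (commute_sym (commuteX e (commute_sym cC))) -mulgA mulKg -expgD.
  by rewrite -mulSn subn1 (prednK q0) expgM cq expg1n.
have HA : (A ^+ i)^-1 * (conj_aut J g * f) A \in Z 3.
  by apply: (key A _ z k JA (groupX i JA) Zz _ gA); rewrite EA Ek.
have HB : (B ^+ l)^-1 * (conj_aut J g * f) B \in Z 3.
  by apply: (key B _ z' n JB (groupX l JB) Zz' _ gB); rewrite EB En.
have A4 : conj_aut J g * f \in Auti J 4.
  exact: (aut_normal_Aut4 (groupM Ag Af) HA HB (esym (mulKVg _ _)) (esym (mulKVg _ _)) pi il).
have I4 : conj_aut J g \in Auti J 4.
  apply: (subsetP (Inn_sub_Aut4 p_pr p_odd m_gt0 x_gt0 x_val x3 relAB defJ cardJ)).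
  by rewrite /Inn; apply: mem_morphim; rewrite // (subsetP (normG J)).
rewrite -(mulKg (conj_aut J g) f); exact: groupM (groupVr I4) A4.
Qed.

Lemma Aut_swap : exists theta : {perm gT},
  [/\ theta \in Aut J, theta A = B & theta B = A] /\
  [/\ Auti J 4 = Inn J * Auti J 3, Aut J = <[theta]> * Auti J 4
    & #|Aut J| = (2 * p ^ (8 * m))%N].
Proof.
have [theta [Ath thA thB]] :=
  aut_of_pair p_pr p_odd m_gt0 x_gt0 x_val x3 defJ defJ' relAB relBA cardJ.
have AutE : Aut J = <[theta]> * Auti J 4.
  apply/eqP; rewrite eqEsubset; apply/andP; split; last first.
    rewrite mul_subG ?cycle_subG //; apply/subsetP=> f; exact: Auti_Aut.
  apply/subsetP=> f Af.
  have dec := gen_decomp p_pr p_odd m_gt0 x_gt0 x_val x3 relAB defJ cardJ.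
  have [w Zw [i [j EA]]] := dec _ (autJ Af JA).
  have [w' Zw' [k [l EB]]] := dec _ (autJ Af JB).
  have := aut_row_unit p_pr p_odd m_gt0 x_gt0 x_val x3 relAB defJ cardJ Af Zw Zw' EA EB.
  case/orP=> [pi|pk].
    by rewrite -(mul1g f); apply: mem_mulg; [exact: group1 | exact: aut_unit_Aut4 Af Zw EA pi].
  (* Precomposing with theta puts the entry k, prime to p, in the place of i. *)
  have EB' : (theta * f) A = w' * A ^+ k * B ^+ l by rewrite permM thA.
  rewrite -(mulKg theta f); apply: mem_mulg; first by rewrite groupV cycle_id.
  exact: (aut_unit_Aut4 (groupM Ath Af) Zw' EB' pk).
have th4 : theta \notin Auti J 4.
  apply/negP=> /Auti_mem/(_ JA); rewrite thA => ZAB.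
  have A4 := Z_sub (A_Z3 p_pr p_odd m_gt0 x_gt0 x_val x3 relAB defJ cardJ) (isT : 3 <= 4).
  (* A^(q-1) B is A^-1 B modulo Z_4, in the form with natural exponents that [AB_Z4] accepts. *)
  have : A ^+ (q - 1) * B ^+ 1 \in Z 4.
    rewrite expg1 -(mulKVg A B) mulgA -expgSr subn1 prednK //; exact: groupM A4 ZAB.
  move/(AB_Z4 p_pr p_odd m_gt0 x_gt0 x_val x3 relAB defJ cardJ)=> /andP[_].
  by rewrite dvdn1 -(expn0 p) eqn_exp2l ?prime_gt1 // => /eqP m0; move: m_gt0; rewrite m0.
exists theta; split; first exact: And3 Ath thA thB.
apply: (And3 (Aut4_Inn_Aut3 p_pr p_odd m_gt0 x_gt0 x_val x3 relAB defJ cardJ) AutE _).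
have th2 : theta ^+ 2 = 1.
  apply: (eq_Aut_gen defJ (groupX 2 Ath) (group1 _)) => g /set2P[]->;
    rewrite expgS expg1 permM perm1.
    by rewrite thA thB.
  by rewrite thB thA.
have o2 : #[theta] = 2.
  apply: nt_prime_order => //; apply: contraNneq th4 => ->; exact: group1.
rewrite AutE (TI_cardMg (G := <[theta]>%G) (H := ('ker (can_aut J 4))%G)).
  rewrite -/(#[theta]) o2 -(card_Aut4 p_pr p_odd m_gt0 x_gt0 x_val x3 relAB defJ cardJ) //.
by apply: prime_TIg; rewrite -?orderE ?o2 // cycle_subG.
Qed.

End AutJ.

Theorem theorem4p5 (p m alpha : nat) (p_prime : prime p) (p_odd : odd p)
    (m_gt0 : 0 < m) (alpha_gt1 : 1 < alpha)
    (alpha_val : logn p (alpha - 1)%N = m)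
    (alpha3 : p = 3 -> m = 1%N -> ((alpha - 1) %/ 3)%N = 1 %[mod 3])
    (gT : finGroupType) (J : {group gT}) (A B : gT)
    (genJ : J = <<[set A; B]>> :> {set gT})
    (relA : A ^ [~ A, B] = A ^+ alpha)
    (relB : B ^ [~ B, A] = B ^+ alpha)
    (ordA : A ^+ (p ^ (3 * m))%N = 1)
    (ordB : B ^+ (p ^ (3 * m))%N = 1)
    (presJ : J \isog Grp (a : b :
               a ^ [~ a, b] = a ^+ alpha, b ^ [~ b, a] = b ^+ alpha,
               a ^+ (p ^ (3 * m))%N = b ^+ (p ^ (3 * m))%N = 1)) :
  exists theta : {perm gT},
    [/\ theta \in Aut J, theta A = B & theta B = A] /\
    [/\ Auti J 4 = Inn J * Auti J 3,
        Aut J = <[theta]> * Auti J 4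
      & #|Aut J| = (2 * p ^ (8 * m))%N].
Proof.
have alphaE : alpha = (alpha - 1).+1 by rewrite -addn1 subnK // ltnW.
move: (alpha - 1)%N alphaE alpha_val alpha3 => x Ea x_val x3; subst alpha.
have x_gt0 : 0 < x by [].
have relAB : relq p m x A B by [].
(* The model satisfies the relations, so the presentation makes it a homomorphic image of J. *)
have cardJ : p ^ (7 * m) <= #|J|.
  have [hT [a [b [ra rb a1 b1 card_ab]]]] := model_exists p_prime p_odd m_gt0 x_gt0 x_val.
  apply: leq_trans card_ab _.
  exact: (pres_card_ge presJ (And3 (conj ra rb) a1 b1)).
exact: (Aut_swap p_prime p_odd m_gt0 x_gt0 x_val x3 relAB genJ cardJ).
Qed.
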